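(* Let $n$ be a positive integer, $m$ an integer with $2\le m\le n$, $S\in\mathbf G(n,m)$, let $V$ be an $m$-dimensional stationary integral varifold in $\mathbf R^n$, and let $A=\operatorname{spt}\|V\|$. Then, for $\mathscr H^m$ almost all $a\in A\cap S$, the set $A$ is strongly pointwise differentiable of every positive integer order at $a$.
   Context: $\mathbf G(n,m)$ is the set of $m$-dimensional linear subspaces of $\mathbf R^n$ and $S^\perp$ denotes the orthogonal complement of $S$. $\mathscr H^m$ is $m$-dimensional Hausdorff measure. $\operatorname{dist}(x,A)=\inf\{|x-a|:a\in A\}$; $\mathbf B(a,r)$ is the closed ball. An $m$-dimensional varifold $V$ in an open set $U\subset\mathbf R^n$ is a Radon measure on $U\times\mathbf G(n,m)$; its weight is $\|V\|(E)=V(E\times\mathbf G(n,m))$; its first variation is $\delta V(g)=\int \operatorname{trace}(S_\natural\circ\mathrm Dg(x))\,\mathrm dV(x,S)$ for smooth compactly supported $g:U\to\mathbf R^n$, where $S_\natural$ is the orthogonal projection onto $S$. $V$ is stationary if $\delta V=0$. $V$ is integral if there are a countably $(\mathscr H^m,m)$ rectifiable, $\mathscr H^m$ measurable set $E\subset U$ and a positive-integer-valued function $\theta$ on $E$, locally $\mathscr H^m\llcorner E$ integrable, such that $\int f\,\mathrm dV=\int_E f(x,T_xE)\theta(x)\,\mathrm d\mathscr H^m x$ for continuous compactly supported $f$ on $U\times \mathbf G(n,m)$, with $T_xE$ the approximate tangent plane. Strong pointwise differentiability of order $k$ ($k$ a positive integer) of $A\subset\mathbf R^n$ at $a$: there exist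 an integer $0\le\ell\le n$, $T\in\mathbf G(n,\ell)$, and a polynomial function $P:T\to T^\perp$ of degree at most $k$ such that $B=\{\chi+P(\chi):\chi\in T\}$ satisfies $a\in B$ and $\lim_{r\to0+}r^{-k}\sup\{|\operatorname{dist}(x,A)-\operatorname{dist}(x,B)|:x\in\mathbf B(a,r)\}=0$. *)

(* Defs.v *)
From HB Require Import structures.
From mathcomp Require Import all_boot all_order all_algebra.
From mathcomp Require Import all_classical all_reals all_analysis.

Set Implicit Arguments.
Unset Strict Implicit.
Unset Printing Implicit Defensive.

Import Order.TTheory GRing.Theory Num.Theory.
Import numFieldTopology.Exports numFieldNormedType.Exports.

Local Open Scope classical_set_scope.
Local Open Scope ring_scope.

(** The library's norm on ['rV[R]_n] is the sup norm. It is used below only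
    through the topology, differentiability, boundedness and the Lipschitz
    property, which do not depend on the choice of norm; every metric quantity
    (diameters, balls, distances) uses the Euclidean norm [enorm]. *)
Section Euclidean.
Context {R : realType} {n : nat}.
Implicit Types (x y a : 'rV[R]_n) (A : set 'rV[R]_n) (S : {vspace 'rV[R]_n}).

Definition dotp x y : R := \sum_i x 0 i * y 0 i.

Definition enorm x : R := Num.sqrt (dotp x x).

Definition eball a (r : R) : set 'rV[R]_n := [set x | enorm (x - a) <= r].

(** Equal to [+oo] when [A] is empty. *)
Definition edist x A : \bar R := ereal_inf [set (enorm (x - a))%:E | a in A].

(** The [0] makes the diameter of the empty set [0] instead of [-oo]. *)
Definition ediam A : \bar R :=
  ereal_sup [set d | d = 0%E \/
    exists x y, [/\ A x, A y & d = (enorm (x - y))%:E]].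

Definition orthcomp S : {vspace 'rV[R]_n} :=
  lker (linfun (mulmxr (\matrix_(i < \dim S) (vbasis S)`_i)^T)).

Lemma memv_orthcomp S x :
  reflect {in S, forall y, dotp x y = 0} (x \in orthcomp S).
Proof.
apply: (iffP idP); rewrite memv_ker lfunE /=.
  move=> /eqP h y /coord_vbasis ->; rewrite /dotp.
  under eq_bigr => i _.
    rewrite summxE mulr_sumr.
    under eq_bigr => j _ do rewrite mxE mulrCA.
    over.
  rewrite exchange_big big1//= => j _; rewrite -mulr_sumr.
  suff -> : \sum_i x 0 i * (vbasis S)`_j 0 i = 0 by rewrite mulr0.
  have /rowP/(_ j) := h; rewrite !mxE => {2}<-.
  by apply: eq_bigr => i _; rewrite !mxE.
move=> h; apply/eqP/rowP => j; rewrite !mxE.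
rewrite -[RHS](h (vbasis S)`_j).
  by apply: eq_bigr => i _; rewrite !mxE.
by apply: vbasis_mem; rewrite mem_nth ?size_tuple.
Qed.

Definition orthproj S : 'End('rV[R]_n) := daddv_pi S (orthcomp S).

Lemma orthcomp_disjoint S : (S :&: orthcomp S = 0)%VS.
Proof.
apply/eqP; rewrite -subv0; apply/subvP => x /memv_capP[xS /memv_orthcomp/(_ _ xS)].
move=> /eqP; rewrite /dotp psumr_eq0 => [|i _]; last by rewrite -expr2 sqr_ge0.
move=> /allP h; rewrite memv0; apply/eqP/rowP => i; rewrite mxE; apply/eqP.
by have := h i (mem_index_enum _); rewrite mulf_eq0 orbb.
Qed.

Lemma addv_orthcomp S : (S + orthcomp S)%VS = fullv.
Proof.
apply/eqP; rewrite eqEdim subvf /= -(leq_add2r (\dim (S :&: orthcomp S))).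
rewrite dimv_sum_cap orthcomp_disjoint dimv0 addn0.
pose f : 'Hom('rV[R]_n, 'rV[R]_(\dim S)) :=
  linfun (mulmxr (\matrix_(i < \dim S) (vbasis S)`_i)^T).
have := limg_ker_dim f fullv; rewrite capfv -[lker f]/(orthcomp S) => <-.
rewrite addnC leq_add2r.
by rewrite (leq_trans (dimvS (subvf _)))// dimvf /dim /= mul1n.
Qed.

Lemma orthprojP S x :
  orthproj S x \in S /\ x - orthproj S x \in orthcomp S.
Proof.
split; first exact: memv_pi.
have xS : x \in (S + orthcomp S)%VS by rewrite addv_orthcomp memvf.
rewrite -[X in X - _](daddv_pi_add (orthcomp_disjoint S) xS).
by rewrite addrC addKr memv_pi.
Qed.

End Euclidean.

Section Hausdorff.
Context {R : realType}.

(** Volume of the unit ball of R^m, that is [pi^(m/2) / Gamma(m/2 + 1)]. *)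
Fixpoint ball_volume (m : nat) : R :=
  match m with
  | 0 => 1
  | 1 => 2
  | k.+2 => 2 * pi / k.+2%:R * ball_volume k
  end.

Context {n : nat}.
Implicit Types (m : nat) (A : set 'rV[R]_n).

(** The case distinction matters only for [m = 0], where [0 ^+ 0 = 1]. *)
Definition hausdorff_gauge m A : \bar R :=
  if A == set0 then 0%E else
  ((ball_volume m / 2 ^+ m)%:E * ediam A ^+ m)%E.

Definition hausdorff_pre m (delta : R) A : \bar R :=
  ereal_inf [set (\sum_(k <oo) hausdorff_gauge m (F k))%E | F in
    [set F : nat -> set 'rV[R]_n |
      A `<=` \bigcup_k F k /\ forall k, (ediam (F k) <= delta%:E)%E]].

Definition hausdorff m A : \bar R :=
  ereal_sup [set hausdorff_pre m delta A | delta in [set d : R | 0 < d]].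

End Hausdorff.

Section HausdorffOuterMeasure.
Context {R : realType} {n : nat} (m : nat).
Local Open Scope ereal_scope.

Lemma ediam_ge0 (A : set 'rV[R]_n) : 0 <= ediam A.
Proof. by apply: ereal_sup_ubound; left. Qed.

Lemma ediam_set0 : ediam (set0 : set 'rV[R]_n) = 0.
Proof.
apply/eqP; rewrite eq_le ediam_ge0 andbT.
by apply: ge_ereal_sup => e [->//|[x [y [x0]]]]; case: x0.
Qed.

Lemma ball_volume_gt0 (k : nat) : (0 < ball_volume k :> R)%R.
Proof.
suff: (0 < ball_volume k :> R)%R && (0 < ball_volume k.+1 :> R)%R by case/andP.
elim: k => [|k /andP[k0 k1]]; first by rewrite /= ltr01 ltr0n.
by rewrite k1 /= mulr_gt0// divr_gt0// mulr_gt0// pi_gt0.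
Qed.

Lemma hausdorff_gauge_ge0 (A : set 'rV[R]_n) : 0 <= hausdorff_gauge m A.
Proof.
rewrite /hausdorff_gauge; case: ifP => // _; apply: mule_ge0.
  by rewrite lee_fin divr_ge0// ?exprn_ge0// ltW// ball_volume_gt0.
by rewrite expe_ge0// ediam_ge0.
Qed.

Let dT := g_sigma_algebraType [set: set 'rV[R]_n].

Let gauge (d : R) (A : set dT) : \bar R :=
  if ediam (A : set 'rV[R]_n) <= d%:E then hausdorff_gauge m A else +oo.

Let gauge_ge0 d A : 0 <= gauge d A.
Proof. by rewrite /gauge; case: ifP => // _; exact: hausdorff_gauge_ge0. Qed.

Let gauge0 d : (0 < d)%R -> gauge d set0 = 0.
Proof.
by move=> d0; rewrite /gauge ediam_set0 lee_fin (ltW d0) /hausdorff_gauge eqxx.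
Qed.

Let hausdorff_preE d : hausdorff_pre m d = mu_ext (gauge d).
Proof.
apply/funext => A; apply/eqP; rewrite eq_le; apply/andP; split.
  apply: le_ereal_inf_tmp => _ [F [_ AF] <-].
  have [Fd|] := pselect (forall k, ediam (F k : set 'rV[R]_n) <= d%:E).
    apply: ereal_inf_lbound; exists F => //.
    by apply: eq_eseriesr => k _; rewrite /gauge Fd.
  move=> /existsNP[k /negP Fk]; rewrite (eseries_pinfty (k := k)) ?leey//.
    by move=> i _; rewrite -ltNye (lt_le_trans _ (gauge_ge0 _ _)).
  by rewrite /gauge (negbTE Fk).
apply: le_ereal_inf_tmp => _ [F [AF Fd] <-].
apply: ereal_inf_lbound; exists F.
  by split=> // i; exact: sub_sigma_algebra.
by apply: eq_eseriesr => k _; rewrite /gauge Fd.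
Qed.

Let hausdorff0 : hausdorff m (set0 : set 'rV[R]_n) = 0.
Proof.
apply/eqP; rewrite eq_le; apply/andP; split.
  by apply: ge_ereal_sup => _ [d d0 <-]; rewrite hausdorff_preE mu_ext0// gauge0.
apply: (@le_trans _ _ (hausdorff_pre m 1 (set0 : set 'rV[R]_n))).
  by rewrite hausdorff_preE mu_ext_ge0// gauge0.
by apply: ereal_sup_ubound; exists 1%R => //=; exact: ltr01.
Qed.

Let le_hausdorff :
  {homo (hausdorff m : set 'rV[R]_n -> \bar R) : A B / A `<=` B >-> A <= B}.
Proof.
move=> A B AB; apply: ge_ereal_sup => _ [d d0 <-].
apply: (@le_trans _ _ (hausdorff_pre m d B)).
  by rewrite !hausdorff_preE; exact: le_mu_ext.
by apply: ereal_sup_ubound; exists d.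
Qed.

Let hausdorff_ge0 (A : set 'rV[R]_n) : 0 <= hausdorff m A.
Proof. by rewrite -hausdorff0; exact: le_hausdorff. Qed.

Let hausdorff_sigma_subadditive :
  sigma_subadditive (hausdorff m : set 'rV[R]_n -> \bar R).
Proof.
move=> F; apply: ge_ereal_sup => _ [d d0 <-].
apply: (@le_trans _ _ (\sum_(i <oo) hausdorff_pre m d (F i))).
  by rewrite hausdorff_preE; apply: mu_ext_sigma_subadditive => //; exact: gauge0.
apply: lee_nneseries => [i _ _|i _].
  by rewrite hausdorff_preE mu_ext_ge0// gauge0.
by apply: ereal_sup_ubound; exists d.
Qed.

HB.instance Definition _ := isOuterMeasure.Build R _
  (hausdorff m : set 'rV[R]_n -> \bar R) hausdorff0 hausdorff_ge0
  le_hausdorff hausdorff_sigma_subadditive.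

End HausdorffOuterMeasure.

Section Grassmannian.
Context (R : realType) (m n : nat).

Lemma exists_vspace_dim (mn : (m <= n)%N) :
  exists S : {vspace 'rV[R]_n}, \dim S == m.
Proof.
pose b := vbasis (fullv : {vspace 'rV[R]_n}).
exists <<take m b>>%VS; apply/eqP.
have : free (take m b ++ drop m b).
  by rewrite cat_take_drop; exact: basis_free (vbasisP _).
move=> /catl_free; rewrite /free => /eqP ->.
by rewrite size_takel// size_tuple dimvf /dim/= mul1n.
Qed.

(** The bound [m <= n], which makes the type nonempty, is part of the type so
    that the latter can carry the pointed structure that measurable spaces
    require. *)
Definition grass (mn : (m <= n)%N) : Type :=
  {S : {vspace 'rV[R]_n} | \dim S == m}.

Context (mn : (m <= n)%N).

Definition grass_vspace (S : grass mn) : {vspace 'rV[R]_n} := sval S.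

Definition grass_projmx (S : grass mn) : 'M[R]_n :=
  lin1_mx (orthproj (grass_vspace S)).

HB.instance Definition _ := Choice.copy (grass mn)
  {S : {vspace 'rV[R]_n} | \dim S == m}.
HB.instance Definition _ := isPointed.Build (grass mn)
  (exist _ (xchoose (exists_vspace_dim mn))
           (xchooseP (exists_vspace_dim mn))).
(** A sequence of subspaces converges when the matrices of the orthogonal
    projections do. *)
HB.instance Definition _ := Topological.copy (grass mn)
  (initial_topology grass_projmx).

End Grassmannian.
Arguments grass : clear implicits.
Arguments grass R {m n} mn.
Coercion grass_vspace : grass >-> space.

Definition borel (T : ptopologicalType) := g_sigma_algebraType (@open T).

(** For a Hausdorff space, where compact sets are Borel. *)
Definition radon (R : realType) (T : ptopologicalType)
    (mu : {measure set (borel T) -> \bar R}) : Prop :=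
  [/\ forall K : set T, compact K -> (mu K < +oo)%E,
      forall A : set (borel T), measurable A ->
        mu A = ereal_inf [set mu U | U in [set U : set T | open U /\ A `<=` U]]
    & forall U : set T, open U ->
        mu U = ereal_sup [set mu K | K in
          [set K : set T | compact K /\ K `<=` U]]].

(** Smoothness is expressed by requiring all iterated directional derivatives
    [D_v1 (... (D_vk g))] to be Frechet differentiable. *)
Definition smooth (R : realType) (U W : normedModType R) (g : U -> W) : Prop :=
  forall (vs : seq U) (x : U),
    differentiable (foldr (fun v h => 'D_v h) g vs) x.

Definition compactly_supported (T : topologicalType) (W : zmodType)
    (g : T -> W) : Prop :=
  compact (closure [set x | g x != 0]).

Section Rectifiable.
Context {R : realType} (m : nat) {n : nat}.
Implicit Types (E : set 'rV[R]_n).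

Definition m_rectifiable E : Prop :=
  exists (D : set 'rV[R]_m) (f : 'rV[R]_m -> 'rV[R]_n),
    [/\ bounded_set D, [lipschitz f x | x in D] & E = f @` D].

Definition countably_m_rectifiable E : Prop :=
  exists F : nat -> set 'rV[R]_n,
    (forall k, m_rectifiable (F k)) /\ E = \bigcup_k F k.

Definition countably_Hm_rectifiable E : Prop :=
  exists2 F, countably_m_rectifiable F & hausdorff m (E `\` F) = 0%E.

End Rectifiable.

Section ApproximateTangents.
Context {R : realType}.

Definition tangent_cone {n : nat} (A : set 'rV[R]_n) (a : 'rV[R]_n) :
    set 'rV[R]_n :=
  [set v | forall eps : R, 0 < eps -> exists x (r : R),
    [/\ A x, 0 < r, enorm (x - a) < eps & enorm (r *: (x - a) - v) < eps]].

Definition density_zero (m : nat) {n : nat} (E : set 'rV[R]_n)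
    (a : 'rV[R]_n) : Prop :=
  (hausdorff m (E `&` eball a r) * ((ball_volume m * r ^+ m)^-1)%:E)%E
    @[r --> 0^'+] --> 0%E.

(** The [m] dimensional approximate tangent vectors at [a] of the restriction
    to [E] of the [m] dimensional Hausdorff measure: those tangent at [a] to
    every set whose complement has, for that measure, density zero at [a]. *)
Definition approx_tangent_cone (m : nat) {n : nat} (E : set 'rV[R]_n)
    (a : 'rV[R]_n) : set 'rV[R]_n :=
  \bigcap_(A in [set A | density_zero m (E `\` A) a]) tangent_cone A a.

(** The approximate tangent plane, with a junk value at the points where the
    approximate tangent cone is not an [m] dimensional subspace. *)
Definition approx_tangent_plane {m n : nat} (mn : (m <= n)%N)
    (E : set 'rV[R]_n) (x : 'rV[R]_n) : grass R mn :=
  get [set T : grass R mn |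
    approx_tangent_cone m E x = [set v | v \in grass_vspace T]].

End ApproximateTangents.

Section Varifold.
Context (R : realType) (m n : nat) (mn : (m <= n)%N).

Definition varifold_space : Type := ('rV[R]_n * grass R mn)%type.

HB.instance Definition _ := Topological.on varifold_space.
HB.instance Definition _ := Pointed.copy varifold_space
  ('rV[R]_n * grass R mn)%type.

Implicit Type V : {measure set (borel varifold_space) -> \bar R}.

Definition varifold V : Prop := radon V.

Definition weight V (A : set 'rV[R]_n) : \bar R := V (A `*` setT).

Definition weight_support V : set 'rV[R]_n :=
  ~` \bigcup_(U in [set U : set 'rV[R]_n | open U /\ weight V U = 0%E]) U.

Definition first_variation V (g : 'rV[R]_n -> 'rV[R]_n) : \bar R :=
  (\int[V]_z
    (\tr (lin1_mx (orthproj (grass_vspace (snd z)) \o 'd g (fst z))))%:E)%E.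

Definition stationary V : Prop :=
  forall g, smooth g -> compactly_supported g -> first_variation V g = 0%E.

(** [H] is the Hausdorff measure on its own (complete) sigma-algebra of
    Caratheodory measurable sets, to which [E] is also required to belong. *)
Definition integral_varifold V : Prop :=
  exists (E : set 'rV[R]_n) (theta : 'rV[R]_n -> nat),
    let H := hausdorff m : set (caratheodory_type (hausdorff m)) -> \bar R in
    [/\ countably_Hm_rectifiable m E /\ (hausdorff m).-caratheodory E,
        forall x, E x -> (0 < theta x)%N,
        forall K : set 'rV[R]_n, compact K ->
          H.-integrable (E `&` K) (fun x => (theta x)%:R%:E)
      & forall f : varifold_space -> R,
          continuous f -> compactly_supported f ->
          (\int[V]_z (f z)%:E =
           \int[H]_(x in E)
             (f (x, approx_tangent_plane mn E x) * (theta x)%:R)%:E)%E].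

End Varifold.
Arguments varifold_space R {m n} mn.

Section StrongPointwiseDifferentiability.
Context {R : realType}.

(** In coordinates with respect to a basis of [U], a polynomial of total degree
    at most [k] with coefficients in [W]; the exponents are multi-indices. *)
Definition polynomial_fun (U W : vectType R) (k : nat) (P : U -> W) : Prop :=
  exists c : {ffun 'I_(\dim {:U}) -> 'I_k.+1} -> W,
    forall x, P x =
      \sum_(al : {ffun 'I_(\dim {:U}) -> 'I_k.+1} | (\sum_i al i <= k)%N)
        (\prod_i coord (vbasis {:U}) i x ^+ al i) *: c al.

Definition strongly_pointwise_differentiable {n : nat} (k : nat)
    (A : set 'rV[R]_n) (a : 'rV[R]_n) : Prop :=
  exists (l : nat) (ln : (l <= n)%N) (T : grass R ln)
      (P : subvs_of T -> subvs_of (orthcomp T)),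
    let B := [set vsval x + vsval (P x) | x in [set: subvs_of T]] in
    [/\ polynomial_fun k P, B a &
        ((r ^+ k)^-1%:E *
         ereal_sup [set `|edist x A - edist x B| | x in eball a r])%E
        @[r --> 0^'+] --> 0%E].

End StrongPointwiseDifferentiability.

(* Main.v *)
From HB Require Import structures.
Require Import Defs.
From mathcomp Require Import all_boot all_order all_algebra.
From mathcomp Require Import all_classical all_reals all_analysis.
From mathcomp Require Import measurable_realfun zify ring lra.

(** Let [Q] be the orthogonal projection onto the complement of [S] and [h x]
    the squared length of [x Q]. By a Vitali covering argument, the weight
    outside [S] of the ball with centre [a] and radius [r] is [o(r^m)] for
    almost every [a] in [S]; at such a point of the support [A], the set [S]
    itself approximates [A] to every order, so that [P = 0] will do.

    Testing the first variation with truncations of [(b + h x) (x - a)/|x - a|^m],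
    corrected by a multiple of [x Q], yields a sub-mean-value inequality for the
    constants and for [h]. For the constants, and since the density of an
    integral varifold is at least [1], it bounds the weight of balls centred in
    [A] from below by [c r^m]. For [h], which vanishes on [S], it then gives
    [sup h] over [A] in the ball of radius [r] at most [o(1)] times [sup h] over
    [A] in the ball of radius [2 r]; hence [sup h] decays faster than any power
    of [r], and so does the mean tilt of the tangent planes, by a Caccioppoli
    type estimate. If [A] missed the ball of radius [r^k] about some [s] in [S],
    then the truncated field [(x - s)/|x - s|^m] would be admissible and, [V]
    being so close to a piece of [S], would force the weight near [a] to be
    too small for the lower bound. *)

Set Implicit Arguments.
Unset Strict Implicit.
Unset Printing Implicit Defensive.

Import Order.TTheory GRing.Theory Num.Theory.
Import numFieldTopology.Exports numFieldNormedType.Exports.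

Local Open Scope classical_set_scope.
Local Open Scope ring_scope.

(** * Euclidean space and orthogonal projections *)

(** Each test field is a sum of fields [phi x *: (x *m M + c)], so one formula for the first
    variation serves throughout. The power |x - a|^-m is dictated by the fact that (x - a)/|x - a|^m
    has zero divergence along every m plane through a. What remains is a regularisation term at a
    small scale, a truncation term at scale r, and a term from the component of x - a normal to the
    tangent plane. In the sub-mean-value inequality this last term has a favourable sign and is
    dropped. No sharp constant is used: at each halving of the radius, whatever ratio the constants
    have is beaten by the small weight off S. The lower bound on weights turns means of h into
    pointwise values, by averaging over balls so small that h hardly varies there.

    In the hole argument the normal term has the unfavourable sign. It is controlled by tilt and
    height, but divided by the power m + 2 of the radius r^k of the hole; hence the demand for decay
    faster than every power. The truncation term is comparable to r^-m times the weight of a ball,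
    which the lower bound keeps away from 0. *)

Section EuclideanNorm.
Context {R : realType} {n : nat}.
Implicit Types (x y z a : 'rV[R]_n) (t : R).

Lemma dotpE x y : dotp x y = (x *m y^T) 0 0.
Proof. by rewrite mxE; apply: eq_bigr => i _; rewrite mxE. Qed.

Lemma dotpC x y : dotp x y = dotp y x.
Proof. by apply: eq_bigr => i _; rewrite mulrC. Qed.

Lemma dotpDl x y z : dotp (x + y) z = dotp x z + dotp y z.
Proof. by rewrite !dotpE mulmxDl mxE. Qed.

Lemma dotpZl t x y : dotp (t *: x) y = t * dotp x y.
Proof. by rewrite !dotpE -scalemxAl mxE. Qed.

Lemma dotpDr x y z : dotp x (y + z) = dotp x y + dotp x z.
Proof. by rewrite dotpC dotpDl !(dotpC _ x). Qed.

Lemma dotpZr t x y : dotp x (t *: y) = t * dotp x y.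
Proof. by rewrite dotpC dotpZl dotpC. Qed.

Lemma dotpNl x y : dotp (- x) y = - dotp x y.
Proof. by rewrite -scaleN1r dotpZl mulN1r. Qed.

Lemma dotpNr x y : dotp x (- y) = - dotp x y.
Proof. by rewrite dotpC dotpNl dotpC. Qed.

Lemma dotpBl x y z : dotp (x - y) z = dotp x z - dotp y z.
Proof. by rewrite dotpDl dotpNl. Qed.

Lemma dotpBr x y z : dotp x (y - z) = dotp x y - dotp x z.
Proof. by rewrite dotpDr dotpNr. Qed.

Lemma dotp_ge0 x : 0 <= dotp x x.
Proof. by apply: sumr_ge0 => i _; rewrite -expr2 sqr_ge0. Qed.

Lemma dotp_mulmx x y (M : 'M[R]_n) : dotp (x *m M) y = dotp x (y *m M^T).
Proof. by rewrite !dotpE trmx_mul trmxK mulmxA. Qed.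

Lemma dotp_eq0 x : (dotp x x == 0) = (x == 0).
Proof.
apply/eqP/eqP => [/eqP|->]; last by rewrite dotpE mul0mx mxE.
rewrite psumr_eq0 => [/allP h|i _]; last by rewrite -expr2 sqr_ge0.
apply/rowP => i; rewrite mxE; apply/eqP.
by have := h i (mem_index_enum _); rewrite mulf_eq0 orbb.
Qed.

Lemma enorm_ge0 x : 0 <= enorm x.
Proof. exact: sqrtr_ge0. Qed.

Lemma sqr_enorm x : enorm x ^+ 2 = dotp x x.
Proof. by rewrite sqr_sqrtr// dotp_ge0. Qed.

Lemma enormN x : enorm (- x) = enorm x.
Proof. by rewrite /enorm dotpNl dotpNr opprK. Qed.

Lemma enormB x y : enorm (x - y) = enorm (y - x).
Proof. by rewrite -enormN opprB. Qed.

Lemma enorm0 : enorm (0 : 'rV[R]_n) = 0.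
Proof. by rewrite /enorm dotpE mul0mx mxE sqrtr0. Qed.

Lemma dotp_CS x y : dotp x y ^+ 2 <= dotp x x * dotp y y.
Proof.
have [/eqP|y0] := eqVneq (dotp y y) 0.
  by rewrite dotp_eq0 => /eqP ->; rewrite !(dotpE _ 0) !trmx0 !mulmx0 !mxE mulr0 expr0n.
have yp : 0 < dotp y y by rewrite lt_def y0 dotp_ge0.
have := dotp_ge0 (dotp y y *: x - dotp x y *: y).
rewrite dotpBl !dotpBr !dotpZl !dotpZr (dotpC y x).
set A := dotp x x; set B := dotp y y in yp *; set C := dotp x y.
have -> : B * (B * A) - B * (C * C) - (C * (B * C) - C * (C * B)) = B * (A * B - C ^+ 2) by ring.
by rewrite pmulr_rge0// subr_ge0.
Qed.

Lemma dotp_le x y : `|dotp x y| <= enorm x * enorm y.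
Proof.
rewrite -(@ler_pXn2r _ 2)// ?nnegrE ?mulr_ge0 ?enorm_ge0//.
by rewrite exprMn !sqr_enorm real_normK ?num_real// dotp_CS.
Qed.

Lemma enormD x y : enorm (x + y) <= enorm x + enorm y.
Proof.
rewrite -(@ler_pXn2r _ 2)// ?nnegrE ?addr_ge0 ?enorm_ge0//.
rewrite sqrrD !sqr_enorm dotpDl !dotpDr (dotpC y x).
have := ler_norm (dotp x y); have := dotp_le x y; lra.
Qed.

Lemma enorm_triangle x y z : enorm (x - z) <= enorm (x - y) + enorm (y - z).
Proof. by apply: le_trans (enormD _ _); rewrite addrA subrK. Qed.

Lemma enorm_le_sqr x t : 0 <= t -> (enorm x <= t) = (dotp x x <= t ^+ 2).
Proof. by move=> t0; rewrite -sqr_enorm ler_pXn2r// nnegrE enorm_ge0. Qed.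

Lemma norm_le_enorm x : `|x| <= enorm x.
Proof.
rewrite /Num.norm/= mx_normrE; apply/bigmax_leP; split => [|i _]; first exact: enorm_ge0.
rewrite -(@ler_pXn2r _ 2)// ?nnegrE ?enorm_ge0// sqr_enorm real_normK ?num_real//.
rewrite (ord1 i.1) /dotp (bigD1 i.2)//= expr2 lerDl.
by apply: sumr_ge0 => j _; rewrite -expr2 sqr_ge0.
Qed.

Lemma enorm_le_norm x : enorm x <= n%:R * `|x|.
Proof.
rewrite enorm_le_sqr ?mulr_ge0//.
apply: (@le_trans _ _ (\sum_(i < n) `|x| ^+ 2)).
  apply: ler_sum => i _; rewrite -expr2 -real_normK ?num_real//.
  rewrite ler_pXn2r// ?nnegrE//.
  by rewrite [leRHS]/Num.norm/= mx_normrE (le_bigmax _ (fun i => `|x i.1 i.2|) (0, i)).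
rewrite sumr_const card_ord exprMn -[leLHS]mulr_natl ler_wpM2r ?sqr_ge0//.
by rewrite -natrX ler_nat; case: (n) => // k; rewrite expnS leq_pmulr// expn_gt0.
Qed.

Lemma continuous_dotp_sub a : continuous (fun x => dotp (x - a) (x - a)).
Proof.
rewrite /dotp; apply: (@continuous_big _ _ +%R) => [|i _ x].
  exact: add_continuous.
have c : {for x, continuous (fun y : 'rV[R]_n => (y - a) 0 i)}.
  rewrite (_ : (fun y : 'rV[R]_n => _) = (fun y => y 0 i - a 0 i)).
    by apply: continuousB; [exact: coord_continuous|exact: cst_continuous].
  by apply/funext => y; rewrite !mxE.
exact: (continuousM c c).
Qed.

Lemma continuous_enorm_sub a : continuous (fun x => enorm (x - a)).
Proof.
move=> x; apply: (@continuous_comp _ _ _ (fun x => dotp (x - a) (x - a)) Num.sqrt).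
  exact: continuous_dotp_sub.
exact: sqrt_continuous.
Qed.

Lemma closed_eball a t : closed (eball a t).
Proof.
rewrite (_ : eball a t = (fun x => enorm (x - a)) @^-1` [set s | s <= t])//.
apply: preimage_closed; last exact: closed_le.
by move=> x _; exact: continuous_enorm_sub.
Qed.

Lemma open_eball a t : open [set x | enorm (x - a) < t].
Proof.
rewrite (_ : [set x | _] = (fun x => enorm (x - a)) @^-1` [set s | s < t])//.
apply: open_comp; last exact: open_lt.
by move=> x _; exact: continuous_enorm_sub.
Qed.

Lemma compact_eball a t : compact (eball a t).
Proof.
apply: bounded_closed_compact; last exact: closed_eball.
exists (t + `|a|); split; first exact: num_real.
move=> s ts x /= xat.
rewrite -[x](subrK a) (le_trans (ler_normD _ _))//.
by rewrite ltW// (le_lt_trans _ ts)// lerD2r (le_trans (norm_le_enorm _)).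
Qed.

Lemma nbhs_eball a t : 0 < t -> nbhs a (eball a t).
Proof.
move=> t0; apply: (@filterS _ _ _ [set x | enorm (x - a) < t]); first by move=> x /ltW.
by apply: open_nbhs_nbhs; split; [exact: open_eball|rewrite /= subrr enorm0].
Qed.

Lemma open_eballP (U : set 'rV[R]_n) a : open U -> U a ->
  exists2 t : R, 0 < t & eball a t `<=` U.
Proof.
move=> oU Ua; have /nbhs_ballP[e /= e0 eU] := open_nbhs_nbhs (conj oU Ua).
exists (e / 2); first by rewrite divr_gt0.
move=> x /= xa; apply: eU; rewrite -ball_normE /ball_/= distrC.
by rewrite (le_lt_trans (norm_le_enorm _))// (le_lt_trans xa)// ltr_pdivrMr// mulr_natr mulr2n ltrDl.
Qed.

End EuclideanNorm.

Section OrthogonalProjection.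
Context {R : realType} {n : nat}.
Implicit Types (x y : 'rV[R]_n) (S : {vspace 'rV[R]_n}) (P : 'M[R]_n).

Definition projmx S : 'M[R]_n := lin1_mx (orthproj S).

Lemma mul_projmx S x : x *m projmx S = orthproj S x.
Proof. by rewrite mul_rV_lin1. Qed.

Lemma projmx_uniq S x y : y \in S -> x - y \in orthcomp S -> x *m projmx S = y.
Proof.
move=> yS xyS; rewrite mul_projmx; have [pS xpS] := orthprojP S x.
apply/eqP; rewrite -subr_eq0 -memv0 -(orthcomp_disjoint S).
apply/memv_capP; split; first by rewrite rpredB.
have -> : orthproj S x - y = (x - y) - (x - orthproj S x).
  by rewrite opprB [RHS]addrC addrA subrK.
by rewrite rpredB.
Qed.

Lemma projmx_in S x : x *m projmx S \in S.
Proof. by rewrite mul_projmx; case: (orthprojP S x). Qed.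

Lemma projmx_id S x : x \in S -> x *m projmx S = x.
Proof. by move=> xS; apply: projmx_uniq => //; rewrite subrr mem0v. Qed.

Lemma projmx_perp S x y : y \in S -> dotp (x - x *m projmx S) y = 0.
Proof.
rewrite mul_projmx => yS; case: (orthprojP S x) => _ /memv_orthcomp; exact.
Qed.

Lemma mulmx_rowP (A B : 'M[R]_n) : (forall x, x *m A = x *m B) -> A = B.
Proof.
by move=> AB; apply/row_matrixP => i; rewrite !rowE AB.
Qed.

Lemma projmx_idem S : projmx S *m projmx S = projmx S.
Proof.
by apply: mulmx_rowP => x; rewrite mulmxA projmx_id// projmx_in.
Qed.

Lemma projmx_sym S : (projmx S)^T = projmx S.
Proof.
have h x y : dotp (x *m projmx S) y = dotp (x *m projmx S) (y *m projmx S).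
  by apply/eqP; rewrite -subr_eq0 -dotpBr dotpC projmx_perp// projmx_in.
have {}h x y : dotp (x *m projmx S) y = dotp x (y *m projmx S).
  by rewrite h dotpC -h dotpC.
apply/matrixP => i j; rewrite mxE.
have := h (delta_mx 0 j) (delta_mx 0 i).
rewrite -!rowE.
have e (x : 'rV[R]_n) k : dotp x (delta_mx 0 k) = x 0 k.
  rewrite /dotp (bigD1 k)//= big1 => [|l lk]; rewrite !mxE ?eqxx ?mulr1 ?addr0//.
  by rewrite (negbTE lk) andbF mulr0.
by rewrite e dotpC e !mxE.
Qed.

(** Coordinates in a basis of [S] factor the projection as [C *m B], with [B *m C] the identity of
    size [\dim S]; the trace is cyclic. *)
Lemma mxtrace_projmx S : \tr (projmx S) = (\dim S)%:R.
Proof.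
pose B := \matrix_(i < \dim S) (vbasis S)`_i : 'M[R]_(\dim S, n).
pose C := \matrix_(i < n, j < \dim S) coord (vbasis S) j (row i (projmx S)).
have PCB : projmx S = C *m B.
  apply/row_matrixP => i; rewrite row_mul mulmx_sum_row.
  rewrite [LHS](coord_vbasis (_ : row i (projmx S) \in S)); last by rewrite rowE projmx_in.
  by apply: eq_bigr => j _; rewrite rowK !mxE.
have BC : B *m C = 1%:M.
  apply/matrixP => i j; rewrite !mxE.
  have -> : \sum_k B i k * C k j = coord (vbasis S) j (row i B *m projmx S).
    rewrite (mulmx_sum_row (row i B)) linear_sum/=; apply: eq_bigr => k _.
    by rewrite linearZ/= !mxE.
  rewrite projmx_id ?rowK; last by rewrite vbasis_mem// mem_nth// size_tuple.
  by rewrite coord_free ?(basis_free (vbasisP S))// eq_sym.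
by rewrite PCB mxtrace_mulC BC mxtrace1.
Qed.

(** This describes the Grassmannian by polynomial equations on matrices, which is what makes it
    closed. *)
Lemma projmx_onto P : P *m P = P -> P^T = P ->
  exists S, projmx S = P.
Proof.
move=> PP PT; exists (limg (linfun (mulmxr P))).
apply: mulmx_rowP => x; apply: projmx_uniq.
  by apply/memv_imgP; exists x; rewrite ?memvf// lfunE.
apply/memv_orthcomp => y /memv_imgP[z _ ->]; rewrite lfunE/=.
by rewrite dotpC dotp_mulmx PT mulmxBl -mulmxA PP subrr dotpC dotpE mul0mx mxE.
Qed.

Lemma projmx_compl S x : x *m (1%:M - projmx S) = x - x *m projmx S.
Proof. by rewrite mulmxBr mulmx1. Qed.

Lemma projmx_compl_eq0 S x : (x *m (1%:M - projmx S) == 0) = (x \in S).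
Proof.
rewrite projmx_compl subr_eq0; apply/eqP/idP => [->|/projmx_id ->//].
exact: projmx_in.
Qed.

Lemma projmx_compl_idem S :
  (1%:M - projmx S) *m (1%:M - projmx S) = 1%:M - projmx S.
Proof. by rewrite mulmxBr mulmx1 mulmxBl mul1mx projmx_idem subrr subr0. Qed.

Lemma projmx_compl_sym S : (1%:M - projmx S)^T = 1%:M - projmx S.
Proof. by rewrite linearB/= trmx1 projmx_sym. Qed.

Lemma enorm_proj_le P x : P *m P = P -> P^T = P -> dotp (x *m P) (x *m P) <= dotp x x.
Proof.
move=> PP PT; have := dotp_ge0 (x - x *m P).
have e : dotp x (x *m P) = dotp (x *m P) (x *m P).
  by rewrite dotp_mulmx PT -mulmxA PP.
rewrite dotpBl !dotpBr (dotpC _ x) e; lra.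
Qed.

(** A diagonal entry is the sum of the squares of its row, so [P i j ^+ 2 <= P i i] for all [j], and
    [j = i] gives [P i i <= 1]. *)
Lemma norm_proj_entry_le1 P i j : P *m P = P -> P^T = P -> `|P i j| <= 1.
Proof.
move=> PP PT.
have diag a : P a a = \sum_b P a b ^+ 2.
  have -> : P a a = (P *m P) a a by rewrite PP.
  rewrite mxE; apply: eq_bigr => b _.
  have -> : P b a = P a b by rewrite -[in LHS]PT mxE.
  by rewrite expr2.
have le a b : P a b ^+ 2 <= P a a.
  by rewrite [leRHS]diag (bigD1 b)//= lerDl sumr_ge0// => c _; exact: sqr_ge0.
have P1 : P i i <= 1 by have := le i i; nra.
rewrite -(@ler_pXn2r _ 2)// ?nnegrE// real_normK ?num_real// expr1n.
exact: le_trans (le i j) P1.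
Qed.

(** The squared Hilbert-Schmidt norm. *)
Definition hs (A : 'M[R]_n) := \tr (A *m A^T).

Lemma hsE A : hs A = \sum_i \sum_j A i j ^+ 2.
Proof.
by apply: eq_bigr => i _; rewrite !mxE; apply: eq_bigr => j _; rewrite !mxE expr2.
Qed.

Lemma hs_ge0 A : 0 <= hs A.
Proof. by rewrite hsE; apply: sumr_ge0 => i _; apply: sumr_ge0 => j _; exact: sqr_ge0. Qed.

Lemma enorm_mulmx_hs x A : dotp (x *m A) (x *m A) <= dotp x x * hs A.
Proof.
have -> : hs A = \sum_j dotp (row j A^T) (row j A^T).
  by rewrite hsE exchange_big; apply: eq_bigr => j _; apply: eq_bigr => i _; rewrite !mxE expr2.
rewrite mulr_sumr; apply: ler_sum => j _.
have -> : (x *m A) 0 j = dotp x (row j A^T).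
  by rewrite mxE; apply: eq_bigr => i _; rewrite !mxE.
by rewrite -expr2; exact: dotp_CS.
Qed.

(** Both matrices being orthogonal projections, the trace equals [hs (Q *m P)]. *)
Lemma tr_projM_ge0 P Q : P *m P = P -> P^T = P -> Q *m Q = Q -> Q^T = Q ->
  0 <= \tr (Q *m P).
Proof.
move=> PP PT QQ QT.
have := hs_ge0 (Q *m P); rewrite /hs trmx_mul PT QT mulmxA -(mulmxA Q) PP.
by rewrite mxtrace_mulC mulmxA QQ.
Qed.

(** Because [hs (Q (1 - P)) = tr Q - tr (Q P)]. *)
Lemma tilt_bound P Q x : P *m P = P -> P^T = P -> Q *m Q = Q -> Q^T = Q ->
  \tr P = \tr Q ->
  dotp (x *m Q *m (1%:M - P)) (x *m Q *m (1%:M - P)) <=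
  dotp x x * \tr ((1%:M - Q) *m P).
Proof.
move=> PP PT QQ QT trPQ; rewrite -mulmxA.
apply: le_trans (enorm_mulmx_hs _ _) _; rewrite le_eqVlt; apply/orP; left; apply/eqP.
have e : (1%:M - P)^T = 1%:M - P by rewrite [LHS]linearB/= trmx1 PT.
congr (_ * _); rewrite /hs trmx_mul e QT.
have e2 : (1%:M - P) *m (1%:M - P) = 1%:M - P.
  by rewrite mulmxBr mulmx1 mulmxBl mul1mx PP subrr subr0.
rewrite mulmxA -(mulmxA Q) e2 mxtrace_mulC mulmxA QQ.
have -> : Q *m (1%:M - P) = Q - Q *m P by rewrite mulmxBr mulmx1.
have -> : (1%:M - Q) *m P = P - Q *m P by rewrite mulmxBl mul1mx.
by rewrite !linearB/= trPQ.
Qed.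

End OrthogonalProjection.

(** * Compactness of the Grassmannian *)

Section GrassmannianTopology.
Context {R : realType} {m n : nat} {mn : (m <= n)%N}.
Implicit Types T : grass R mn.

Lemma grass_projmxE T : grass_projmx T = projmx (grass_vspace T).
Proof. by []. Qed.

Lemma grass_idem T : grass_projmx T *m grass_projmx T = grass_projmx T.
Proof. exact: projmx_idem. Qed.

Lemma grass_sym T : (grass_projmx T)^T = grass_projmx T.
Proof. exact: projmx_sym. Qed.

Lemma grass_tr T : \tr (grass_projmx T) = m%:R.
Proof. by rewrite grass_projmxE mxtrace_projmx; case: T => S /= /eqP ->. Qed.

Lemma grass_continuous : continuous (@grass_projmx R m n mn).
Proof. exact: initial_continuous. Qed.

Lemma range_grass : range (@grass_projmx R m n mn) =
  [set P | [/\ P *m P = P, P^T = P & \tr P = m%:R]].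
Proof.
apply/seteqP; split => [_ [T _ <-]|P [PP PT trP]].
  by split; [exact: grass_idem|exact: grass_sym|exact: grass_tr].
have [S SP] := projmx_onto PP PT.
have dS : \dim S == m.
  by rewrite -(@eqr_nat R) -trP -SP mxtrace_projmx.
by exists (exist _ S dS).
Qed.

Lemma continuous_mxE (U : topologicalType) p q (f : U -> 'M[R]_(p, q)) :
  (forall i j, continuous (fun x => f x i j)) -> continuous f.
Proof.
move=> fc x A [B xB BA].
have : \forall y \near x, forall i j, B i j (f y i j).
  apply: filter_forall => i; apply: filter_forall => j.
  exact: (fc i j x).
by apply: filterS => y yB; exact: BA.
Qed.

Lemma vec_mx_entry (v : 'rV[R]_(n * n)) i j : vec_mx v i j = v 0 (mxvec_index i j).
Proof. by rewrite mxE. Qed.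

(** Heine-Borel, applied to row vectors after flattening matrices by [mxvec]: entries of projections
    are at most 1, and idempotence, symmetry and the value of the trace are closed conditions. *)
Lemma compact_range_grass : compact (range (@grass_projmx R m n mn)).
Proof.
pose K := vec_mx @^-1` range (@grass_projmx R m n mn) : set 'rV[R]_(n * n).
have -> : range (@grass_projmx R m n mn) = vec_mx @` K.
  apply/seteqP; split => [P rP|_ [v Kv <-]//].
  by exists (mxvec P); rewrite /K /= mxvecK.
have ce i j : continuous (fun v : 'rV[R]_(n * n) => vec_mx v i j).
  by under eq_fun do rewrite vec_mx_entry; exact: coord_continuous.
apply: continuous_compact.
  by apply: continuous_subspaceT; exact: continuous_mxE.
rewrite /K range_grass; apply: bounded_closed_compact.
  exists 1; split; first exact: num_real.
  move=> s s1 v [PP PT _]; apply: le_trans (ltW s1).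
  rewrite /Num.norm/= mx_normrE; apply/bigmax_leP; split => // -[k l] _ /=.
  rewrite (ord1 k); have [i j] := mxvec_indexP l; rewrite -vec_mx_entry.
  exact: norm_proj_entry_le1.
have cD (F G : 'rV[R]_(n * n) -> R) : continuous F -> continuous G ->
    closed [set v | F v = G v].
  move=> cF cG; rewrite (_ : [set v | _] = (F \- G) @^-1` [set 0]).
    apply: preimage_closed; last exact: closed_eq.
    by move=> v _; apply: continuousB; [exact: cF|exact: cG].
  apply/seteqP; split => v /=; first by move=> ->; rewrite subrr.
  by move/eqP; rewrite subr_eq0 => /eqP.
have cM i j : continuous (fun v : 'rV[R]_(n * n) => (vec_mx v *m vec_mx v) i j).
  under eq_fun do rewrite mxE.
  apply: (@continuous_big _ _ +%R) => [|k _ v]; first exact: add_continuous.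
  by apply: continuousM; exact: ce.
have ctr : continuous (fun v : 'rV[R]_(n * n) => \tr (vec_mx v : 'M[R]_n)).
  by apply: (@continuous_big _ _ +%R) => [|k _]; [exact: add_continuous|exact: ce].
rewrite (_ : _ @^-1` _ =
  (\bigcap_(i in setT) \bigcap_(j in setT)
    [set v | (vec_mx v *m vec_mx v) i j = vec_mx v i j]) `&`
  ((\bigcap_(i in setT) \bigcap_(j in setT)
    [set v : 'rV[R]_(n * n) | vec_mx v j i = vec_mx v i j]) `&`
  [set v : 'rV[R]_(n * n) | \tr (vec_mx v : 'M[R]_n) = m%:R])).
  apply: closedI; [|apply: closedI]; last by apply: cD => //; exact: cst_continuous.
    by apply: closed_bigI => i _; apply: closed_bigI => j _; apply: cD.
  by apply: closed_bigI => i _; apply: closed_bigI => j _; apply: cD.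
apply/seteqP; split => v.
  move=> [PP PT tr]; split; [|split] => //.
    by move=> i _ j _ /=; rewrite PP.
  by move=> i _ j _ /=; rewrite -[in RHS]PT [in RHS]mxE.
move=> [PP [PT tr]]; split => //.
  by apply/matrixP => i j; apply: PP.
by apply/matrixP => i j; rewrite mxE; apply: PT.
Qed.

(** Since the topology is initial for [grass_projmx], a cluster point of the image filter in the
    compact range lifts to a cluster point of the filter itself. *)
Lemma compact_grass : compact [set: grass R mn].
Proof.
move=> F FF _; pose G := (@grass_projmx R m n mn) @ F.
have [_ [[T _ <-] clT]] : range (@grass_projmx R m n mn) `&` cluster G !=set0.
  apply: compact_range_grass.
  by rewrite /G /= ; apply: filterE => T; exists T.
exists T; split => // A B FA.
rewrite nbhsE => -[C [[W oW <-] WT] WB].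
have GA : G ((@grass_projmx R m n mn) @` A).
  by rewrite /G /=; apply: filterS FA => x Ax; exists x.
have nW : nbhs (grass_projmx T) W by apply: open_nbhs_nbhs; split.
have [_ [[y Ay <-] Wy]] := clT _ _ GA nW.
by exists y; split => //; exact: WB.
Qed.

End GrassmannianTopology.

(** * Smooth functions *)

Section SmoothFunctions.
Context {R : realType}.

(** A version of [smooth] graded by the number of derivatives, so that closure under products and
    compositions can be proved by induction on [k]. *)
Fixpoint kdiff {U W : normedModType R} (k : nat) (f : U -> W) : Prop :=
  (forall x, differentiable f x) /\
  if k is k'.+1 then forall v, kdiff k' ('D_v f) else True.

Section Closure.
Context {U W : normedModType R}.
Implicit Types (f g : U -> W) (p q : U -> R) (k : nat).

Lemma kdiff_differentiable k f x : kdiff k f -> differentiable f x.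
Proof. by case: k => [|k] []. Qed.

Lemma kdiff_derive k f v : kdiff k.+1 f -> kdiff k ('D_v f).
Proof. by move=> [_]; exact. Qed.

Lemma kdiffW k f : kdiff k.+1 f -> kdiff k f.
Proof.
elim: k f => [|k IH] f [df dDf]; split=> // v.
exact: IH.
Qed.

Lemma smoothP f : (forall k, kdiff k f) <-> smooth f.
Proof.
split=> [fk vs|sf k].
  suff : forall k, kdiff k (foldr (fun v h => 'D_v h) f vs).
    by move=> h x; exact: (kdiff_differentiable x (h 0%N)).
  by elim: vs => //= v vs IH k; exact: kdiff_derive (IH k.+1).
elim: k f sf => [|k IH] f sf; split=> //; try exact: (sf [::]).
move=> v; apply: IH => vs x.
by have := sf (rcons vs v) x; rewrite foldr_rcons.
Qed.

Lemma derive_eq_fun f v (df : U -> W) :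
  (forall x, is_derive x v f (df x)) -> 'D_v f = df.
Proof. by move=> h; apply/funext => x; rewrite derive_val. Qed.

Lemma kdiff_is_derive k f v x : kdiff k f -> is_derive x v f ('D_v f x).
Proof. by move=> /kdiff_differentiable fk; apply/derivableP/diff_derivable. Qed.

Lemma kdiff_cst k (w : W) : kdiff k (cst w : U -> W).
Proof.
elim: k w => [|k IH] w; split=> //; try by move=> x; exact: differentiable_cst.
move=> v; have -> : 'D_v (cst w : U -> W) = cst 0 by apply: derive_eq_fun.
exact: IH.
Qed.

Lemma kdiffD k f g : kdiff k f -> kdiff k g -> kdiff k (f + g).
Proof.
elim: k f g => [|k IH] f g fk gk; split => //.
- by move=> x; apply: differentiableD; [apply: kdiff_differentiable fk|apply: kdiff_differentiable gk].
- by move=> x; apply: differentiableD; [apply: kdiff_differentiable fk|apply: kdiff_differentiable gk].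
move=> v; have -> : 'D_v (f + g) = 'D_v f + 'D_v g.
  apply: derive_eq_fun => x; apply: is_deriveD.
    exact: kdiff_is_derive fk.
  exact: kdiff_is_derive gk.
by apply: IH; exact: kdiff_derive.
Qed.

Lemma kdiff_sum k (I : Type) (r : seq I) (f : I -> U -> W) :
  (forall i, kdiff k (f i)) -> kdiff k (fun x => \sum_(i <- r) f i x).
Proof.
move=> fk; elim: r => [|i r IH].
  by under eq_fun do rewrite big_nil; exact: kdiff_cst.
by under eq_fun do rewrite big_cons; exact: kdiffD.
Qed.

Lemma smooth_kdiff k f : smooth f -> kdiff k f.
Proof. by move/smoothP. Qed.

Lemma smooth_cst (w : W) : smooth (cst w : U -> W).
Proof. by apply/smoothP => k; exact: kdiff_cst. Qed.

Lemma smoothD f g : smooth f -> smooth g -> smooth (fun x => f x + g x).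
Proof. by move=> /smoothP sf /smoothP sg; apply/smoothP => k; exact: kdiffD. Qed.

Lemma smooth_sum (I : Type) (r : seq I) (f : I -> U -> W) :
  (forall i, smooth (f i)) -> smooth (fun x => \sum_(i <- r) f i x).
Proof.
by move=> sf; apply/smoothP => k; apply: kdiff_sum => i; exact: smooth_kdiff.
Qed.

Lemma smooth_is_derive f v x : smooth f -> is_derive x v f ('D_v f x).
Proof. by move=> /smoothP sf; exact: kdiff_is_derive (sf 0%N). Qed.

Lemma smooth_differentiable f x : smooth f -> differentiable f x.
Proof. by move=> sf; exact: (sf [::]). Qed.

Lemma smooth_derive f v : smooth f -> smooth ('D_v f).
Proof. by move=> /smoothP sf; apply/smoothP => k; exact: kdiff_derive (sf k.+1). Qed.

Lemma smooth_continuous f : smooth f -> continuous f.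
Proof. by move=> sf x; apply: differentiable_continuous; exact: smooth_differentiable. Qed.

Lemma smooth_linear (f : {linear U -> W}) : continuous f -> smooth f.
Proof.
move=> cf; apply/smoothP; case=> [|k]; split => //.
- by move=> x; exact: linear_differentiable.
- by move=> x; exact: linear_differentiable.
move=> v; have -> : 'D_v f = cst (f v); last exact: kdiff_cst.
by apply/funext => x; rewrite deriveE ?diff_lin//; exact: linear_differentiable.
Qed.

End Closure.

Section ScalarClosure.
Context {U W : normedModType R}.
Implicit Types (f g : U -> W) (p q : U -> R) (k : nat).

Lemma kdiffZl k p (w : W) : kdiff k p -> kdiff k (fun x => p x *: w).
Proof.
elim: k p => [|k IH] p pk; split => //.
- by move=> x; apply: differentiableZl; exact: kdiff_differentiable pk.
- by move=> x; apply: differentiableZl; exact: kdiff_differentiable pk.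
move=> v; have -> : 'D_v (fun x => p x *: w) = fun x => 'D_v p x *: w.
  apply/funext => x; have dp := kdiff_differentiable x pk.
  rewrite !deriveE//; last exact: differentiableZl.
  by rewrite diffZl.
exact/IH/kdiff_derive.
Qed.

Lemma kdiffM k p q : kdiff k p -> kdiff k q -> kdiff k (p * q).
Proof.
elim: k p q => [|k IH] p q pk qk; split => //.
- by move=> x; apply: differentiableM; [apply: kdiff_differentiable pk|apply: kdiff_differentiable qk].
- by move=> x; apply: differentiableM; [apply: kdiff_differentiable pk|apply: kdiff_differentiable qk].
move=> v; have -> : 'D_v (p * q) = p * 'D_v q + q * 'D_v p.
  apply: derive_eq_fun => x; apply: is_deriveM.
    exact: kdiff_is_derive pk.
  exact: kdiff_is_derive qk.
by apply: kdiffD; apply: IH; first [exact: kdiffW|exact: kdiff_derive].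
Qed.

Lemma smoothZl p (w : W) : smooth p -> smooth (fun x => p x *: w).
Proof. by move=> /smoothP sp; apply/smoothP => k; exact: kdiffZl. Qed.

Lemma smoothM p q : smooth p -> smooth q -> smooth (fun x => p x * q x).
Proof. by move=> /smoothP sp /smoothP sq; apply/smoothP => k; exact: kdiffM. Qed.

Lemma is_derive_comp_real (F : R -> R) (dF : R) p v x :
  is_derive (p x) 1 F dF -> differentiable p x ->
  is_derive x v (F \o p) (dF * 'D_v p x).
Proof.
move=> [DF FdF] dp.
have dF' : differentiable F (p x) by exact/derivable1_diffP.
apply: DeriveDef; first exact/diff_derivable/differentiable_comp.
rewrite !deriveE//; last exact: differentiable_comp.
by rewrite diff_comp//= (deriv1E DF) derive1E FdF [LHS]mulrC.
Qed.

Lemma differentiable_comp_real (F : R -> R) (dF : R) p x :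
  is_derive (p x) 1 F dF -> differentiable p x -> differentiable (F \o p) x.
Proof.
by move=> [DF _] dp; apply: differentiable_comp => //; exact/derivable1_diffP.
Qed.

End ScalarClosure.

Section CompositionClosure.
Context {U : normedModType R}.
Implicit Types (p : U -> R) (k : nat).

(** The chain rule writes each derivative as a product of functions already known to be smooth. This
    serves for antiderivatives without a closed formula. *)
Lemma smooth_comp_prim (F dF : R -> R) p :
  (forall x, is_derive (p x) 1 F (dF (p x))) ->
  smooth p -> smooth (dF \o p) -> smooth (F \o p).
Proof.
move=> FdF sp sdF; apply/smoothP; case=> [|k]; split => //.
- by move=> x; apply: differentiable_comp_real (FdF x) (smooth_differentiable x sp).
- by move=> x; apply: differentiable_comp_real (FdF x) (smooth_differentiable x sp).
move=> v; have -> : 'D_v (F \o p) = (dF \o p) * 'D_v p.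
  by apply: derive_eq_fun => x; exact: is_derive_comp_real (FdF x) (smooth_differentiable x sp).
by apply: kdiffM; apply: smooth_kdiff => //; exact: smooth_derive.
Qed.

(** Each derivative in the family is a combination of two members, so induction on the order of
    differentiability, for all members at once, closes up. *)
Lemma smooth_comp_family (F : nat -> R -> R) (D : set R) p
    (c1 c2 : nat -> R) (s1 s2 : nat -> nat) :
  (forall i t, D t ->
    is_derive t 1 (F i) (c1 i * F (s1 i) t + c2 i * F (s2 i) t)) ->
  (forall x, D (p x)) -> smooth p -> forall i, smooth (F i \o p).
Proof.
move=> DF Dp sp i; apply/smoothP => k; elim: k i => [|k IH] i; split => //.
- by move=> x; apply: differentiable_comp_real (DF i _ (Dp x)) (smooth_differentiable x sp).
- by move=> x; apply: differentiable_comp_real (DF i _ (Dp x)) (smooth_differentiable x sp).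
move=> v; have -> : 'D_v (F i \o p) =
    (cst (c1 i) * (F (s1 i) \o p) + cst (c2 i) * (F (s2 i) \o p)) * 'D_v p.
  by apply: derive_eq_fun => x; exact: is_derive_comp_real (DF i _ (Dp x)) (smooth_differentiable x sp).
apply: kdiffM; last exact/smooth_kdiff/smooth_derive.
by apply: kdiffD; apply: kdiffM => //; exact: kdiff_cst.
Qed.

End CompositionClosure.

(** * Flat functions and powers of the norm *)

Section BumpFunctions.
Implicit Types (t : R) (k : nat).

(** [psi 0] is the usual function exp(-1/t) that is flat at 0. The extra index makes the family
    closed under differentiation. *)
Definition psi k t : R := if 0 < t then t ^- k * expR (- t^-1) else 0.

(** The power |x|^-k as a function of [t] = |x|^2, the variable in which composition with the
    squared distance is smooth. *)
Definition kappa k t : R := (Num.sqrt t) ^- k.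

Lemma psi_ge0 k t : 0 <= psi k t.
Proof.
rewrite /psi; case: ifPn => // t0.
by rewrite mulr_ge0 ?expR_ge0// invr_ge0 exprn_ge0// ltW.
Qed.

Lemma psi_gt0 k t : 0 < t -> 0 < psi k t.
Proof.
by move=> t0; rewrite /psi t0 mulr_gt0 ?expR_gt0// invr_gt0 exprn_gt0.
Qed.

Lemma psi_le0 k t : t <= 0 -> psi k t = 0.
Proof. by rewrite /psi leNgt => /negbTE ->. Qed.

(** From exp(s) >= s^(k+1)/(k+1)! at s = 1/t. It gives continuity at 0, and all numerical bounds on
    [psi 2] below, in the form [psi 2 t <= 6 * t] for positive [t]. *)
Lemma psi_bound k t : psi k t <= k.+1`!%:R * `|t|.
Proof.
rewrite /psi; case: ifPn => [t0|_]; last by rewrite mulr_ge0.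
rewrite (gtr0_norm t0) expRN -ler_pdivlMl ?invr_gt0 ?exprn_gt0// invrK.
rewrite -[leLHS]mul1r ler_pdivrMr ?expR_gt0//.
have := expR_ge1Dxn k (ltW (_ : 0 < t^-1)); rewrite invr_gt0 => /(_ t0) h.
apply: (@le_trans _ _ ((t ^+ k * (k.+1`!%:R * t)) * (t^-1 ^+ k.+1 / k.+1`!%:R))); last first.
  rewrite ler_wpM2l//; last by apply: le_trans h; rewrite lerDr.
  by rewrite mulr_ge0 ?mulr_ge0 ?exprn_ge0 ?ltW.
rewrite le_eqVlt; apply/orP; left; apply/eqP.
rewrite exprVn exprS; field.
by rewrite expf_neq0 ?gt_eqF//= ltr0n fact_gt0.
Qed.

Lemma is_derive_exprVn k t : t != 0 ->
  is_derive t 1 (fun s => s ^- k) (- k%:R * t ^- k.+1).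
Proof.
move=> t0; have tk : t ^+ k != 0 by rewrite expf_neq0.
have d : is_derive t 1 (fun s : R => s ^+ k) (k%:R * t ^+ k.-1).
  apply: DeriveDef; first exact: exprn_derivable.
  by rewrite exp_derive [LHS]mulr1.
apply: is_derive_eq (@is_deriveV _ (fun s => s ^+ k) t _ _ tk d) _.
rewrite /GRing.scale/=; case: k tk {d} => [|k] tk; first by rewrite !mul0r oppr0 mul0r mulr0.
by rewrite /= !exprS expr0; field; rewrite t0 expf_neq0.
Qed.

Lemma psi_cvg0 k : {for 0, continuous (psi k)}.
Proof.
rewrite /prop_for /continuous_at psi_le0//.
apply: (@squeeze_cvgr _ _ _ _ (cst 0) (fun t => k.+1`!%:R * `|t|)).
- by near=> t; rewrite psi_ge0 psi_bound.
- exact: cvg_cst.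
have h : k.+1`!%:R * `|t| @[t --> (0 : R)] --> k.+1`!%:R * `|0 : R|.
  by apply: cvgM; [exact: cvg_cst|exact: norm_continuous].
by rewrite normr0 mulr0 in h.
Unshelve. all: by end_near. Qed.

Lemma is_derive_psi k t :
  is_derive t 1 (psi k) (- k%:R * psi k.+1 t + 1 * psi k.+2 t).
Proof.
have [t0|t0|->] := ltgtP t 0.
- rewrite !psi_le0 ?ltW// mulr0 mulr0 addr0.
  apply: (@near_eq_is_derive _ _ _ (cst 0)).
  by near=> s; rewrite psi_le0// ltW//; near: s; exact: lt_nbhsl.
- apply: (@near_eq_is_derive _ _ _ ((fun t => t ^- k) * (expR \o (fun t => - t^-1)))).
    near=> s; rewrite /psi ifT//; near: s; exact: lt_nbhsr.
  rewrite /psi t0.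
  have tn0 : t != 0 by rewrite gt_eqF.
  have d1 := is_derive_exprVn k tn0.
  have d2 : is_derive t 1 (fun s : R => - s^-1) (t ^- 2).
    apply: is_derive_eq (is_deriveN (@is_deriveV _ id t _ _ tn0 (is_derive_id t 1))) _.
    by rewrite scaleNr opprK /GRing.scale/= mulr1.
  have d3 := is_derive1_comp (is_derive_expR _) d2.
  apply: is_derive_eq (is_deriveM d1 d3) _.
  rewrite /GRing.scale/= !exprS; field.
  by rewrite tn0 expf_neq0.
rewrite !psi_le0// !mulr0 addr0.
(* At 0 the slope function is [psi k.+1] itself, because [psi k z = psi k.+1 z * z]; it is
   continuous and vanishes there. *)
apply/is_derive1_caratheodory; exists (psi k.+1); split.
- move=> z; rewrite (@psi_le0 _ 0)// !subr0 /psi; case: ifPn => [z0|]; last by rewrite mul0r.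
  have z1 : z != 0 by rewrite gt_eqF.
  by rewrite exprS; field; rewrite expf_neq0 ?z1.
- exact: psi_cvg0.
- by rewrite psi_le0.
Unshelve. all: by end_near. Qed.

Lemma is_derive_kappa k t : 0 < t ->
  is_derive t 1 (kappa k) (- (k%:R / 2) * kappa k.+2 t + 0 * kappa 0 t).
Proof.
move=> t0; have s0 : Num.sqrt t != 0 by rewrite gt_eqF// sqrtr_gt0.
apply: is_derive_eq (is_derive1_comp (is_derive_exprVn k s0) (is_derive1_sqrt t0)) _.
by rewrite /kappa mul0r addr0 !exprS; field; rewrite s0 expf_neq0.
Qed.

Lemma smooth_psi (U : normedModType R) (p : U -> R) k : smooth p -> smooth (psi k \o p).
Proof.
move=> sp; exact: (@smooth_comp_family _ psi setT p (fun i => - i%:R) (fun=> 1) S (fun i => i.+2)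
  (fun i t _ => is_derive_psi i t) (fun=> I) sp).
Qed.

Lemma smooth_kappa (U : normedModType R) (p : U -> R) k : (forall x, 0 < p x) ->
  smooth p -> smooth (kappa k \o p).
Proof.
move=> p0 sp; exact: (@smooth_comp_family _ kappa [set t | 0 < t] p
  (fun i => - (i%:R / 2)) (fun=> 0) (fun i => i.+2) (fun=> 0%N) is_derive_kappa p0 sp).
Qed.

Lemma kappa_continuous k t : 0 < t -> {for t, continuous (kappa k)}.
Proof.
by move=> t0; apply/differentiable_continuous/derivable1_diffP; case: (is_derive_kappa k t0).
Qed.

End BumpFunctions.
End SmoothFunctions.

(** * First variation *)

Section BorelFunctions.
Context {R : realType} {T : ptopologicalType}.
Implicit Types (f : T -> R) (A : set T).

Lemma open_borel A : open A -> measurable (A : set (borel T)).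
Proof. by move=> oA; exact: sub_sigma_algebra. Qed.

Lemma closed_borel A : closed A -> measurable (A : set (borel T)).
Proof.
move=> cA; rewrite -[A]setCK; apply: measurableC; apply: open_borel.
exact: closed_openC.
Qed.

Lemma continuous_borel f : continuous f -> measurable_fun setT (f : borel T -> R).
Proof.
move=> cf; apply: (measurability _ (RGenOInfty.measurableE R)) => _ [_ [x ->] <-].
rewrite setTI; apply: open_borel; apply: open_comp; first by move=> y _; exact: cf.
by apply: interval_open.
Qed.

End BorelFunctions.

Section FirstVariation.
Context {R : realType} {m n : nat} {mn : (m <= n)%N}.
Notation Z := (varifold_space R mn).
Implicit Types (V : {measure set (borel Z) -> \bar R}) (z : Z)
  (phi : 'rV[R]_n -> R) (M : 'M[R]_n) (c x v : 'rV[R]_n).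

Definition bounded_support (phi : 'rV[R]_n -> R) :=
  exists r : R, forall x, r < enorm x -> phi x = 0.

(** The integrand of the first variation along the field [phi x *: (x *m M + c)], at the point [z.1]
    and the plane [z.2]. *)
Definition variation_density phi M c z : R :=
  'D_((z.1 *m M + c) *m grass_projmx z.2) phi z.1 +
  phi z.1 * \tr (M *m grass_projmx z.2).

Lemma continuous_fst_Z : continuous (fun z : Z => z.1).
Proof. by move=> z; exact: cvg_fst. Qed.

Lemma continuous_snd_Z : continuous (fun z : Z => z.2).
Proof. by move=> z; exact: cvg_snd. Qed.

Lemma compact_cylinder a (r : R) : compact ((eball a r `*` setT) : set Z).
Proof. by apply: compact_setX; [exact: compact_eball|exact: compact_grass]. Qed.

Lemma bounded_support_compact (W : normedModType R) (g : 'rV[R]_n -> W) (r : R) :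
  (forall x, r < enorm x -> g x = 0) -> compactly_supported g.
Proof.
move=> gr; apply: (subclosed_compact (B := eball 0 r)).
- exact: closed_closure.
- exact: compact_eball.
have /closure_id -> := @closed_eball R n 0 r.
apply: closureS => x /=; rewrite /eball/= subr0 leNgt; apply: contra => /gr ->.
by rewrite eqxx.
Qed.

Lemma continuous_proj_entry i j : continuous (fun z : Z => grass_projmx z.2 i j).
Proof.
move=> z; apply: (@continuous_comp _ _ _ (fun z : Z => z.2) (fun T => grass_projmx T i j)).
  exact: continuous_snd_Z.
apply: (@continuous_comp _ _ _ (@grass_projmx R m n mn) (fun P : 'M[R]_n => P i j)).
  exact: grass_continuous.
exact: coord_continuous.
Qed.

Lemma continuous_fst_entry i : continuous (fun z : Z => z.1 0 i).
Proof.
move=> z; apply: (@continuous_comp _ _ _ (fun z : Z => z.1) (fun x => x 0 i)).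
  exact: continuous_fst_Z.
exact: coord_continuous.
Qed.

Lemma continuous_sumR (U : topologicalType) (k : nat) (f : 'I_k -> U -> R) :
  (forall i, continuous (f i)) -> continuous (fun y => \sum_i f i y).
Proof.
move=> cf; apply: (@continuous_big _ _ +%R) => [|i _]; last exact: cf.
exact: add_continuous.
Qed.

Lemma continuous_mulR (U : topologicalType) (f g : U -> R) :
  continuous f -> continuous g -> continuous (fun y => f y * g y).
Proof. by move=> cf cg y; exact: continuousM (cf y) (cg y). Qed.

Lemma continuous_addR (U : topologicalType) (f g : U -> R) :
  continuous f -> continuous g -> continuous (fun y => f y + g y).
Proof. by move=> cf cg y; exact: continuousD (cf y) (cg y). Qed.

Lemma derive_sum_coord phi x v : differentiable phi x ->
  'D_v phi x = \sum_i v 0 i * 'D_(delta_mx 0 i) phi x.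
Proof.
move=> dphi; rewrite deriveE// {1}[v]row_sum_delta linear_sum.
by apply: eq_bigr => i _; rewrite linearZ/= deriveE.
Qed.

Lemma continuous_variation_density phi M c : smooth phi ->
  continuous (variation_density phi M c).
Proof.
move=> sphi; rewrite /variation_density; apply: continuous_addR.
  under eq_fun => z do rewrite (derive_sum_coord _ (smooth_differentiable z.1 sphi)).
  apply: continuous_sumR => i; apply: continuous_mulR.
    under eq_fun do rewrite mxE.
    apply: continuous_sumR => j; apply: continuous_mulR; last exact: continuous_proj_entry.
    under eq_fun do rewrite !mxE.
    apply: continuous_addR; last exact: cst_continuous.
    apply: continuous_sumR => k; apply: continuous_mulR; last exact: cst_continuous.
    exact: continuous_fst_entry.
  move=> z; apply: (@continuous_comp _ _ _ (fun z : Z => z.1) ('D_(delta_mx 0 i) phi)).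
    exact: continuous_fst_Z.
  exact/smooth_continuous/smooth_derive.
apply: continuous_mulR.
  move=> z; apply: (@continuous_comp _ _ _ (fun z : Z => z.1) phi).
    exact: continuous_fst_Z.
  exact: smooth_continuous.
apply: continuous_sumR => i; under eq_fun do rewrite mxE.
apply: continuous_sumR => j; apply: continuous_mulR; first exact: cst_continuous.
exact: continuous_proj_entry.
Qed.

Lemma derive_bounded_support phi v r x : (forall x, r < enorm x -> phi x = 0) ->
  r < enorm x -> 'D_v phi x = 0.
Proof.
move=> pr rx; rewrite (@near_eq_derive _ _ _ phi (cst 0)) ?derive_cst//.
have : nbhs x [set y | r < enorm y].
  apply: open_nbhs_nbhs; split => //.
  rewrite (_ : mkset _ = (fun y => enorm (y - 0)) @^-1` [set s | r < s]).
    by apply: open_comp; [move=> y _; exact: continuous_enorm_sub|exact: open_gt].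
  by apply/seteqP; split => y /=; rewrite subr0.
by apply: filterS => y /pr.
Qed.

Lemma variation_density_support phi M c r z : (forall x, r < enorm x -> phi x = 0) ->
  r < enorm z.1 -> variation_density phi M c z = 0.
Proof.
by move=> pr rz; rewrite /variation_density (derive_bounded_support _ pr rz) (pr _ rz) mul0r addr0.
Qed.

Definition entry (i : 'I_n) (x : 'rV[R]_n) : R := x 0 i.

Lemma entry_is_linear (i : 'I_n) : linear (entry i).
Proof. by move=> t x y; rewrite /entry !mxE. Qed.

HB.instance Definition _ i := GRing.isLinear.Build R _ _ _ _ (entry_is_linear i).

Lemma entry_continuous (i : 'I_n) : continuous (entry i).
Proof. exact: coord_continuous. Qed.

Lemma smooth_coord (i : 'I_n) : smooth (fun x : 'rV[R]_n => x 0 i).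
Proof.
exact: (@smooth_linear R _ _ (entry i : {linear _ -> _}) (@entry_continuous i)).
Qed.

Lemma is_derive_coord (i : 'I_n) x v : is_derive x v (fun y : 'rV[R]_n => y 0 i) (v 0 i).
Proof.
apply: is_derive_eq (smooth_is_derive _ _ (smooth_coord i)) _.
rewrite deriveE; last exact/smooth_differentiable/smooth_coord.
by rewrite (@diff_lin _ _ _ (entry i : {linear _ -> _}) x (@entry_continuous i)).
Qed.

Lemma is_derive_sumR (I : Type) (r : seq I) (f : I -> 'rV[R]_n -> R) (df : I -> R) x v :
  (forall i, is_derive x v (f i) (df i)) ->
  is_derive x v (fun y => \sum_(i <- r) f i y) (\sum_(i <- r) df i).
Proof.
move=> fdf; elim: r => [|i r IH].
  by rewrite big_nil; under eq_fun do rewrite big_nil; exact: is_derive_cst.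
rewrite big_cons; under eq_fun do rewrite big_cons.
exact: is_deriveD.
Qed.

Lemma derive_scalel p (w : 'rV[R]_n) x v : differentiable p x ->
  'D_v (fun y : 'rV[R]_n => (p y : R) *: w) x = 'D_v p x *: w.
Proof.
by move=> dp; rewrite !deriveE//; [rewrite diffZl|exact: differentiableZl].
Qed.

Lemma first_variation_affine V phi M c : stationary V -> smooth phi ->
  bounded_support phi ->
  (\int[V]_z (variation_density phi M c z)%:E)%E = 0%E.
Proof.
move=> statV sphi [r pr].
pose ell x := x *m M + c.
(* The field is expanded in coordinates because smoothness of products is available for a scalar
   function times a fixed vector. *)
pose g x : 'rV[R]_n := \sum_j (phi x * ell x 0 j) *: (delta_mx 0 j : 'rV[R]_n).
have gE x : g x = phi x *: ell x.
  rewrite [ell x in RHS]row_sum_delta scaler_sumr.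
  by apply: eq_bigr => j _; rewrite scalerA.
have sell j : smooth (fun x => ell x 0 j).
  have -> : (fun x => ell x 0 j) = (fun x => \sum_k x 0 k * M k j + c 0 j).
    by apply/funext => x; rewrite !mxE.
  apply: smoothD; last exact: smooth_cst.
  by apply: smooth_sum => k; apply: smoothM; [exact: smooth_coord|exact: smooth_cst].
have sg : smooth g.
  by apply: smooth_sum => j; apply: smoothZl; exact: smoothM.
rewrite -(statV g sg); last first.
  by apply: (@bounded_support_compact _ _ r) => x rx; rewrite gE pr// scale0r.
rewrite /first_variation; congr integral; apply/funext => -[x T]; congr EFin.
rewrite /variation_density/=.
have dell v j : is_derive x v (fun y => ell y 0 j) ((v *m M) 0 j).
  have -> : (fun y => ell y 0 j) = (fun y => (\sum_k y 0 k * M k j) + c 0 j).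
    by apply/funext => y; rewrite /ell !mxE.
  apply: is_derive_eq (is_deriveD _ (is_derive_cst _ _ _)) (addr0 _).
  rewrite mxE; apply: is_derive_sumR => k.
  apply: is_derive_eq (is_deriveM (is_derive_coord k x v) (is_derive_cst _ _ _)) _.
  by rewrite scaler0 add0r [LHS]mulrC.
have dg v : 'd g x v = 'D_v phi x *: ell x + phi x *: (v *m M).
  rewrite -deriveE; last exact: smooth_differentiable.
  have dphi := smooth_is_derive v x sphi.
  have -> : g = \sum_j (fun y => (phi y * ell y 0 j) *: (delta_mx 0 j : 'rV[R]_n)).
    by apply/funext => y; rewrite fct_sumE.
  rewrite derive_sum; last first.
    by move=> j; apply/diff_derivable/smooth_differentiable/smoothZl/smoothM.
  rewrite [ell x]row_sum_delta [v *m M]row_sum_delta !scaler_sumr -big_split/=.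
  apply: eq_bigr => j _.
  rewrite derive_scalel; last by apply/smooth_differentiable/smoothM.
  rewrite !scalerA -scalerDl; congr (_ *: _).
  have [_ ->] := is_deriveM dphi (dell v j).
  by rewrite /GRing.scale/= addrC; congr (_ + _); rewrite mulrC.
pose P := grass_projmx T.
(* The differential is a rank one matrix, gradient times field, plus [phi x *: M]; by cyclicity the
   trace of the rank one part is a directional derivative of [phi]. *)
have -> : lin1_mx (orthproj (grass_vspace T) \o 'd g x) =
    (\col_i 'D_(delta_mx 0 i) phi x) *m (ell x *m P) + phi x *: (M *m P).
  apply/row_matrixP => i; rewrite rowE mul_rV_lin1/= dg -mul_projmx.
  rewrite [RHS]linearD/= row_mul [X in _ = _ + X]linearZ/= row_mul -rowE.
  have -> : row i (\col_i 'D_(delta_mx 0 i) phi x) = ('D_(delta_mx 0 i) phi x)%:M.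
    by apply/rowP => k; rewrite !mxE (ord1 k) eqxx mulr1n.
  by rewrite mul_scalar_mx mulmxDl -!scalemxAl.
rewrite linearD/= linearZ/=; congr (_ + _).
rewrite derive_sum_coord; last exact: smooth_differentiable.
rewrite mxtrace_mulC trace_mx11 mxE.
by apply: eq_bigr => i _; congr (_ * _); rewrite [RHS]mxE.
Qed.

Lemma integrable_bounded_support V (f : Z -> R) r : varifold V -> continuous f ->
  (forall z, r < enorm z.1 -> f z = 0) -> V.-integrable setT (EFin \o f).
Proof.
move=> [Vfin _ _] cf fr.
have mf := continuous_borel cf.
pose K : set Z := eball 0 r `*` setT.
have cK : compact K by exact: compact_cylinder.
have [C fC] : exists C : R, forall z, K z -> `|f z| <= C.
  have /compact_bounded : compact (f @` K).
    by apply: continuous_compact => //; exact: continuous_subspaceT.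
  move=> [C [_ /(_ (C + 1))]]; rewrite ltrDl ltr01 => /(_ isT) h.
  by exists (C + 1) => z Kz; apply: h; exists z.
have mK : measurable (K : set (borel Z)).
  apply: closed_borel.
  rewrite (_ : K = (fun z : Z => enorm (z.1 - 0)) @^-1` [set s | s <= r]).
    apply: preimage_closed; last exact: closed_le.
    move=> z _; apply: (@continuous_comp _ _ _ (fun z : Z => z.1) (fun x => enorm (x - 0))).
      exact: continuous_fst_Z.
    exact: continuous_enorm_sub.
  by apply/seteqP; split => z /=; [case|].
apply: (@le_integrable _ (borel Z) R V setT measurableT _ (fun z => (C * \1_K z)%:E)).
- exact/measurable_EFinP.
- move=> z _ /=; rewrite lee_fin indicE; have [zK|zK] := boolP (z \in K).
    by rewrite mulr1 (le_trans (fC _ _)) ?ler_norm//; rewrite inE in zK.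
  rewrite mulr0 fr ?normr0//; rewrite notin_setE /K/= in zK.
  by rewrite ltNge; apply/negP => h; apply: zK; split => //=; rewrite /eball/= subr0.
under eq_fun do rewrite EFinM.
apply: integrableZl => //; apply/integrableP; split.
  by apply/measurable_EFinP; exact: measurable_indic.
under eq_integral do rewrite gee0_abs ?lee_fin//.
by rewrite integral_indic// setIT; exact: Vfin.
Qed.

End FirstVariation.

(** * Radial kernels *)

Section Balance.
Context d {T : measurableType d} {R : realType} (mu : {measure set T -> \bar R}).
Local Open Scope ereal_scope.

Lemma ge0_integral_full (N : set T) (F : T -> R) :
  measurable N -> mu N = 0 -> measurable_fun setT F -> (forall z, 0 <= F z)%R ->
  \int[mu]_z (F z)%:E = \int[mu]_(z in ~` N) (F z)%:E.
Proof.
move=> mN N0 mF F0.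
rewrite (@ge0_negligible_integral _ _ _ mu setT N)//.
- by rewrite setTD.
- exact/measurable_EFinP.
- by move=> z _; rewrite lee_fin.
Qed.

(** [I] will be the integrand of a first variation. If [F2] has infinite integral the claim is
    trivial; otherwise [F2 + I] is integrable and the term [I] integrates to 0. *)
Lemma le_integral_balance (N : set T) (F1 F2 I : T -> R) :
  measurable N -> mu N = 0 ->
  measurable_fun setT F1 -> measurable_fun setT F2 ->
  (forall z, 0 <= F1 z)%R -> (forall z, 0 <= F2 z)%R ->
  mu.-integrable setT (EFin \o I) -> \int[mu]_z (I z)%:E = 0 ->
  (forall z, (~` N) z -> F1 z <= F2 z + I z)%R ->
  \int[mu]_z (F1 z)%:E <= \int[mu]_z (F2 z)%:E.
Proof.
move=> mN N0 mF1 mF2 F10 F20 iI I0 le12.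
rewrite (ge0_integral_full mN N0 mF1 F10) (ge0_integral_full mN N0 mF2 F20).
have mNc := measurableC mN.
set D := ~` N in le12 mNc *.
have ID : \int[mu]_(z in D) (I z)%:E = 0.
  by rewrite -I0 [RHS](@negligible_integral _ _ _ mu setT N)// setTD.
have [->|F2fin] := eqVneq (\int[mu]_(z in D) (F2 z)%:E) +oo; first by rewrite leey.
have iF2 : mu.-integrable D (EFin \o F2).
  apply/integrableP; split; first by apply/measurable_EFinP; exact: measurable_funTS.
  under eq_integral do rewrite /= ger0_norm//.
  by rewrite ltey.
have iID : mu.-integrable D (EFin \o I) by exact: integrableS iI.
rewrite -[leRHS]adde0 -ID -integralD//.
apply: ge0_le_integral => //.
- by move=> z _; rewrite lee_fin.
- by apply/measurable_EFinP; exact: measurable_funTS.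
- by apply: (measurable_int mu); exact: integrableD.

Qed.

End Balance.

Lemma continuous_antiderivative (R : realType) (f : R -> R) : continuous f ->
  exists F : R -> R, forall t : R, -1 < t -> is_derive t 1 F (f t).
Proof.
move=> cf.
(* The base point -1 makes the derivative two-sided at every [t >= 0], including 0. *)
exists (fun x => \int[@lebesgue_measure R]_(t in [set` `[-1, x]]) (f t))%R => t t1.
have i : (@lebesgue_measure R).-integrable `[-1, t + 1] (EFin \o f).
  apply: continuous_compact_integrable; first exact: segment_compact.
  exact: continuous_subspaceT.
have t2 : t < t + 1 by rewrite ltrDl.
have [dF Ff] := @continuous_FTC1_closed R f (-1) t (t + 1) t2 i t1 (cf t).
by apply: (DeriveDef dF); rewrite -derive1E.
Qed.

(** * A smooth cutoff function *)

Section Cutoff.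
Context {R : realType}.
Implicit Types t : R.

(** The value of [psi 0 (t - 1 / 4)] at [t = 1], which makes [cutoff] vanish from there on. *)
Definition cutoff_height : R := psi 0 (3 / 4).

(** Equal to [psi 0 cutoff_height] on [t <= 1/4] and to [0] on [1 <= t]. *)
Definition cutoff t : R := psi 0 (cutoff_height - psi 0 (t - 1 / 4)).

Definition dcutoff t : R :=
  psi 2 (cutoff_height - psi 0 (t - 1 / 4)) * psi 2 (t - 1 / 4).

Lemma is_derive_psi0 t : is_derive t 1 (@psi R 0) (psi 2 t).
Proof. by apply: is_derive_eq (is_derive_psi 0 t) _; rewrite mulr0n oppr0 mul0r add0r mul1r. Qed.

Lemma is_derive_psi0_sub t (c : R) : is_derive t 1 (fun s => psi 0 (s - c)) (psi 2 (t - c)).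
Proof.
have h : is_derive t 1 (fun s : R => s - c) 1.
  by apply: is_derive_eq (is_deriveB (is_derive_id t 1) (is_derive_cst c t 1)) _; rewrite subr0.
by apply: is_derive_eq (is_derive1_comp (is_derive_psi0 _) h) _; rewrite mulr1.
Qed.

Lemma is_derive_cutoff t : is_derive t 1 cutoff (- dcutoff t).
Proof.
have h : is_derive t 1 (fun s => cutoff_height - psi 0 (s - 1 / 4)) (- psi 2 (t - 1 / 4)).
  by apply: is_derive_eq (is_deriveB (is_derive_cst cutoff_height t 1) (is_derive_psi0_sub t (1/4))) _; rewrite sub0r.
by apply: is_derive_eq (is_derive1_comp (is_derive_psi0 _) h) _; rewrite mulrN.
Qed.

Lemma psi_ndecr (s t : R) : s <= t -> psi 0 s <= psi 0 t.
Proof.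
move=> st; rewrite /psi; case: ifPn => s0; last exact: (psi_ge0 0 t).
by rewrite (lt_le_trans s0 st) !expr0 !invr1 !mul1r ler_expR lerN2 lef_pV2// posrE (lt_le_trans s0 st).
Qed.

Lemma cutoff_height_gt0 : 0 < cutoff_height.
Proof. by rewrite psi_gt0// divr_gt0. Qed.

Lemma cutoff_ge0 t : 0 <= cutoff t. Proof. exact: psi_ge0. Qed.

Lemma cutoff_eq0 t : 1 <= t -> cutoff t = 0.
Proof.
move=> t1; rewrite /cutoff psi_le0// subr_le0 psi_ndecr//; lra.
Qed.

Lemma cutoff_near t : t <= 1 / 4 -> cutoff t = psi 0 cutoff_height.
Proof. by move=> t1; rewrite /cutoff (@psi_le0 _ _ (t - _)) ?subr0// subr_le0. Qed.

Lemma dcutoff_ge0 t : 0 <= dcutoff t.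
Proof. by rewrite mulr_ge0 ?psi_ge0. Qed.

Lemma dcutoff_near t : t <= 1 / 4 -> dcutoff t = 0.
Proof. by move=> t1; rewrite /dcutoff [X in _ * X]psi_le0 ?mulr0// subr_le0. Qed.

Lemma dcutoff_eq0 t : 1 <= t -> dcutoff t = 0.
Proof.
move=> t1; rewrite /dcutoff psi_le0 ?mul0r// subr_le0 psi_ndecr//; lra.
Qed.

(** Each of the two factors is [psi 2] at an argument of absolute value at most 1, hence at most 3!
    = 6, on the interval where the product does not vanish. *)
Lemma dcutoff_le t : dcutoff t <= 36.
Proof.
have [t1|t1] := leP 1 t; first by rewrite dcutoff_eq0.
have [t4|t4] := leP t (1 / 4); first by rewrite dcutoff_near.
have h1 : psi 2 (t - 1 / 4) <= 6.
  apply: le_trans (psi_bound _ _) _; rewrite ger0_norm; last by rewrite subr_ge0 ltW.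
  have -> : (3`!%:R = 6 :> R) by []. lra.
have h2 : psi 2 (cutoff_height - psi 0 (t - 1 / 4)) <= 6.
  apply: le_trans (psi_bound _ _) _.
  have -> : (3`!%:R = 6 :> R) by [].
  have hc : cutoff_height <= 3 / 4 :> R.
    by apply: le_trans (psi_bound _ _) _; rewrite ger0_norm ?mul1r// divr_ge0.
  have h0 := psi_ge0 0 (t - 1 / 4).
  have h1' : psi 0 (t - 1 / 4) <= cutoff_height by apply: psi_ndecr; lra.
  rewrite ger0_norm; lra.
have := psi_ge0 2 (t - 1 / 4); have := psi_ge0 2 (cutoff_height - psi 0 (t - 1 / 4)).
rewrite /dcutoff; nra.
Qed.

End Cutoff.

Section Kernel.
Context {R : realType} (m : nat).
Implicit Types t s r rho : R.

Lemma kappa_ge0 k s : 0 <= kappa k s.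
Proof. by rewrite /kappa invr_ge0 exprn_ge0// sqrtr_ge0. Qed.

Lemma kappa_le k s t : 0 < s -> s <= t -> kappa k t <= kappa k s.
Proof.
move=> s0 st; have t0 := lt_le_trans s0 st.
rewrite /kappa lef_pV2 ?posrE ?exprn_gt0 ?sqrtr_gt0//.
by rewrite lerXn2r ?nnegrE ?sqrtr_ge0// ler_wsqrtr.
Qed.

Lemma kappa_sqr k r : 0 < r -> kappa k (r ^+ 2) = r ^- k.
Proof. by move=> r0; rewrite /kappa sqrtr_sqr gtr0_norm. Qed.

Lemma kappaS2 k s : 0 < s -> kappa k s = s * kappa k.+2 s.
Proof.
move=> s0; have q0 : Num.sqrt s != 0 by rewrite gt_eqF// sqrtr_gt0.
rewrite /kappa -[X in X * _](sqr_sqrtr (ltW s0)) !exprS; field.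
by rewrite q0 expf_neq0.
Qed.

(** Truncation of [|x|^-m], regularised at the scale [rho]; [t] stands for [|x|^2]. *)
Definition radial rho r t : R := kappa m (t + rho ^+ 2) * cutoff (t / r ^+ 2).

Definition dradial rho r t : R :=
  - (m%:R / 2) * kappa m.+2 (t + rho ^+ 2) * cutoff (t / r ^+ 2) -
  kappa m (t + rho ^+ 2) * (dcutoff (t / r ^+ 2) / r ^+ 2).

Lemma is_derive_affine (c e t : R) : is_derive t 1 (fun s => s * c + e) c.
Proof.
have h := is_deriveD (is_deriveM (is_derive_id t (1 : R)) (is_derive_cst c t 1)) (is_derive_cst e t 1).
by apply: is_derive_eq h _; rewrite /GRing.scale/= mulr0 add0r addr0 mulr1.
Qed.

Lemma is_derive_radial rho r t : 0 < t + rho ^+ 2 ->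
  is_derive t 1 (radial rho r) (dradial rho r t).
Proof.
move=> t0.
have d1 : is_derive t 1 (fun s => kappa m (s + rho ^+ 2)) (- (m%:R / 2) * kappa m.+2 (t + rho ^+ 2)).
  have h : is_derive t 1 (fun s => s + rho ^+ 2) 1.
    by apply: is_derive_eq (is_deriveD (is_derive_id t (1 : R)) (is_derive_cst _ t 1)) _; rewrite addr0.
  apply: is_derive_eq (@is_derive1_comp _ (kappa m) (fun s => s + rho ^+ 2) t _ _ (is_derive_kappa m t0) h) _.
  by rewrite mul0r addr0 mulr1.
have d2 : is_derive t 1 (fun s => cutoff (s / r ^+ 2)) (- dcutoff (t / r ^+ 2) / r ^+ 2).
  have h : is_derive t 1 (fun s => s / r ^+ 2) (r ^- 2).
    have := is_derive_affine (r ^- 2) 0 t; under eq_fun do rewrite addr0; exact.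
  by apply: is_derive_eq (is_derive1_comp (is_derive_cutoff _) h) _.
apply: is_derive_eq (is_deriveM d1 d2) _.
by rewrite /GRing.scale/= /dradial addrC; congr (_ + _); [rewrite mulrC|rewrite mulNr mulrN].
Qed.

Lemma radial_ge0 rho r t : 0 <= radial rho r t.
Proof. by rewrite mulr_ge0 ?kappa_ge0 ?cutoff_ge0. Qed.

Lemma dradial_le0 rho r t : dradial rho r t <= 0.
Proof.
rewrite /dradial mulNr mulNr -opprD oppr_le0 addr_ge0//.
  by rewrite !mulr_ge0 ?kappa_ge0 ?cutoff_ge0.
by rewrite mulr_ge0 ?kappa_ge0 ?divr_ge0 ?dcutoff_ge0 ?sqr_ge0.
Qed.

Lemma radial_eq0 rho r t : 0 < r -> r ^+ 2 <= t -> radial rho r t = 0.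
Proof.
by move=> r0 rt; rewrite /radial cutoff_eq0 ?mulr0// ler_pdivlMr ?exprn_gt0// mul1r.
Qed.

(** With s = t + rho^2 one has kappa_m(s) = s kappa_(m+2)(s), so the terms m kappa_m(s) and - m t
    kappa_(m+2)(s) leave only m rho^2 kappa_(m+2)(s): the divergence of x/|x|^m vanishes up to the
    regularisation, and the rest comes from the cutoff. *)
Lemma radialE rho r t : 0 < rho -> 0 <= t ->
  m%:R * radial rho r t + 2 * t * dradial rho r t =
  m%:R * rho ^+ 2 * kappa m.+2 (t + rho ^+ 2) * cutoff (t / r ^+ 2) -
  2 * t * kappa m (t + rho ^+ 2) * (dcutoff (t / r ^+ 2) / r ^+ 2).
Proof.
move=> rho0 t0; have s0 : 0 < t + rho ^+ 2 by rewrite ltr_wpDl// exprn_gt0.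
rewrite /radial /dradial (kappaS2 m s0).
set c := cutoff _; set e := dcutoff _ / _; by move: c e => c e; field.
Qed.

(** For t <= rho^2, kappa_(m+2)(t + rho^2) is at least (2 rho)^-(m+2), and the cutoff has its
    plateau value [psi 0 cutoff_height]. *)
Definition radial_lower : R := m%:R * psi 0 cutoff_height / 2 ^+ m.+2.
(** The product of 2 (from 2 t <= 2 r^2), 2^m (from kappa_m <= (2/r)^m) and 36 (from
    [dcutoff_le]). *)
Definition radial_upper : R := 72 * 2 ^+ m.

Lemma radial_lower_gt0 : (0 < m)%N -> 0 < radial_lower.
Proof.
move=> m0; rewrite divr_gt0 ?exprn_gt0// mulr_gt0 ?ltr0n//.
by rewrite psi_gt0// cutoff_height_gt0.
Qed.

Lemma radial_upper_gt0 : 0 < radial_upper.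
Proof. by rewrite mulr_gt0 ?exprn_gt0. Qed.

Lemma radial_bound rho r t : 0 < rho -> rho <= r / 2 -> 0 <= t ->
  radial_lower / rho ^+ m * (t <= rho ^+ 2)%R%:R -
  radial_upper / r ^+ m * (t <= r ^+ 2)%R%:R <=
  m%:R * radial rho r t + 2 * t * dradial rho r t.
Proof.
move=> rho0 rhor t0; rewrite radialE//.
have r0 : 0 < r by have := lt_le_trans rho0 rhor; rewrite pmulr_lgt0.
have r20 : 0 < r ^+ 2 by rewrite exprn_gt0.
have s0 : 0 < t + rho ^+ 2 by rewrite ltr_wpDl// exprn_gt0.
apply: lerB.
  have [trho|_] := leP t (rho ^+ 2); last first.
    by rewrite mulr0 mulr_ge0 ?cutoff_ge0// mulr_ge0 ?kappa_ge0// mulr_ge0 ?sqr_ge0.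
  (* Here [rho <= r / 2] places the small ball in the plateau of the cutoff. *)
  have tr : t / r ^+ 2 <= 1 / 4.
    rewrite ler_pdivrMr//; apply: le_trans trho _.
    have : rho ^+ 2 <= (r / 2) ^+ 2 by rewrite ler_sqr ?nnegrE//; [exact: ltW|rewrite divr_ge0// ltW].
    by rewrite expr_div_n -natrX mul1r mulrC.
  rewrite mulr1 cutoff_near// /radial_lower.
  have -> : m%:R * psi 0 cutoff_height / 2 ^+ m.+2 / rho ^+ m =
      m%:R * rho ^+ 2 * (2 * rho) ^- m.+2 * psi 0 cutoff_height :> R.
    have rho1 : rho != 0 by rewrite gt_eqF.
    rewrite exprMn !(exprS _ m.+1) !(exprS _ m) expr2; field.
    by rewrite rho1 !expf_neq0 ?pnatr_eq0.
  rewrite ler_wpM2r ?psi_ge0//; apply: ler_wpM2l.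
    by apply: mulr_ge0; rewrite ?sqr_ge0.
  rewrite -kappa_sqr ?mulr_gt0//; apply: kappa_le => //.
  rewrite exprMn; have := sqr_ge0 rho; lra.
have [tr|tr] := leP t (r ^+ 2); last first.
  by rewrite mulr0 dcutoff_eq0 ?mul0r ?mulr0// ler_pdivlMr// mul1r ltW.
(* The derivative of the cutoff vanishes for |x| <= r/2, so the singularity of the kernel is not
   seen. *)
have [t4|t4] := leP (t / r ^+ 2) (1 / 4).
  by rewrite dcutoff_near// mul0r mulr0 mulr1 divr_ge0 ?exprn_ge0 ?ltW// radial_upper_gt0.
have t4' : (r / 2) ^+ 2 <= t.
  by rewrite expr_div_n -natrX; move: t4; rewrite ltr_pdivlMr// => /ltW; rewrite mul1r mulrC.
have k1 : kappa m (t + rho ^+ 2) <= 2 ^+ m / r ^+ m.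
  rewrite -expr_div_n -invf_div exprVn -kappa_sqr ?divr_gt0//.
  by apply: kappa_le; rewrite ?exprn_gt0 ?divr_gt0// (le_trans t4')// lerDl sqr_ge0.
rewrite mulr1 /radial_upper.
have d36 := dcutoff_le (t / r ^+ 2).
apply: (@le_trans _ _ (2 * r ^+ 2 * (2 ^+ m / r ^+ m) * (36 / r ^+ 2))).
  have p0 : 0 <= 2 * t by rewrite mulr_ge0.
  apply: ler_pM.
  - by rewrite mulr_ge0 ?kappa_ge0.
  - by rewrite divr_ge0 ?dcutoff_ge0 ?ltW.
  - by apply: ler_pM => //; [rewrite kappa_ge0|rewrite ler_wpM2l].
  - by rewrite ler_wpM2r// invr_ge0 ltW.
rewrite le_eqVlt; apply/orP; left; apply/eqP; field.
by rewrite expf_neq0 ?gt_eqF.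
Qed.

(** The antiderivative is normalised at [r ^+ 2]: as [radial] vanishes beyond that point and is
    nonnegative, so does [N] vanish beyond it, and [N] is nonpositive before it. *)
Lemma radial_antiderivative rho r : 0 < rho -> 0 < r ->
  exists N : R -> R, [/\ forall t, 0 <= t -> is_derive t 1 N (radial rho r t),
    forall t, 0 <= t -> N t <= 0 & forall t, r ^+ 2 <= t -> N t = 0].
Proof.
move=> rho0 r0.
(* Clamping the argument of [kappa] at [rho ^+ 2] changes nothing for [t >= 0] and yields a function
   continuous on the whole line. *)
pose f t : R := kappa m (Num.max (t + rho ^+ 2) (rho ^+ 2)) * cutoff (t / r ^+ 2).
have rho20 : 0 < rho ^+ 2 by rewrite exprn_gt0.
have r20 : 0 < r ^+ 2 by rewrite exprn_gt0.
have cf : continuous f.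
  apply: continuous_mulR => t.
    apply: (@continuous_comp _ _ _ (fun t => Num.max (t + rho ^+ 2) (rho ^+ 2)) (kappa m)).
      apply: continuous_max; last exact: cst_continuous.
      by apply: (@continuousD _ _ _ id (cst _)); [exact: cvg_id|exact: cst_continuous].
    by apply: kappa_continuous; rewrite lt_max rho20 orbT.
  apply: (@continuous_comp _ _ _ (fun t => t / r ^+ 2) cutoff).
    by apply: (@continuousM _ _ id (cst _)); [exact: cvg_id|exact: cst_continuous].
  by apply/differentiable_continuous/derivable1_diffP; case: (is_derive_cutoff (t / r ^+ 2)).
have [F dF] := continuous_antiderivative cf.
have fE t : 0 <= t -> f t = radial rho r t.
  by move=> t0; rewrite /f max_l// lerDr.
have dF' t : 0 <= t -> is_derive t 1 F (radial rho r t).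
  move=> t0; rewrite -fE//; apply: dF; exact: lt_le_trans t0.
have mvt s t : 0 <= s -> s <= t ->
    exists2 c, s <= c & F t - F s = radial rho r c * (t - s).
  move=> s0 st; have [| |c] := @MVT_segment R F (radial rho r) s t st.
  - move=> x; rewrite in_itv/= => /andP[sx _]; apply: dF'; exact: le_trans s0 (ltW sx).
  - apply: derivable_within_continuous => x; rewrite in_itv/= => /andP[sx _].
    by have [] := dF' x (le_trans s0 sx).
  by rewrite in_itv/= => /andP[sc _] e; exists c.
have Fconst t : r ^+ 2 <= t -> F t = F (r ^+ 2).
  move=> rt; apply/eqP; rewrite -subr_eq0.
  have [c rc ->] := mvt _ _ (ltW r20) rt.
  by rewrite radial_eq0// mul0r.
exists (fun t => F t - F (r ^+ 2)); split => [t t0|t t0|t rt].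
- by apply: is_derive_eq (is_deriveB (dF' t t0) (is_derive_cst _ _ _)) _; rewrite subr0.
- have [/Fconst ->|/ltW tr] := leP (r ^+ 2) t; first by rewrite subrr.
  rewrite -oppr_ge0 opprB; have [c tc ->] := mvt _ _ t0 tr.
  by rewrite mulr_ge0 ?radial_ge0// subr_ge0.
- by rewrite Fconst// subrr.
Qed.

End Kernel.

(** * Sub-mean-value inequality *)

Section QuadraticFunctions.
Context {R : realType} {n : nat}.
Implicit Types (x y a v : 'rV[R]_n) (Q : 'M[R]_n).

Definition sqdist a x : R := dotp (x - a) (x - a).

(** Used with [b = 1], [Q = 0] for the constants and with [b = 0] and [Q] the normal projection for
    the squared height, so that one inequality covers both. *)
Definition qform (b : R) Q x : R := b + dotp (x *m Q) x.

Lemma is_derive_mulmx_entry (M : 'M[R]_n) x v j :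
  is_derive x v (fun y => (y *m M) 0 j) ((v *m M) 0 j).
Proof.
have -> : (fun y => (y *m M) 0 j) = (fun y => \sum_k y 0 k * M k j).
  by apply/funext => y; rewrite mxE.
rewrite mxE; apply: is_derive_sumR => k.
apply: is_derive_eq (is_deriveM (is_derive_coord k x v) (is_derive_cst _ _ _)) _.
by rewrite scaler0 add0r [LHS]mulrC.
Qed.

Lemma smooth_mulmx_entry (M : 'M[R]_n) j : smooth (fun y : 'rV[R]_n => (y *m M) 0 j).
Proof.
have -> : (fun y => (y *m M) 0 j) = (fun y => \sum_k y 0 k * M k j).
  by apply/funext => y; rewrite mxE.
by apply: smooth_sum => k; apply: smoothM; [exact: smooth_coord|exact: smooth_cst].
Qed.

Lemma is_derive_qform b Q x v : Q^T = Q ->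
  is_derive x v (qform b Q) (2 * dotp v (x *m Q)).
Proof.
move=> QT.
have h : is_derive x v (fun y => \sum_j (y *m Q) 0 j * y 0 j)
    (\sum_j ((x *m Q) 0 j * v 0 j + x 0 j * (v *m Q) 0 j)).
  apply: is_derive_sumR => j.
  exact: (is_deriveM (is_derive_mulmx_entry Q x v j) (is_derive_coord j x v)).
apply: is_derive_eq (is_deriveD (is_derive_cst b x v) h) _.
rewrite add0r big_split/= -[X in X + _]/(dotp (x *m Q) v).
rewrite -[X in _ + X]/(dotp x (v *m Q)).
have -> : dotp x (v *m Q) = dotp v (x *m Q) by rewrite dotpC dotp_mulmx QT.
by rewrite dotpC; ring.
Qed.

Lemma smooth_qform b Q : smooth (qform b Q).
Proof.
apply: smoothD; first exact: smooth_cst.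
apply: smooth_sum => j; apply: smoothM; last exact: smooth_coord.
exact: smooth_mulmx_entry.
Qed.

Lemma smooth_coordB a j : smooth (fun y : 'rV[R]_n => (y - a) 0 j).
Proof.
have -> : (fun y : 'rV[R]_n => (y - a) 0 j) = (fun y => y 0 j + - a 0 j).
  by apply/funext => y; rewrite !mxE.
by apply: smoothD; [exact: smooth_coord|exact: smooth_cst].
Qed.

Lemma is_derive_sqdist a x v : is_derive x v (sqdist a) (2 * dotp v (x - a)).
Proof.
have dB j : is_derive x v (fun y : 'rV[R]_n => (y - a) 0 j) (v 0 j).
  have -> : (fun y : 'rV[R]_n => (y - a) 0 j) = (fun y => y 0 j + - a 0 j).
    by apply/funext => y; rewrite !mxE.
  by apply: is_derive_eq (is_deriveD (is_derive_coord j x v) (is_derive_cst _ _ _)) (addr0 _).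
have h : is_derive x v (fun y => \sum_j (y - a) 0 j * (y - a) 0 j)
    (\sum_j ((x - a) 0 j * v 0 j + (x - a) 0 j * v 0 j)).
  by apply: is_derive_sumR => j; exact: (is_deriveM (dB j) (dB j)).
apply: is_derive_eq h _.
by rewrite big_split/= -/(dotp (x - a) v) dotpC; ring.
Qed.

Lemma smooth_sqdist a : smooth (sqdist a).
Proof.
by apply: smooth_sum => j; apply: smoothM; exact: smooth_coordB.
Qed.

Lemma sqdist_ge0 a x : 0 <= sqdist a x.
Proof. exact: dotp_ge0. Qed.

Lemma eballE a (r : R) x : 0 <= r -> eball a r x <-> sqdist a x <= r ^+ 2.
Proof. by move=> r0; rewrite /eball/= enorm_le_sqr. Qed.

Lemma sqdist_far a (r : R) x : 0 <= r -> r + enorm a < enorm x -> r ^+ 2 <= sqdist a x.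
Proof.
move=> r0 rx; rewrite /sqdist -sqr_enorm ler_sqr ?nnegrE ?enorm_ge0//.
have := enormD (x - a) a; rewrite subrK; lra.
Qed.

Lemma qform_ge0 b Q x : 0 <= b -> Q^T = Q -> Q *m Q = Q -> 0 <= qform b Q x.
Proof.
move=> b0 QT QQ; rewrite addr_ge0//.
by rewrite -QQ mulmxA dotp_mulmx QT dotp_ge0.
Qed.

Lemma smooth_sqdist_comp (F dF : R -> R) a :
  (forall t : R, 0 <= t -> is_derive t 1 F (dF t)) ->
  smooth (dF \o sqdist a) -> smooth (F \o sqdist a).
Proof.
move=> dFF sdF; apply: smooth_comp_prim sdF; last exact: smooth_sqdist.
by move=> x; apply: dFF; exact: sqdist_ge0.
Qed.

Lemma is_derive_sqdist_comp (F dF : R -> R) a x v :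
  (forall t : R, 0 <= t -> is_derive t 1 F (dF t)) ->
  is_derive x v (F \o sqdist a) (dF (sqdist a x) * (2 * dotp v (x - a))).
Proof.
move=> dFF; rewrite -(@derive_val _ _ _ _ _ _ _ (is_derive_sqdist a x v)).
apply: is_derive_comp_real; first by apply: dFF; exact: sqdist_ge0.
exact/smooth_differentiable/smooth_sqdist.
Qed.

End QuadraticFunctions.

Section Identities.
Context {R : realType} {m n : nat} {mn : (m <= n)%N}.
Notation Z := (varifold_space R mn).
Implicit Types (V : {measure set (borel Z) -> \bar R}) (z : Z)
  (Q : 'M[R]_n) (a : 'rV[R]_n).

(** Density of the first variation along
    [(b + x Q x^T) K(|x - a|^2) (x - a) - N(|x - a|^2) x Q] where [N' = K]:
    the two cross terms cancel. *)
Lemma green_density (K dK N : R -> R) b Q a z : Q^T = Q ->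
  (forall t : R, 0 <= t -> is_derive t 1 K (dK t)) ->
  (forall t : R, 0 <= t -> is_derive t 1 N (K t)) ->
  let y := z.1 - a in let P := grass_projmx z.2 in
  smooth (K \o sqdist a) ->
  variation_density (fun x => qform b Q x * K (sqdist a x)) 1%:M (- a) z +
  variation_density (fun x => - N (sqdist a x)) Q 0 z =
  qform b Q z.1 * (m%:R * K (dotp y y) + 2 * dK (dotp y y) * dotp (y *m P) y)
  - N (dotp y y) * \tr (Q *m P).
Proof.
move=> QT dKK dNN y P sK.
rewrite /variation_density mulmx1 mul1mx addr0 -/P -/y grass_tr.
set x := z.1.
have d1 := is_deriveM (is_derive_qform b x (y *m P) QT) (is_derive_sqdist_comp a x (y *m P) dKK).
have d2 := is_deriveN (is_derive_sqdist_comp a x (x *m Q *m P) dNN).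
rewrite (@derive_val _ _ _ _ _ _ _ d1) (@derive_val _ _ _ _ _ _ _ d2).
rewrite /GRing.scale/= -/y -[sqdist a x]/(dotp y y).
have -> : dotp (x *m Q *m P) y = dotp (y *m P) (x *m Q).
  by rewrite dotp_mulmx grass_sym dotpC.
ring.
Qed.

Lemma variation_density_integrable V phi (M : 'M[R]_n) c : varifold V -> smooth phi ->
  bounded_support phi -> V.-integrable setT (EFin \o variation_density phi M c).
Proof.
move=> vV sphi [r pr]; apply: (@integrable_bounded_support _ _ _ _ _ _ r) => //.
  exact: continuous_variation_density.
by move=> z; exact: variation_density_support.
Qed.

Lemma measurable_base (f : 'rV[R]_n -> R) : continuous f ->
  measurable_fun setT (fun z : borel Z => f z.1).
Proof.
move=> cf; apply: continuous_borel => z.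
apply: (@continuous_comp _ _ _ (fun z : Z => z.1) f); last exact: cf.
exact: continuous_fst_Z.
Qed.

Lemma measurable_cylinder_open (A : set 'rV[R]_n) : open A ->
  measurable ([set z | A z.1] : set (borel Z)).
Proof.
move=> oA; apply: open_borel; apply: (open_comp (f := fun z : Z => z.1)) => //.
by move=> z _; exact: continuous_fst_Z.
Qed.

Lemma measurable_cylinder_closed (A : set 'rV[R]_n) : closed A ->
  measurable ([set z | A z.1] : set (borel Z)).
Proof.
move=> cA; apply: closed_borel; apply: (preimage_closed (f := fun z : Z => z.1)) => //.
by move=> z _; exact: continuous_fst_Z.
Qed.

Lemma measurable_indic_cylinder (A : set 'rV[R]_n) :
  measurable ([set z | A z.1] : set (borel Z)) ->
  measurable_fun setT (fun z : borel Z => \1_A z.1 : R).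
Proof.
move=> mA; rewrite (_ : (fun z => _) = \1_[set z : borel Z | A z.1]).
  exact: measurable_indic.
by apply/funext => z; rewrite !indicE; congr (_%:R); congr nat_of_bool; apply/idP/idP; rewrite !inE.
Qed.

Lemma measurable_eball_cylinder a r : measurable ([set z | eball a r z.1] : set (borel Z)).
Proof. by apply: measurable_cylinder_closed; exact: closed_eball. Qed.

Lemma indic_eball a r x : 0 <= r -> \1_(eball a r) x = (sqdist a x <= r ^+ 2)%R%:R :> R.
Proof.
move=> r0; rewrite indicE; congr (_%:R); congr nat_of_bool.
by apply/idP/idP; rewrite inE => /(eballE _ _ r0).
Qed.

(** In [green_density], [dotp (y *m P) y] may be replaced by the larger [dotp y y] because
    [dradial <= 0 <= qform], and the term with [N] has a sign because [N <= 0] and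
    [\tr (Q *m P) >= 0]. What is left is bounded below by [radial_bound], while the total integral
    is 0. *)
Lemma mean_value_inequality : (0 < m)%N -> forall V, varifold V -> stationary V ->
  forall b Q a rho r, Q^T = Q -> Q *m Q = Q -> 0 <= b -> 0 < rho -> rho <= r / 2 ->
  (\int[V]_z (radial_lower m / rho ^+ m * (\1_(eball a rho) z.1 * qform b Q z.1))%:E <=
   \int[V]_z (radial_upper m / r ^+ m * (\1_(eball a r) z.1 * qform b Q z.1))%:E)%E.
Proof.
move=> m0 V vV sV b Q a rho r QT QQ b0 rho0 rhor.
have r0 : 0 < r by have := lt_le_trans rho0 rhor; rewrite pmulr_lgt0.
have [N [dN N0 Nr]] := radial_antiderivative m rho0 r0.
have rho20 : 0 < rho ^+ 2 by rewrite exprn_gt0.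
have dK (t : R) : 0 <= t -> is_derive t 1 (radial m rho r) (dradial m rho r t).
  by move=> t0; apply: is_derive_radial; rewrite ltr_wpDl.
have sK : smooth (radial m rho r \o sqdist a).
  apply: smoothM.
    apply: (@smooth_kappa _ _ (fun x => sqdist a x + rho ^+ 2)).
      by move=> x; rewrite ltr_wpDl// sqdist_ge0.
    by apply: smoothD; [exact: smooth_sqdist|exact: smooth_cst].
  have s1 : smooth (fun x : 'rV[R]_n => sqdist a x / r ^+ 2 + - (1 / 4)).
    apply: smoothD; last exact: smooth_cst.
    by apply: smoothM; [exact: smooth_sqdist|exact: smooth_cst].
  have s2 := smoothM (@smooth_cst R 'rV[R]_n R (-1 : R)) (smooth_psi 0 s1).
  have := smooth_psi 0 (smoothD (@smooth_cst R 'rV[R]_n R cutoff_height) s2).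
  by congr smooth; apply/funext => x; rewrite /cutoff/= mulN1r.
have sh := smooth_qform b Q.
pose phi1 x := qform b Q x * radial m rho r (sqdist a x).
pose phi2 x := - N (sqdist a x).
have s1 : smooth phi1 by exact: smoothM.
have s2 : smooth phi2.
  have := smoothM (@smooth_cst R 'rV[R]_n R (-1 : R)) (smooth_sqdist_comp dN sK).
  by congr smooth; apply/funext => x; rewrite /phi2 /= mulN1r.
have b1 : bounded_support phi1.
  by exists (r + enorm a) => x rx; rewrite /phi1 radial_eq0 ?mulr0// sqdist_far// ltW.
have b2 : bounded_support phi2.
  by exists (r + enorm a) => x rx; rewrite /phi2 Nr ?oppr0// sqdist_far// ltW.
pose I z := variation_density phi1 1%:M (- a) z + variation_density phi2 Q 0 z.
have i1 := variation_density_integrable 1%:M (- a) vV s1 b1.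
have i2 := variation_density_integrable Q 0 vV s2 b2.
have mh := measurable_base (smooth_continuous sh).
have m1 s := measurable_indic_cylinder (measurable_eball_cylinder a s).
have r00 := ltW r0; have rho00 := ltW rho0.
apply: (@le_integral_balance _ _ _ V set0 _ _ I) => //.
- by apply: measurable_funM => //; apply: measurable_funM.
- by apply: measurable_funM => //; apply: measurable_funM.
- move=> z; apply: mulr_ge0; last by rewrite mulr_ge0 ?qform_ge0.
  by rewrite divr_ge0 ?exprn_ge0// ltW// radial_lower_gt0.
- move=> z; apply: mulr_ge0; last by rewrite mulr_ge0 ?qform_ge0.
  by rewrite divr_ge0 ?exprn_ge0// ltW// radial_upper_gt0.
- rewrite (_ : EFin \o I = (EFin \o variation_density phi1 1%:M (- a)) \+ (EFin \o variation_density phi2 Q 0))%E//.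
  exact: integrableD.
- under eq_integral do rewrite EFinD.
  by rewrite integralD//= !first_variation_affine// adde0.
move=> z _; rewrite /I green_density// !indic_eball//.
set y := z.1 - a; set P := grass_projmx z.2.
have PP : P *m P = P by exact: grass_idem.
have PT : P^T = P by exact: grass_sym.
have p1 : dotp (y *m P) y <= dotp y y.
  by have := enorm_proj_le y PP PT; rewrite [in X in X -> _]dotp_mulmx PT -mulmxA PP dotpC.
have h0 : 0 <= qform b Q z.1 by exact: qform_ge0.
have tr0 : 0 <= \tr (Q *m P) by exact: tr_projM_ge0.
have y0 := dotp_ge0 y.
have Ny := N0 _ y0.
have dK0 := dradial_le0 m rho r (dotp y y).
have := ler_wpM2l h0 (radial_bound m rho0 rhor y0).
rewrite -[sqdist a z.1]/(dotp y y).
set A := _ / rho ^+ m; set B := _ / r ^+ m.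
move=> le1.
have le2 : qform b Q z.1 * (dradial m rho r (dotp y y) * dotp y y) <=
    qform b Q z.1 * (dradial m rho r (dotp y y) * dotp (y *m P) y).
  by rewrite ler_wpM2l// ler_wnM2l.
have le3 : N (dotp y y) * \tr (Q *m P) <= 0 by rewrite mulr_le0_ge0.
move: le1 le2 le3; nra.
Qed.

End Identities.

(** * Tilt and holes *)

Section TiltAndHoles.
Context {R : realType} {m n : nat} {mn : (m <= n)%N}.
Notation Z := (varifold_space R mn).
Implicit Types (V : {measure set (borel Z) -> \bar R}) (z : Z)
  (Q : 'M[R]_n) (a : 'rV[R]_n).

Lemma measurable_tr Q : measurable_fun setT (fun z : borel Z => \tr (Q *m grass_projmx z.2)).
Proof.
apply: continuous_borel; apply: continuous_sumR => i; under eq_fun do rewrite mxE.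
apply: continuous_sumR => j; apply: continuous_mulR; first exact: cst_continuous.
exact: continuous_proj_entry.
Qed.

Lemma continuous_enorm_mul Q : continuous (fun x : 'rV[R]_n => enorm (x *m Q)).
Proof.
rewrite /enorm => x.
apply: (@continuous_comp _ _ _ (fun x : 'rV[R]_n => dotp (x *m Q) (x *m Q)) Num.sqrt).
  by apply: continuous_sumR => j; apply: continuous_mulR;
    apply: smooth_continuous; exact: smooth_mulmx_entry.
exact: sqrt_continuous.
Qed.

Lemma smooth_psi_sqdist k (c e : R) a : smooth (psi k \o (fun x => c - sqdist a x / e)).
Proof.
apply: smooth_psi.
have s1 := smoothM (smooth_sqdist a) (@smooth_cst R 'rV[R]_n R (- e^-1)).
have := smoothD (@smooth_cst R 'rV[R]_n R c) s1.
by congr smooth; apply/funext => x; rewrite /= mulrN.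
Qed.

Lemma is_derive_psi0_affine (c e t : R) :
  is_derive t 1 (fun s => psi 0 (c - s / e)) (- (psi 2 (c - t / e) / e)).
Proof.
have h : is_derive t 1 (fun s => c - s / e) (- e^-1).
  have := is_derive_affine (- e^-1) c t.
  by congr is_derive; apply/funext => s; rewrite mulrN addrC.
by apply: is_derive_eq (is_derive1_comp (is_derive_psi0 _) h) _; rewrite mulrN.
Qed.

(** The field [phi x *: (x *m Q)] has density [phi * \tr (Q *m P)] plus a gradient term linear in
    [enorm (x *m Q)]. On the ball of radius r, [phi] is at least [psi 0 1]. The 48 collects
    [psi 2 <= 12], the factor 2 in the derivative of the squared distance, |x - a| <= 2 r, and the
    division by r^2. *)
Lemma tilt_estimate V Q a (r : R) : varifold V -> stationary V ->
  Q^T = Q -> Q *m Q = Q -> 0 < r ->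
  (\int[V]_z (psi 0 1 * (\1_(eball a r) z.1 * \tr (Q *m grass_projmx z.2)))%:E <=
   \int[V]_z (48 / r * (\1_(eball a (2 * r)) z.1 * enorm (z.1 *m Q)))%:E)%E.
Proof.
move=> vV sV QT QQ r0.
have r20 : 0 < r ^+ 2 by rewrite exprn_gt0.
pose phi : 'rV[R]_n -> R := psi 0 \o (fun x => 2 - sqdist a x / r ^+ 2).
have sphi : smooth phi by exact: smooth_psi_sqdist.
have p2r (x : 'rV[R]_n) : 2 * r ^+ 2 <= sqdist a x -> 2 - sqdist a x / r ^+ 2 <= 0.
  by move=> h; rewrite subr_le0 ler_pdivlMr.
have bphi : bounded_support phi.
  exists (2 * r + enorm a) => x rx; rewrite /phi/= psi_le0// p2r//.
  have r2 : 0 <= 2 * r by rewrite mulr_ge0// ltW.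
  apply: le_trans (sqdist_far r2 rx); rewrite exprMn; lra.
have m1 s := measurable_indic_cylinder (@measurable_eball_cylinder R m n mn a s).
have tr0 z : 0 <= \tr (Q *m grass_projmx z.2).
  by apply: tr_projM_ge0 => //; [exact: grass_idem|exact: grass_sym].
have i1 := variation_density_integrable Q 0 vV sphi bphi.
apply: (@le_integral_balance _ _ _ V set0 _ _ (variation_density phi Q 0)) => //.
- by apply: measurable_funM => //; apply: measurable_funM => //; exact: measurable_tr.
- apply: measurable_funM => //; apply: measurable_funM => //.
  exact: (measurable_base (f := fun x => enorm (x *m Q)) (@continuous_enorm_mul Q)).
- by move=> z; rewrite mulr_ge0 ?psi_ge0// mulr_ge0.
- move=> z; apply: mulr_ge0; first by rewrite divr_ge0// ltW.
  by rewrite mulr_ge0// enorm_ge0.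
- exact: first_variation_affine.
move=> z _; rewrite /variation_density addr0.
set x := z.1; set P := grass_projmx z.2.
have d1 := is_derive_sqdist_comp a x (x *m Q *m P) (fun t _ => is_derive_psi0_affine 2 (r ^+ 2) t).
have r00 := ltW r0; have r2 : 0 <= 2 * r by rewrite mulr_ge0.
rewrite (@derive_val _ _ _ _ _ _ _ d1) !indic_eball//.
rewrite -[phi x]/(psi 0 (2 - sqdist a x / r ^+ 2)).
set u := sqdist a x; set t0 := \tr (Q *m P).
have u0 : 0 <= u by exact: sqdist_ge0.
have step1 : psi 0 1 * ((u <= r ^+ 2)%R%:R * t0) <= psi 0 (2 - u / r ^+ 2) * t0.
  have [ur|_] := leP u (r ^+ 2); last by rewrite mul0r mulr0 mulr_ge0 ?psi_ge0 ?tr0.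
  rewrite mul1r ler_wpM2r ?tr0// psi_ndecr//.
  by rewrite lerBrDr -lerBrDl ler_pdivrMr//; lra.
have step2 : psi 2 (2 - u / r ^+ 2) / r ^+ 2 * (2 * dotp (x *m Q *m P) (x - a)) <=
    48 / r * ((u <= (2 * r) ^+ 2)%R%:R * enorm (x *m Q)).
  have [ur|ur] := leP u ((2 * r) ^+ 2); last first.
    rewrite psi_le0 ?mul0r ?mulr0// p2r// -/u.
    by apply: le_trans (ltW ur); rewrite exprMn; lra.
  have psi12 : psi 2 (2 - u / r ^+ 2) <= 12.
    have [h|h] := leP (2 - u / r ^+ 2) 0; first by rewrite psi_le0.
    apply: le_trans (psi_bound _ _) _; rewrite gtr0_norm//.
    have -> : (3`!%:R = 6 :> R) by [].
    have h2 : 0 <= u / r ^+ 2 by rewrite divr_ge0// ltW.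
    lra.
  have dle : dotp (x *m Q *m P) (x - a) <= enorm (x *m Q) * (2 * r).
    apply: le_trans (ler_norm _) _; apply: le_trans (dotp_le _ _) _.
    apply: ler_pM; rewrite ?enorm_ge0//.
      by rewrite enorm_le_sqr ?enorm_ge0// sqr_enorm enorm_proj_le ?grass_idem ?grass_sym.
    by rewrite enorm_le_sqr.
  rewrite mul1r.
  have -> : 48 / r * enorm (x *m Q) = 12 / r ^+ 2 * (2 * (enorm (x *m Q) * (2 * r))).
    by field; rewrite gt_eqF.
  have h1 : psi 2 (2 - u / r ^+ 2) / r ^+ 2 <= 12 / r ^+ 2 by rewrite ler_wpM2r// invr_ge0 ltW.
  apply: (@le_trans _ _ (psi 2 (2 - u / r ^+ 2) / r ^+ 2 * (2 * (enorm (x *m Q) * (2 * r))))).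
    apply: ler_wpM2l; first by rewrite divr_ge0 ?psi_ge0// ltW.
    by rewrite ler_wpM2l.
  apply: ler_wpM2r => //; rewrite mulr_ge0// mulr_ge0 ?enorm_ge0//.
move: step1 step2; rewrite mulNr; lra.
Qed.

Lemma radial_density (K dK : R -> R) a z :
  (forall t : R, 0 <= t -> is_derive t 1 K (dK t)) ->
  let y := z.1 - a in let P := grass_projmx z.2 in
  variation_density (K \o sqdist a) 1%:M (- a) z =
  m%:R * K (dotp y y) + 2 * dK (dotp y y) * dotp (y *m P) y.
Proof.
move=> dKK y P; rewrite /variation_density mulmx1 mul1mx -/P -/y grass_tr.
have d1 := is_derive_sqdist_comp a z.1 (y *m P) dKK.
rewrite (@derive_val _ _ _ _ _ _ _ d1) /= -/y -[sqdist a z.1]/(dotp y y).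
ring.
Qed.

End TiltAndHoles.

(** * The consequence of a ball without weight centred on the plane *)

Section Holes.
Context {R : realType} {m n : nat} {mn : (m <= n)%N}.
Notation Z := (varifold_space R mn).
Implicit Types (V : {measure set (borel Z) -> \bar R}) (z : Z) (S : grass R mn).

Definition normal_mx S : 'M[R]_n := 1%:M - grass_projmx S.

Lemma normal_mx_sym S : (normal_mx S)^T = normal_mx S.
Proof. exact: projmx_compl_sym. Qed.

Lemma normal_mx_idem S : normal_mx S *m normal_mx S = normal_mx S.
Proof. exact: projmx_compl_idem. Qed.

Lemma normal_mx_eq0 S x : (x *m normal_mx S == 0) = (x \in grass_vspace S).
Proof. exact: projmx_compl_eq0. Qed.

(** Half the squared Hilbert-Schmidt distance between the projections onto [S] and [z.2]. In this
    form it is linear in the second projection, hence the divergence of the normal field. *)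
Definition tilt S z : R := \tr (normal_mx S *m grass_projmx z.2).

Lemma tilt_ge0 S z : 0 <= tilt S z.
Proof.
apply: tr_projM_ge0; [exact: grass_idem|exact: grass_sym|exact: normal_mx_idem|exact: normal_mx_sym].
Qed.

(** Split y = x - s into its parts in [S] and normal to [S], and project both onto the normal space
    of the tangent plane. The first part is governed by [tilt_bound], the second shrinks; it is the
    normal part of x since s lies in [S]. The factors 2 come from |A + B|^2 <= 2|A|^2 + 2|B|^2. *)
Lemma normal_component_bound S z (s : 'rV[R]_n) : s \in grass_vspace S ->
  dotp (z.1 - s) (z.1 - s) - dotp ((z.1 - s) *m grass_projmx z.2) (z.1 - s) <=
  2 * dotp (z.1 - s) (z.1 - s) * tilt S z + 2 * dotp (z.1 *m normal_mx S) (z.1 *m normal_mx S).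
Proof.
move=> sS; set y := z.1 - s; set P := grass_projmx z.2.
have PP : P *m P = P by exact: grass_idem.
have PT : P^T = P by exact: grass_sym.
have yQ : y *m normal_mx S = z.1 *m normal_mx S.
  by rewrite mulmxBl; move: sS; rewrite -normal_mx_eq0 => /eqP ->; rewrite subr0.
clearbody y.
have QQ : (1%:M - P) *m (1%:M - P) = 1%:M - P.
  by rewrite mulmxBr mulmx1 mulmxBl mul1mx PP subrr subr0.
have QT : (1%:M - P)^T = 1%:M - P by rewrite [LHS]linearB/= trmx1 PT.
have -> : dotp y y - dotp (y *m P) y = dotp (y *m (1%:M - P)) (y *m (1%:M - P)).
  by rewrite [RHS]dotp_mulmx QT -mulmxA QQ mulmxBr mulmx1 dotpBr (dotpC (y *m P)).
have tb := tilt_bound y PP PT (grass_idem S) (grass_sym S).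
have {}tb := tb (etrans (grass_tr _) (esym (grass_tr _))).
have -> : y *m (1%:M - P) = y *m grass_projmx S *m (1%:M - P) + z.1 *m normal_mx S *m (1%:M - P).
  rewrite -mulmxDl -yQ -mulmxDr.
  have -> : grass_projmx S + normal_mx S = 1%:M by rewrite /normal_mx addrC subrK.
  by rewrite mulmx1.
have h2 := enorm_proj_le (z.1 *m normal_mx S) QQ QT.
set A := y *m _ *m _ in tb *; set B := z.1 *m _ *m _ in h2 *; clearbody A B.
have h3 := dotp_ge0 (A - B).
move: tb; rewrite -/(normal_mx S) -/(tilt S z) => tb.
move: h3; rewrite dotpBl !dotpBr dotpDl !dotpDr (dotpC B A); lra.
Qed.

(** The field is (x - s)/|x - s|^m, regularised at scale [e] and truncated at [r]. The hole is the
    null set of [le_integral_balance], so |x - s| >= rho may be assumed and negative powers of the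
    distance are at most those of [rho]. The truncation term is moved to the left side; the
    regularisation and the normal component of x - s form the right side. *)
Lemma hole_estimate V S (s : 'rV[R]_n) (r rho e : R) : (2 <= m)%N ->
  varifold V -> stationary V -> s \in grass_vspace S ->
  0 < e -> e <= rho -> rho <= r ->
  V [set z | enorm (z.1 - s) < rho] = 0%E ->
  (\int[V]_z (cutoff_height / r ^+ m * \1_(eball s (r / 2)) z.1)%:E <=
   \int[V]_z (\1_(eball s r) z.1 * (m%:R * e ^+ 2 / rho ^+ m.+2 +
     (2 * m%:R + 24) / rho ^+ m.+2 *
     (r ^+ 2 * tilt S z + dotp (z.1 *m normal_mx S) (z.1 *m normal_mx S))))%:E)%E.
Proof.
move=> m2 vV sV sS e0 erho rhor hole.
have rho0 := lt_le_trans e0 erho; have r0 := lt_le_trans rho0 rhor.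
have e00 := ltW e0; have rho00 := ltW rho0; have r00 := ltW r0.
have r20 : 0 < r ^+ 2 by rewrite exprn_gt0.
have rho20 : 0 < rho ^+ 2 by rewrite exprn_gt0.
have e20 : 0 < e ^+ 2 by rewrite exprn_gt0.
have rhoi : 0 < rho ^- m.+2 by rewrite invr_gt0 exprn_gt0.
(* This truncation has no plateau, since its derivative is to be bounded below on the ball of radius
   r/2. *)
pose K t : R := kappa m (t + e ^+ 2) * psi 0 (1 - t / r ^+ 2).
pose dK t : R := - (m%:R / 2) * kappa m.+2 (t + e ^+ 2) * psi 0 (1 - t / r ^+ 2) -
  kappa m (t + e ^+ 2) * (psi 2 (1 - t / r ^+ 2) / r ^+ 2).
have dKK (t : R) : 0 <= t -> is_derive t 1 K (dK t).
  move=> t0; have t1 : 0 < t + e ^+ 2 by rewrite ltr_wpDl.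
  have h : is_derive t 1 (fun s => s + e ^+ 2) 1.
    by apply: is_derive_eq (is_deriveD (is_derive_id t (1 : R)) (is_derive_cst _ t 1)) _; rewrite addr0.
  have d1 := @is_derive1_comp _ (kappa m) (fun s => s + e ^+ 2) t _ _ (is_derive_kappa m t1) h.
  apply: is_derive_eq (is_deriveM d1 (is_derive_psi0_affine 1 (r ^+ 2) t)) _.
  by rewrite /GRing.scale/= /dK /=; ring.
have sK : smooth (K \o sqdist s).
  apply: smoothM; last exact: smooth_psi_sqdist.
  apply: (@smooth_kappa _ _ (fun x => sqdist s x + e ^+ 2)).
    by move=> x; rewrite ltr_wpDl// sqdist_ge0.
  by apply: smoothD; [exact: smooth_sqdist|exact: smooth_cst].
have bK : bounded_support (K \o sqdist s).
  exists (r + enorm s) => x rx; rewrite /K /= psi_le0 ?mulr0//.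
  by rewrite subr_le0 ler_pdivlMr// mul1r sqdist_far// ltW.
have i1 := variation_density_integrable 1%:M (- s) vV sK bK.
have m1 t := measurable_indic_cylinder (@measurable_eball_cylinder R m n mn s t).
have ch0 : 0 < cutoff_height :> R by exact: cutoff_height_gt0.
have c0 : 0 <= 2 * m%:R + 24 :> R by rewrite addr_ge0// mulr_ge0.
apply: (@le_integral_balance _ _ _ V [set z | enorm (z.1 - s) < rho] _ _
    (fun z => - variation_density (K \o sqdist s) 1%:M (- s) z)) => //.
- have := @measurable_cylinder_open R m n mn _ (@open_eball R n s rho); exact.
- by apply: measurable_funM.
- apply: measurable_funM => //; apply: measurable_funD => //; apply: measurable_funM => //.
  apply: measurable_funD.
    by apply: measurable_funM => //; exact: measurable_tr.
  apply: (measurable_base (f := fun x => dotp (x *m normal_mx S) (x *m normal_mx S))).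
  by apply: continuous_sumR => j; apply: continuous_mulR;
    apply: smooth_continuous; exact: smooth_mulmx_entry.
- by move=> z; rewrite mulr_ge0// divr_ge0 ?exprn_ge0// ltW.
- move=> z; apply: mulr_ge0 => //; apply: addr_ge0.
    by rewrite !mulr_ge0// ltW.
  rewrite !mulr_ge0 ?addr_ge0 ?dotp_ge0 ?(ltW rhoi)//.
  by rewrite mulr_ge0 ?tilt_ge0// ltW.
- exact: (integrableN i1).
- under eq_integral do rewrite EFinN.
  by rewrite integralN ?first_variation_affine ?oppe0// integrable_add_def.
move=> z /negP; rewrite -leNgt => hz.
rewrite (radial_density _ _ dKK).
have r2 : 0 <= r / 2 by rewrite divr_ge0.
rewrite !indic_eball//.
have nb := normal_component_bound z sS.
rewrite -[sqdist s z.1]/(dotp (z.1 - s) (z.1 - s)).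
set y := z.1 - s in hz nb *; set P := grass_projmx z.2 in nb *.
have uz : rho ^+ 2 <= dotp y y by rewrite -sqr_enorm ler_sqr ?nnegrE ?enorm_ge0// ltW.
move: nb uz; set u := dotp y y; set p := dotp (y *m P) y; set q := dotp (z.1 *m _) _.
have q0 : 0 <= q by exact: dotp_ge0.
have ti0 := tilt_ge0 S z; move: ti0; set ti := tilt S z => ti0 nb uz.
have pu : 0 <= u - p.
  rewrite subr_ge0 /p dotp_mulmx /P grass_sym -[X in dotp _ (_ *m X)](grass_idem z.2).
  by rewrite mulmxA -[X in _ *m _ *m X](grass_sym z.2) -dotp_mulmx enorm_proj_le ?grass_idem ?grass_sym.
have u0 : 0 < u by exact: lt_le_trans uz.
have s0 : 0 < u + e ^+ 2 by rewrite addr_gt0.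
have erho2 : e ^+ 2 <= rho ^+ 2 by rewrite ler_sqr ?nnegrE.
have r4 : (r / 2) ^+ 2 = r ^+ 2 / 4 by field.
have [ur|ur] := ltP (r ^+ 2) u.
  have ps k : psi k (1 - u / r ^+ 2) = 0.
    by rewrite psi_le0// subr_le0 ler_pdivlMr// mul1r ltW.
  have -> : (u <= (r / 2) ^+ 2) = false.
    by apply/negbTE; rewrite -ltNge; apply: le_lt_trans ur; rewrite r4; lra.
  by rewrite /K /dK !ps !mulr0 !mul0r !mulr0 subrr mulr0 mul0r addr0 oppr0 addr0.
rewrite mul1r /K /dK.
have t0 : 0 <= u / r ^+ 2 by rewrite divr_ge0// ltW.
have t1 : u / r ^+ 2 <= 1 by rewrite ler_pdivrMr// mul1r.
set X := psi 0 (1 - u / r ^+ 2); set Y := psi 2 (1 - u / r ^+ 2).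
have X0 : 0 <= X by exact: psi_ge0.
have Y0 : 0 <= Y by exact: psi_ge0.
have X1 : X <= 1.
  by apply: le_trans (psi_bound _ _) _; rewrite mul1r ger0_norm; lra.
have Y6 : Y <= 6.
  apply: le_trans (psi_bound _ _) _; have -> : (3`!%:R = 6 :> R) by [].
  rewrite ger0_norm; lra.
have kS := kappaS2 m s0.
set k2 := kappa m.+2 (u + e ^+ 2) in kS *.
have k20 : 0 <= k2 by exact: kappa_ge0.
have k2le : k2 <= rho ^- m.+2.
  rewrite -(kappa_sqr _ rho0); apply: kappa_le => //.
  by apply: le_trans uz _; rewrite lerDl ltW.
have kmle : kappa m (u + e ^+ 2) <= rho ^- m.
  rewrite -(kappa_sqr _ rho0); apply: kappa_le => //.
  by apply: le_trans uz _; rewrite lerDl ltW.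
set km := kappa m (u + e ^+ 2) in kS kmle *.
have km0 : 0 <= km by exact: kappa_ge0.
have rhom : rho ^- m / r ^+ 2 <= rho ^- m.+2.
  have p1 : 0 < rho ^+ m.+2 by rewrite exprn_gt0.
  have p2 : 0 < rho ^+ m * r ^+ 2 by rewrite mulr_gt0 ?exprn_gt0.
  rewrite -invfM lef_pV2 ?posrE//.
  rewrite (exprD rho 2 m) [leRHS]mulrC; apply: ler_wpM2r; first by rewrite exprn_ge0.
  by rewrite ler_sqr ?nnegrE.
have low : cutoff_height / r ^+ m * (u <= (r / 2) ^+ 2)%R%:R <= 2 * u * km * (Y / r ^+ 2).
  have [ur2|_] := leP u ((r / 2) ^+ 2); last first.
    by rewrite mulr0; apply: mulr_ge0; [rewrite !mulr_ge0// ltW|rewrite divr_ge0// ltW].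
  rewrite mulr1.
  (* For u <= (r/2)^2 the argument of [psi] lies between 3/4 and 1, where [psi 2] dominates [psi 0],
     which is nondecreasing. *)
  have Yc : cutoff_height <= Y.
    have p34 : 3 / 4 <= 1 - u / r ^+ 2.
      have : u / r ^+ 2 <= 1 / 4 by rewrite ler_pdivrMr//; lra.
      lra.
    apply: le_trans (psi_ndecr p34) _.
    have w0 : 0 < 1 - u / r ^+ 2 by apply: lt_le_trans p34; rewrite divr_gt0.
    rewrite /Y /psi w0 ler_wpM2r ?expR_ge0// expr0 invr1 invf_ge1 ?exprn_gt0//.
    by rewrite exprn_ile1//; lra.
  (* Here m >= 2 enters: as u + e^2 <= 2u <= r^2, the number 2u kappa_m(u + e^2) is at least
     kappa_(m-2)(2u), and this is at least r^-(m-2). *)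
  have [k mk] : exists k, m = k.+2 by exists m.-2; case: (m) m2 => [|[|k]].
  have kk : r ^- k <= 2 * u * km.
    have u2 : 0 < 2 * u by rewrite mulr_gt0.
    have -> : r ^- k = kappa k (r ^+ 2) by rewrite kappa_sqr.
    apply: (@le_trans _ _ (kappa k (2 * u))).
      apply: kappa_le => //; apply: le_trans (ler_wpM2l _ ur2) _ => //.
      by rewrite r4; lra.
    rewrite (kappaS2 _ u2) -mk; apply: ler_wpM2l; first exact: ltW.
    by apply: kappa_le => //; lra.
  have -> : cutoff_height / r ^+ m = r ^- k * (cutoff_height / r ^+ 2).
    by rewrite mk !exprS; field; rewrite ?expf_neq0 gt_eqF.
  apply: ler_pM => //.
  - by rewrite invr_ge0 exprn_ge0.
  - by rewrite divr_ge0// ltW.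
  - by rewrite ler_wpM2r// invr_ge0 ltW.
have r2i : 0 <= r ^- 2 by rewrite invr_ge0 ltW.
have me0 : 0 <= m%:R * e ^+ 2 by rewrite mulr_ge0// ltW.
have main1 : m%:R * e ^+ 2 * k2 * X <= m%:R * e ^+ 2 / rho ^+ m.+2.
  rewrite -[leRHS]mulr1; apply: ler_pM => //; first by rewrite mulr_ge0.
  by rewrite ler_wpM2l.
(* The coefficient of the squared normal component is -2 [dK], at most (m + 12) rho^-(m+2) by X <= 1
   and Y <= 6; the bound [nb] doubles it. *)
have main2 : (m%:R * k2 * X + 2 * km * (Y / r ^+ 2)) * (u - p) <=
    (2 * m%:R + 24) / rho ^+ m.+2 * (r ^+ 2 * ti + q).
  apply: (@le_trans _ _ ((m%:R + 12) / rho ^+ m.+2 * (u - p))).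
    apply: ler_wpM2r => //; rewrite [leRHS]mulrDl; apply: lerD.
      rewrite -mulrA; apply: ler_wpM2l => //; apply: (@le_trans _ _ (k2 * 1)).
        by rewrite ler_wpM2l.
      by rewrite mulr1.
    apply: (@le_trans _ _ (2 * rho ^- m * (6 / r ^+ 2))).
      apply: ler_pM; [by rewrite mulr_ge0|by rewrite mulr_ge0|by rewrite ler_wpM2l|].
      by rewrite ler_wpM2r.
    have -> : 2 * rho ^- m * (6 / r ^+ 2) = 12 * (rho ^- m / r ^+ 2) by ring.
    by rewrite ler_wpM2l.
  have -> : (2 * m%:R + 24) / rho ^+ m.+2 * (r ^+ 2 * ti + q) =
     (m%:R + 12) / rho ^+ m.+2 * (2 * r ^+ 2 * ti + 2 * q) by ring.
  apply: ler_wpM2l; first by rewrite mulr_ge0 ?addr_ge0// ltW.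
  apply: le_trans nb _; rewrite lerD2r; apply: ler_wpM2r => //.
  by rewrite ler_wpM2l.
move: low main1 main2; rewrite kS; move: (rho ^- m.+2) (Y / r ^+ 2) => A B.
lra.
Qed.

End Holes.

(** * Hausdorff measure and weight *)

Section CaratheodoryCriterion.
Context {R : realType} {n : nat} (m : nat).
Local Open Scope ereal_scope.
Implicit Types (A B C T : set 'rV[R]_n) (d : R).

Lemma hausdorff_pre_ge0 d A : 0 <= hausdorff_pre m d A.
Proof.
apply: le_ereal_inf_tmp => _ [F _ <-]; apply: nneseries_ge0 => k _ _.
exact: hausdorff_gauge_ge0.
Qed.

Lemma hausdorff_pre_anti d e A : (d <= e)%R -> hausdorff_pre m e A <= hausdorff_pre m d A.
Proof.
move=> de; apply: ereal_inf_le_tmp => _ [F [AF Fd] <-]; exists F => //; split => // k.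
by apply: le_trans (Fd k) _; rewrite lee_fin.
Qed.

Lemma hausdorff_pre_le d A : (0 < d)%R -> hausdorff_pre m d A <= hausdorff m A.
Proof. by move=> d0; apply: ereal_sup_ubound; exists d. Qed.

Lemma ediam_ge A x y : A x -> A y -> (enorm (x - y))%:E <= ediam A.
Proof. by move=> Ax Ay; apply: ereal_sup_ubound; right; exists x, y. Qed.

Definition separated d A B := forall x y, A x -> B y -> (d <= enorm (x - y))%R.

(** A set of diameter at most [d] cannot meet both [A] and [B], so any admissible cover of the union
    splits into covers of [A] and of [B] without common sets. *)
Lemma hausdorff_pre_separated d A B : (0 < d)%R ->
  separated (2 * d)%R A B ->
  hausdorff_pre m d A + hausdorff_pre m d B <= hausdorff_pre m d (A `|` B).
Proof.
move=> d0 sAB; apply: le_ereal_inf_tmp => _ [F [ABF Fd] <-].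
pose G (D : set 'rV[R]_n) k := if `[< F k `&` D !=set0 >] then F k else set0.
have GP (D : set 'rV[R]_n) : D `<=` A `|` B ->
    hausdorff_pre m d D <= \sum_(k <oo) hausdorff_gauge m (G D k).
  move=> DAB; apply: ereal_inf_lbound; exists (G D) => //; split => [x Dx|k].
    have [k _ Fkx] := ABF _ (DAB _ Dx); exists k => //; rewrite /G.
    by case: asboolP => // h; exfalso; apply: h; exists x.
  by rewrite /G; case: asboolP => // _; rewrite ediam_set0 lee_fin ltW.
apply: (le_trans (leeD (GP A _) (GP B _))); [by left|by right|].
rewrite -nneseriesD; [|by move=> *; exact: hausdorff_gauge_ge0|by move=> *; exact: hausdorff_gauge_ge0].
apply: lee_nneseries => [k _ _|k _].
  by rewrite adde_ge0// hausdorff_gauge_ge0.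
have g0 : hausdorff_gauge m (set0 : set 'rV[R]_n) = 0 by rewrite /hausdorff_gauge eqxx.
rewrite /G; case: asboolP => [[x [Fx Ax]]|_]; case: asboolP => [[y [Fy By]]|_]; last 3 first.
- by rewrite g0 adde0.
- by rewrite g0 add0e.
- by rewrite g0 adde0 hausdorff_gauge_ge0.
have := le_trans (ediam_ge Fx Fy) (Fd k); rewrite lee_fin => h.
have := le_trans (sAB x y Ax By) h; rewrite leNgt ltr_pMl//.
by rewrite ltr1n.
Qed.

Lemma hausdorff_separated d A B : (0 < d)%R -> separated d A B ->
  hausdorff m A + hausdorff m B <= hausdorff m (A `|` B).
Proof.
move=> d0 sAB; set X := hausdorff m (A `|` B).
have pre e e' : (0 < e)%R -> (0 < e')%R -> hausdorff_pre m e A + hausdorff_pre m e' B <= X.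
  move=> e0 e'0; pose f := Num.min (Num.min e e') (d / 2)%R.
  have f0 : (0 < f)%R by rewrite !lt_min e0 e'0 divr_gt0.
  have fe : (f <= e)%R by rewrite !ge_min lexx.
  have fe' : (f <= e')%R by rewrite !ge_min lexx orbT.
  have fd : (2 * f <= d)%R by rewrite -ler_pdivlMl// mulrC ge_min lexx orbT.
  apply: le_trans (leeD (hausdorff_pre_anti A fe) (hausdorff_pre_anti B fe')) _.
  apply: le_trans (hausdorff_pre_separated f0 _) (hausdorff_pre_le _ f0).
  by move=> x y Ax By; apply: le_trans fd (sAB x y Ax By).
have [->|Xfin] := eqVneq X +oo; first by rewrite leey.
have X0 : 0 <= X by exact: outer_measure_ge0.
have preB e' : (0 < e')%R -> hausdorff_pre m e' B \is a fin_num.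
  move=> e'0; rewrite ge0_fin_numE ?hausdorff_pre_ge0//.
  apply: le_lt_trans (_ : _ <= X) _; last by rewrite ltey.
  by apply: le_trans (pre _ _ ltr01 e'0); rewrite leeDr// hausdorff_pre_ge0.
have h1 e' : (0 < e')%R -> hausdorff m A + hausdorff_pre m e' B <= X.
  move=> e'0; rewrite -leeBrDr ?preB//; apply: ge_ereal_sup => _ [e e0 <-].
  by rewrite leeBrDr ?preB// pre.
have Afin : hausdorff m A \is a fin_num.
  rewrite ge0_fin_numE ?outer_measure_ge0//.
  apply: le_lt_trans (_ : _ <= X) _; last by rewrite ltey.
  by apply: le_trans (h1 _ ltr01); rewrite leeDl// hausdorff_pre_ge0.
rewrite -leeBrDl//; apply: ge_ereal_sup => _ [e e0 <-].
by rewrite leeBrDl// h1.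
Qed.

Definition inner_part C T (k : nat) : set 'rV[R]_n :=
  [set x | T x /\ forall c, C c -> (k.+1%:R^-1 <= enorm (x - c))%R].

(** Caratheodory's criterion for metric outer measures. The sets [Tk] of points of [T] at distance
    at least 1/(k+1) from [C] exhaust [T] minus [C]; the point is that their measures tend to the
    measure of that set, because the shells between them have summable measure. *)
Lemma closed_hausdorff_caratheodory C : closed C -> (hausdorff m).-caratheodory C.
Proof.
move=> cC; apply: le_caratheodory_measurable => T.
have [Tinf|Tfin] := eqVneq (hausdorff m T) +oo.
  by rewrite [X in _ <= X](_ : _ = +oo)// leey.
pose H : {outer_measure set 'rV[R]_n -> \bar R} := hausdorff m : set 'rV[R]_n -> \bar R.
have HT : H T \is a fin_num by rewrite ge0_fin_numE ?outer_measure_ge0// ltey.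
have sub D : D `<=` T -> H D \is a fin_num.
  move=> DT; rewrite ge0_fin_numE ?outer_measure_ge0//.
  by apply: le_lt_trans (le_outer_measure H _ _ DT) _; rewrite ltey.
pose Tk := inner_part C T.
have TkT k : Tk k `<=` T by move=> x [].
have TkS k l : (k <= l)%N -> Tk k `<=` Tk l.
  move=> kl x [Tx h]; split => // c Cc; apply: le_trans (h c Cc).
  by rewrite lef_pV2 ?posrE ?ltr0n// ler_nat.
pose h k := fine (H (Tk k)).
have hE k : H (Tk k) = (h k)%:E by rewrite fineK// sub.
have inv k : (0 < k.+1%:R^-1 - k.+2%:R^-1 :> R)%R.
  by rewrite subr_gt0 ltf_pV2 ?posrE ?ltr0n// ltr_nat.
have step k : H (Tk k) + H (Tk k.+2 `\` Tk k.+1) <= H (Tk k.+2).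
  apply: le_trans (hausdorff_separated (inv k) _) (le_outer_measure H _ _ _).
    move=> x y [Tx xC] [[Ty yC] /not_andP[//|/existsNP[c /not_implyP[Cc /negP]]]].
    rewrite -ltNge => yc; have := xC c Cc; have := enorm_triangle x y c; move: yc.
    by move: (k.+1%:R^-1)%R (k.+2%:R^-1)%R => p q; lra.
  by move=> x [/(TkS _ k.+2)|[]//]; apply; rewrite leqW.
pose r k := fine (H (Tk k.+2 `\` Tk k.+1)).
have rE k : H (Tk k.+2 `\` Tk k.+1) = (r k)%:E.
  by rewrite fineK// sub// => x [/TkT].
have stepr k : (r k <= h k.+2 - h k)%R.
  by have := step k; rewrite !hE rE -EFinD lee_fin lerBrDl.
have hle k l : (k <= l)%N -> (h k <= h l)%R.
  by move=> kl; rewrite -lee_fin -!hE; exact/le_outer_measure/TkS.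
pose t := fine (H T).
have ht k : (h k <= t)%R.
  by rewrite -lee_fin -hE fineK//; exact/le_outer_measure/TkT.
pose L := sup (range h).
have hsup : has_sup (range h).
  by split; [exists (h 0%N); exists 0%N|exists t => _ [k _ <-]].
have hL k : (h k <= L)%R by apply: sup_upper_bound => //; exists k.
have cover k : T `\` C `<=` Tk k.+1 `|` \bigcup_i (Tk (k + i).+2 `\` Tk (k + i).+1).
  move=> x [Tx Cx].
  have [j xj] : exists j, Tk j x.
    have [e e0 eC] := open_eballP (closed_openC cC) Cx.
    exists (Num.bound e^-1); split => // c Cc; rewrite leNgt; apply/negP => xc.
    apply: (eC c) => //; rewrite /eball/= enormB ltW//; apply: lt_trans xc _.
    rewrite -[ltRHS]invrK ltf_pV2 ?posrE ?ltr0n ?invr_gt0//.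
    have ei : (0 <= e^-1)%R by rewrite invr_ge0 ltW.
    by apply: lt_trans (archi_boundP ei) _; rewrite ltr_nat.
  have := ex_minnP (P := fun j => `[< Tk j x >]) (ex_intro _ j (asboolT xj)).
  move=> [i /asboolP xi imin].
  have [ik|ki] := leqP i k.+1; first by left; exact: TkS xi.
  right; exists (i - k.+2)%N => //.
  have -> : (k + (i - k.+2)).+2 = i by lia.
  have -> : (k + (i - k.+2)).+1 = i.-1 by lia.
  split => // xi1; have := imin i.-1 (asboolT xi1); lia.
(* The shell of index k + 2 is at positive distance from [Tk k], two steps below. The bounds [stepr]
   thus telescope with step two, leaving two terms at each end. *)
have psum k N : (\sum_(i < N) r (k + i)%N <= 2 * L - h k - h k.+1)%R.
  suff le : (\sum_(i < N) r (k + i)%N <= h (k + N)%N + h (k + N).+1 - h k - h k.+1)%R.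
    by apply: le_trans le _; have := hL (k + N)%N; have := hL (k + N).+1; lra.
  elim: N => [|N IH]; first by rewrite big_ord0 addn0; lra.
  by rewrite big_ord_recr/= addnS; have := stepr (k + N)%N; lra.
have bound k : H (T `\` C) <= (2 * L - h k)%:E.
  apply: le_trans (le_outer_measure H _ _ (cover k)) _.
  apply: le_trans (outer_measureU2 H _ _) _.
  have -> : (2 * L - h k = h k.+1 + (2 * L - h k - h k.+1))%R by ring.
  rewrite EFinD hE leeD2l//; apply: le_trans (outer_measure_sigma_subadditive H _) _.
  apply: lime_le; first by apply: is_cvg_nneseries => i _ _; exact: outer_measure_ge0.
  apply: nearW => N; rewrite big_mkord.
  under eq_bigr do rewrite rE.
  by rewrite sumEFin lee_fin psum.
have lowb k : H (T `&` C) + (h k)%:E <= H T.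
  rewrite -hE; apply: le_trans (hausdorff_separated (_ : (0 < k.+1%:R^-1)%R) _) (le_outer_measure H _ _ _).
  - by rewrite invr_gt0.
  - by move=> x y [_ Cx] [_ yC]; rewrite enormB; exact: yC.
  - by move=> x [[]|/TkT].
have HTC : H (T `&` C) \is a fin_num by apply: sub => x [].
rewrite -[X in _ <= X]/(H T) -[X in X + _]/(H (T `&` C)) -[X in _ + X]/(H (T `\` C)).
apply/lee_addgt0Pr => e e0.
have [_ [k _ <-] Lk] := sup_adherent (divr_gt0 e0 (ltr0n _ 2)) hsup.
apply: le_trans (leeD2l _ (bound k)) _.
have -> : (2 * L - h k)%:E = (h k)%:E + (2 * (L - h k))%:E by rewrite -EFinD; congr EFin; ring.
rewrite addeA; apply: leeD (lowb k) _; rewrite lee_fin.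
by rewrite -/L in Lk; lra.
Qed.

End CaratheodoryCriterion.

(** * Continuous functions increasing to the indicator of an open set *)

Section OpenApproximation.
Context {R : realType} {n : nat}.
Implicit Types (x y : 'rV[R]_n) (A C : set 'rV[R]_n).

(** A real-valued distance, as continuous test functions require. For empty [C] it takes the default
    value 0 of [inf], hence the nonemptiness hypotheses below. *)
Definition setdist C x : R := inf [set enorm (x - c) | c in C].

Lemma setdist_lbound C x c : C c -> setdist C x <= enorm (x - c).
Proof.
move=> Cc; apply: ge_inf; last by exists c.
by exists 0 => _ [d _ <-]; exact: enorm_ge0.
Qed.

Lemma le_setdist C x (e : R) : C !=set0 -> (forall c, C c -> e <= enorm (x - c)) ->
  e <= setdist C x.
Proof.
move=> [c Cc] h; apply: lb_le_inf; first by exists (enorm (x - c)); exists c.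
by move=> _ [d Cd <-]; exact: h.
Qed.

Lemma setdist_lip C x y : C !=set0 -> setdist C x <= enorm (x - y) + setdist C y.
Proof.
move=> C0; rewrite -lerBlDl; apply: le_setdist => // c Cc.
by rewrite lerBlDl (le_trans (setdist_lbound _ Cc))// enorm_triangle.
Qed.

Lemma setdist_continuous C : C !=set0 -> continuous (setdist C).
Proof.
move=> C0 x; apply/(@cvgrPdist_le _ _ _ (nbhs x) (nbhs_filter x)) => e e0.
have : nbhs x (eball x e) by exact: nbhs_eball.
apply: filterS => y; rewrite /eball/= => xy.
rewrite ler_distlC; have := setdist_lip x y C0; have := setdist_lip y x C0.
rewrite (enormB x y) => *; apply/andP; split; lra.
Qed.

Lemma setdist_ge0 C x : C !=set0 -> 0 <= setdist C x.
Proof. by move=> C0; apply: le_setdist => // c _; exact: enorm_ge0. Qed.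

(** Adding the exterior of a ball gives [plateau A k] bounded support and makes the region nonempty
    even when [A] is the whole space. *)
Definition outer_region A (k : nat) : set 'rV[R]_n := ~` A `|` [set x | k%:R <= enorm x].

Definition plateau A (k : nat) x : R := Num.min 1 (k%:R * setdist (outer_region A k) x).

Context (n_gt0 : (0 < n)%N).

Lemma outer_region_neq0 A k : outer_region A k !=set0.
Proof.
exists (const_mx k%:R); right => /=; apply: le_trans (norm_le_enorm _).
rewrite [leRHS]/Num.norm/= mx_normrE.
have := le_bigmax (0 : R) (fun i : 'I_1 * 'I_n => `|(const_mx k%:R : 'rV[R]_n) i.1 i.2|) (ord0, Ordinal n_gt0).
by rewrite /= mxE normr_nat.
Qed.

Lemma plateau_continuous A k : continuous (plateau A k).
Proof.
move=> x; rewrite /plateau.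
apply: (@continuous_min _ _ (cst 1) (fun x => k%:R * setdist (outer_region A k) x) x).
  exact: cst_continuous.
apply: (@continuousM _ _ (cst k%:R) (setdist _)); first exact: cst_continuous.
by apply: setdist_continuous; exact: outer_region_neq0.
Qed.

Lemma plateau_ge0 A k x : 0 <= plateau A k x.
Proof.
rewrite /plateau le_min ler01/= mulr_ge0//.
by apply: setdist_ge0; exact: outer_region_neq0.
Qed.

Lemma plateau_out A k x : outer_region A k x -> plateau A k x = 0.
Proof.
move=> Ox; apply/eqP; rewrite eq_le plateau_ge0 andbT /plateau ge_min.
apply/orP; right; rewrite mulr_ge0_le0//.
by apply: le_trans (setdist_lbound x Ox) _; rewrite subrr enorm0.
Qed.

Lemma plateau_ndecr A k l x : (k <= l)%N -> plateau A k x <= plateau A l x.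
Proof.
move=> kl; rewrite /plateau; apply: le_min2 => //.
apply: ler_pM => //; rewrite ?ler_nat ?setdist_ge0//; first exact: outer_region_neq0.
apply: le_setdist => [|c Oc]; first exact: outer_region_neq0.
apply: setdist_lbound; case: Oc => [|lc]; [by left|right => /=].
by apply: le_trans lc; rewrite ler_nat.
Qed.

Lemma plateau_cvg A x : open A -> A x -> plateau A k x @[k --> \oo] --> (1 : R).
Proof.
move=> oA Ax; have [e e0 eA] := open_eballP oA Ax.
pose K := maxn (Num.bound e^-1) (Num.bound (enorm x + e)).
apply: cvg_near_cst; exists K => // k /= Kk.
rewrite /plateau; apply/min_idPl.
have k1 : e^-1 <= k%:R.
  apply/ltW; apply: lt_le_trans (archi_boundP _) _; first by rewrite invr_ge0 ltW.
  by rewrite ler_nat (leq_trans (leq_maxl _ _) Kk).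
have k2 : enorm x + e <= k%:R.
  apply/ltW; apply: lt_le_trans (archi_boundP _) _; first by rewrite addr_ge0 ?enorm_ge0 ?ltW.
  by rewrite ler_nat (leq_trans (leq_maxr _ _) Kk).
have de : e <= setdist (outer_region A k) x.
  apply: le_setdist; first exact: outer_region_neq0.
  move=> c [Ac|/= kc].
    by rewrite leNgt; apply/negP => xc; apply: Ac; apply: eA; rewrite /eball/= enormB ltW.
  have := enormD (c - x) x; rewrite subrK enormB; lra.
rewrite -[leLHS](mulVf (lt0r_neq0 e0)); have ei : 0 <= e^-1 by rewrite invr_ge0 ltW.
apply: ler_pM; rewrite ?(ltW e0)//.
Qed.

End OpenApproximation.

(** * The weight as a Hausdorff integral of the multiplicity *)

Section WeightRepresentation.
Context {R : realType} {m n : nat} {mn : (m <= n)%N} (n_gt0 : (0 < n)%N).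
Notation Z := (varifold_space R mn).
Implicit Types (V : {measure set (borel Z) -> \bar R}) (A B : set 'rV[R]_n).
Local Open Scope ereal_scope.

Definition hausdorff_outer : {outer_measure set 'rV[R]_n -> \bar R} :=
  hausdorff m : set 'rV[R]_n -> \bar R.

Notation cT := (caratheodory_type hausdorff_outer).

Definition hausdorff_measure : {measure set cT -> \bar R} :=
  hausdorff_outer : set cT -> \bar R.

Notation H := hausdorff_measure.

Definition cylinder A : set Z := [set z | A z.1].

Lemma borel_caratheodory B : measurable (B : set (borel 'rV[R]_n)) ->
  measurable (B : set cT).
Proof.
apply: smallest_sub; first exact: sigma_algebra_measurable.
move=> U oU; rewrite -[U]setCK; apply: measurableC.
by apply: closed_hausdorff_caratheodory; exact: open_closedC.
Qed.

Lemma measurable_cylinder B : measurable (B : set (borel 'rV[R]_n)) ->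
  measurable (cylinder B : set (borel Z)).
Proof.
have mfst : measurable_fun setT (fun z : borel Z => (z.1 : borel 'rV[R]_n)).
  apply: measurability => // _ [U oU <-]; rewrite setTI.
  exact: measurable_cylinder_open.
by move=> mB; have := mfst measurableT _ mB; rewrite setTI.
Qed.

Lemma continuous_caratheodory (f : 'rV[R]_n -> R) : continuous f ->
  measurable_fun setT (f : cT -> R).
Proof.
move=> cf _ Y mY; rewrite setTI; apply: borel_caratheodory.
by have := continuous_borel cf measurableT mY; rewrite setTI.
Qed.

Section Representation.
Context (V : {measure set (borel Z) -> \bar R}) (E : set 'rV[R]_n) (theta : 'rV[R]_n -> nat).
Context (vV : varifold V) (mE : (hausdorff m).-caratheodory E)
  (intE : forall K : set 'rV[R]_n, compact K ->
     H.-integrable (E `&` K) (fun x => (theta x)%:R%:E))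
  (repV : forall f : Z -> R, continuous f -> compactly_supported f ->
     \int[V]_z (f z)%:E =
     \int[H]_(x in E) (f (x, approx_tangent_plane mn E x) * (theta x)%:R)%:E).

Definition multiplicity (x : cT) : \bar R := if x \in E then (theta x)%:R%:E else 0.

Lemma multiplicity_ge0 x : 0 <= multiplicity x.
Proof. by rewrite /multiplicity; case: ifP. Qed.

Lemma measurable_multiplicity : measurable_fun setT multiplicity.
Proof.
have mEK k : measurable (E `&` eball 0 k%:R : set cT).
  apply: measurableI => //; apply: borel_caratheodory; apply: closed_borel.
  exact: closed_eball.
have EU : E = \bigcup_k (E `&` eball 0 k%:R).
  apply/seteqP; split => [x Ex|x [k _ []//]].
  exists (Num.bound (enorm x)) => //; split => //; rewrite /eball/= subr0 ltW//.
  by apply: archi_boundP; exact: enorm_ge0.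
have mth : measurable_fun (E : set cT) (fun x : cT => (theta x)%:R%:E : \bar R).
  rewrite EU; apply/(measurable_fun_bigcup _ mEK) => k.
  have ik := intE (@compact_eball _ _ 0 k%:R).
  exact: (measurable_int H ik).
by have /(measurable_restrictT _ (mE : measurable (E : set cT))) := mth.
Qed.

Definition weight_rep B : \bar R := \int[H]_(x in (B : set cT)) multiplicity x.

(** The representation hypothesis applies to each [plateau A k], which does not depend on the plane;
    monotone convergence on both sides gives the indicator of [A]. *)
Lemma weight_rep_open A : open A -> V (cylinder A) = weight_rep A.
Proof.
move=> oA.
have mA := borel_caratheodory (open_borel oA).
have pc k : continuous (plateau A k) by exact: plateau_continuous.
have fV k : \int[V]_z (plateau A k z.1)%:E =
    \int[H]_x ((plateau A k x)%:E * multiplicity x).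
  have cf : continuous (fun z : Z => plateau A k z.1).
    move=> z; apply: (@continuous_comp _ _ _ (fun z : Z => z.1) (plateau A k)).
      exact: continuous_fst_Z.
    exact: pc.
  rewrite (repV cf); last first.
    apply: (subclosed_compact (B := (eball 0 k%:R `*` setT : set Z))).
    - exact: closed_closure.
    - exact: compact_cylinder.
    have cl : closed (eball 0 k%:R `*` setT : set Z).
      rewrite (_ : _ `*` _ = (fun z : Z => z.1) @^-1` eball 0 k%:R).
        apply: preimage_closed; last exact: closed_eball.
        by move=> z _; exact: continuous_fst_Z.
      by apply/seteqP; split => z /=; [case|].
    move/closure_id : cl => ->; apply: closureS => z /= pz; split => //.
    rewrite /eball/= subr0 leNgt; apply/negP => kz; move: pz.
    by rewrite plateau_out ?eqxx//; right => /=; exact: ltW.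
  rewrite integral_mkcond; apply: eq_integral => x _.
  rewrite /multiplicity/= patchE; case: ifPn => xE; last by rewrite mule0.
  by rewrite EFinM.
have limV : \int[V]_z (plateau A k z.1)%:E @[k --> \oo] --> V (cylinder A).
  have mp k : measurable_fun setT (fun z : borel Z => (plateau A k z.1)%:E).
    by apply/measurable_EFinP; exact: (measurable_base (f := plateau A k)).
  have h := @cvg_monotone_convergence _ _ R V setT measurableT (fun k z => (plateau A k z.1)%:E) mp _ _.
  have -> : V (cylinder A) = \int[V]_z (limn (fun k => (plateau A k z.1)%:E)).
    rewrite (eq_integral (fun z : borel Z => (\1_(cylinder A) z)%:E)) ?integral_indic ?setIT//.
      exact: measurable_cylinder (open_borel oA).
    move=> z _; apply: cvg_lim => //; rewrite indicE.
    have [zA|zA] := boolP (z \in cylinder A).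
      by apply: cvg_EFin; [exact: nearW|apply: plateau_cvg => //; rewrite inE in zA].
    apply: cvg_near_cst; apply: nearW => k; rewrite plateau_out//.
    by left; rewrite notin_setE in zA.
  apply: h => [k z _|z _ k l kl]; first by rewrite lee_fin plateau_ge0.
  by rewrite lee_fin plateau_ndecr.
have limH : \int[H]_x ((plateau A k x)%:E * multiplicity x) @[k --> \oo] --> weight_rep A.
  have mp k : measurable_fun setT (fun x : cT => (plateau A k x)%:E * multiplicity x).
    apply: emeasurable_funM; last exact: measurable_multiplicity.
    by apply/measurable_EFinP; exact: continuous_caratheodory.
  have h := @cvg_monotone_convergence _ _ R H setT measurableT
    (fun k x => (plateau A k x)%:E * multiplicity x) mp _ _.
  have -> : weight_rep A = \int[H]_x (limn (fun k => (plateau A k x)%:E * multiplicity x)).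
    rewrite /weight_rep integral_mkcond; apply: eq_integral => x _; apply/esym.
    apply: cvg_lim => //; rewrite patchE; case: ifPn => xA.
      have [r ->] : exists r : R, multiplicity x = r%:E.
        by rewrite /multiplicity; case: ifP => _; [exists (theta x)%:R|exists 0%R].
      rewrite -[X in _ --> X]mul1e -EFinM; under eq_fun do rewrite -EFinM.
      apply: cvg_EFin; first exact: nearW.
      apply: cvgM; last exact: cvg_cst.
      by apply: plateau_cvg => //; rewrite inE in xA.
    apply: cvg_near_cst; apply: nearW => k; rewrite plateau_out ?mul0e//.
    by left; rewrite notin_setE in xA.
  apply: h => [k x _|x _ k l kl]; first by rewrite mule_ge0 ?multiplicity_ge0// lee_fin plateau_ge0.
  by rewrite lee_wpmul2r ?multiplicity_ge0// lee_fin plateau_ndecr.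
have e : (fun k => \int[V]_z (plateau A k z.1)%:E) =
    (fun k => \int[H]_x ((plateau A k x)%:E * multiplicity x)).
  by apply/funext => k; exact: fV.
rewrite e in limV.
exact: (cvg_unique (@ereal_hausdorff R) limV limH).
Qed.

Lemma cylinder_ball_fin a (r : R) : V (cylinder (eball a r)) < +oo.
Proof.
case: vV => Vfin _ _; rewrite (_ : cylinder _ = (eball a r `*` setT : set Z)).
  by apply: Vfin; exact: compact_cylinder.
by apply/seteqP; split => z /=; [|case].
Qed.

(** Both sides are Borel measures in [B] that agree on open sets, a family stable under
    intersection, and are finite on the balls exhausting the space. *)
Lemma weight_repE B : measurable (B : set (borel 'rV[R]_n)) ->
  V (cylinder B) = weight_rep B.
Proof.
pose nu1 (A : set (borel 'rV[R]_n)) := V (cylinder A).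
pose nu2 (A : set (borel 'rV[R]_n)) := weight_rep A.
have nu10 : nu1 set0 = 0 by exact: measure0.
have nu1_ge0 A : 0 <= nu1 A by exact: measure_ge0.
have nu1_sa : semi_sigma_additive nu1.
  move=> F mF tF mUF; rewrite /nu1.
  have -> : cylinder (\bigcup_k F k) = \bigcup_k cylinder (F k) by [].
  apply: measure_semi_sigma_additive.
  - by move=> k; exact: measurable_cylinder.
  - apply/trivIsetP => i j _ _ ij; apply/seteqP; split => // z [zi zj].
    by have /trivIsetP/(_ i j Logic.I Logic.I ij) e := tF; have : (F i `&` F j) z.1 by []; rewrite e.
  - by apply: bigcup_measurable => k _; exact: measurable_cylinder.
have nu20 : nu2 set0 = 0 by exact: integral_set0.
have nu2_ge0 A : 0 <= nu2 A by apply: integral_ge0 => x _; exact: multiplicity_ge0.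
have nu2_sa : semi_sigma_additive nu2.
  move=> F mF tF mUF.
  have mF' k : measurable (F k : set cT) by exact: borel_caratheodory.
  exact: (semi_sigma_additive_nng_induced (mu := H) measurable_multiplicity
    multiplicity_ge0 mF' tF (borel_caratheodory mUF)).
pose mu1 : {measure set (borel 'rV[R]_n) -> \bar R} :=
  HB.pack nu1 (isMeasure.Build _ _ _ nu1 nu10 nu1_ge0 nu1_sa).
pose mu2 : {measure set (borel 'rV[R]_n) -> \bar R} :=
  HB.pack nu2 (isMeasure.Build _ _ _ nu2 nu20 nu2_ge0 nu2_sa).
move=> mB.
apply: (@measure_unique _ R (borel 'rV[R]_n) open (fun k => [set x | enorm (x - 0) < k%:R]%R) _ _ _ _ mu1 mu2) => //.
- by move=> A C oA oC; exact: openI.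
- by move=> k; exact: open_eball.
- apply/seteqP; split => // x _; exists (Num.bound (enorm x)) => //=.
  by rewrite subr0; apply: archi_boundP; exact: enorm_ge0.
- by move=> A oA; exact: weight_rep_open.
move=> k; apply: le_lt_trans (cylinder_ball_fin 0 k%:R).
rewrite -[leLHS]/(V (cylinder [set x | enorm (x - 0) < k%:R]%R)).
apply: (@le_measure _ _ _ V); rewrite ?inE.
- exact: (measurable_cylinder (open_borel (@open_eball _ _ 0 k%:R))).
- exact: (measurable_cylinder (closed_borel (@closed_eball _ _ 0 k%:R))).
- by move=> z /ltW.
Qed.

(** Integrality enters here: a positive integer multiplicity is at least 1 on [E]. *)
Lemma hausdorff_le_weight B : measurable (B : set (borel 'rV[R]_n)) ->
  (forall x, E x -> (0 < theta x)%N) -> hausdorff m (E `&` B) <= V (cylinder B).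
Proof.
move=> mB th0; rewrite weight_repE// /weight_rep.
have mEc : measurable (E : set cT) by [].
have mBc := borel_caratheodory mB.
rewrite -[leLHS]/(H (E `&` B)) -[leLHS]mul1e -integral_cst; last exact: measurableI.
apply: (@le_trans _ _ (\int[H]_(x in E `&` B) multiplicity x)).
  apply: ge0_le_integral => //.
  - exact: measurableI.
  - by apply: measurable_funTS; exact: measurable_multiplicity.
  - move=> x [Ex _]; rewrite /multiplicity mem_set// lee_fin ler1n; exact: th0.
apply: ge0_subset_integral => //.
- exact: measurableI.
- by apply: measurable_funTS; exact: measurable_multiplicity.
- by move=> x _; exact: multiplicity_ge0.
Qed.

Lemma weight_concentrated B G : measurable (B : set (borel 'rV[R]_n)) ->
  measurable (G : set (borel 'rV[R]_n)) -> E `&` B `<=` G ->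
  V (cylinder B) <= V (cylinder G).
Proof.
move=> mB mG EBG; rewrite (weight_repE mB) (weight_repE mG) /weight_rep.
rewrite [leLHS]integral_mkcond [leRHS]integral_mkcond.
have mBc := borel_caratheodory mB; have mGc := borel_caratheodory mG.
apply: ge0_le_integral.
- exact: measurableT.
- by move=> x _; apply: erestrict_ge0 => y _; exact: multiplicity_ge0.
- by apply/(measurable_restrictT _ mBc); apply: measurable_funTS; exact: measurable_multiplicity.
- by apply/(measurable_restrictT _ mGc); apply: measurable_funTS; exact: measurable_multiplicity.
move=> x _; rewrite !patchE; case: ifPn => [|_]; last first.
  by case: ifP => _; rewrite ?multiplicity_ge0.
rewrite inE => Bx; case: ifPn => // /negP; rewrite inE => Gx.
by rewrite /multiplicity; case: ifPn => //; rewrite inE => Ex; exfalso; apply: Gx; exact: EBG.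
Qed.

End Representation.
End WeightRepresentation.

(** * Density *)

Section DensityLowerBound.
Context {R : realType} {m n : nat} {mn : (m <= n)%N} (n_gt0 : (0 < n)%N) (m_gt0 : (0 < m)%N).
Notation Z := (varifold_space R mn).
Implicit Types (V : {measure set (borel Z) -> \bar R}) (A B : set 'rV[R]_n).
Local Open Scope ereal_scope.

Definition gauge_const : R := (ball_volume m / 2 ^+ m)%R.

Lemma gauge_const_gt0 : (0 < gauge_const)%R.
Proof. by rewrite divr_gt0 ?exprn_gt0// ball_volume_gt0. Qed.

Lemma measurable_eball a (r : R) : measurable (eball a r : set (borel 'rV[R]_n)).
Proof. by apply: closed_borel; exact: closed_eball. Qed.

Lemma weight_le V A B : measurable (A : set (borel 'rV[R]_n)) ->
  measurable (B : set (borel 'rV[R]_n)) -> A `<=` B ->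
  V (cylinder A) <= V (cylinder B).
Proof.
move=> mA mB AB; apply: le_measure; rewrite ?inE.
- exact: (measurable_cylinder mA).
- exact: (measurable_cylinder mB).
- by move=> z; exact: AB.
Qed.

Lemma weight_bigcup V (F : nat -> set 'rV[R]_n) :
  (forall k, measurable (F k : set (borel 'rV[R]_n))) ->
  V (cylinder (\bigcup_k F k)) <= \sum_(k <oo) V (cylinder (F k)).
Proof.
move=> mF; have -> : cylinder (\bigcup_k F k) = \bigcup_k cylinder (F k) :> set Z by [].
apply: (@measure_sigma_subadditive _ _ _ V _ (fun k => cylinder (F k))) => //.
- by move=> k; exact: measurable_cylinder.
- by apply: bigcup_measurable => k _; exact: measurable_cylinder.
Qed.

(** The points of [U] at which the weight of all small balls is at most [t * rho ^+ m]. The index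
    [j] bounds both the norm of the point and the radii concerned, so that the set has finite weight
    and a uniform scale. *)
Definition thin_set V (U : set 'rV[R]_n) (t : R) (j : nat) : set 'rV[R]_n :=
  U `&` eball 0 j%:R `&`
  [set y | forall rho : R, (0 < rho)%R -> (rho < j.+1%:R^-1)%R ->
     V (cylinder (eball y rho)) <= (t * rho ^+ m)%:E].

(** The condition on the radii is closed: a strict violation at radius rho persists for a slightly
    larger s, and the ball of radius s about any point near y contains the ball of radius rho about
    y. *)
Lemma measurable_thin_set V U t j : (0 < t)%R -> open U ->
  measurable (thin_set V U t j : set (borel 'rV[R]_n)).
Proof.
move=> t0 oU; apply: measurableI.
  by apply: measurableI; [exact: open_borel|exact: measurable_eball].
apply: closed_borel; rewrite -[X in closed X]setCK; apply: open_closedC.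
rewrite openE => y /existsNP[rho /not_implyP[rho0 /not_implyP[rhoj /negP]]].
rewrite -ltNge => Vy.
have [s rs [sj Vs]] : exists2 s, (rho < s)%R & (s < j.+1%:R^-1)%R /\
    (t * s ^+ m)%:E < V (cylinder (eball y rho)).
  have c : (t * s ^+ m)%:E @[s --> rho^'+] --> (t * rho ^+ m)%:E.
    apply: cvg_EFin; first exact: nearW.
    apply: cvgM; first exact: cvg_cst.
    by apply: cvg_at_right_filter; exact: exprn_continuous.
  near (rho^'+) => s; exists s => //; split.
    by near: s; exact: nbhs_right_lt.
  near: s; move: c => /(_ [set v | v < V (cylinder (eball y rho))]); apply.
  by apply: open_nbhs_nbhs; split; [exact: open_ereal_lt_ereal|].
have sr : (0 < s - rho)%R by rewrite subr_gt0.
apply: filterS (nbhs_eball y sr) => x; rewrite /eball/= => xy.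
apply/existsNP; exists s; apply/not_implyP; split; first exact: lt_trans rs.
apply/not_implyP; split => //; apply/negP; rewrite -ltNge.
apply: lt_le_trans Vs _; apply: weight_le; try exact: measurable_eball.
move=> z; rewrite /eball/= => zy; have := enorm_triangle z y x; rewrite (enormB y x); lra.
Unshelve. all: by end_near. Qed.

Lemma ediam_eball A x : A x -> ediam A \is a fin_num ->
  A `<=` eball x (fine (ediam A)).
Proof.
by move=> Ax Af y Ay; rewrite /eball/= -lee_fin fineK// ediam_ge.
Qed.

(** Cover [E] within the thin set W almost optimally. A covering set meeting W lies in the ball
    about a point of W whose radius is its diameter, and thinness bounds the weight of that ball by
    half the gauge of the set. Hence w <= (w + e)/2 for the weight w of W, since the Hausdorff
    measure of its part in [E] is at most w. *)
Lemma thin_set_null V U (j : nat) : varifold V -> integral_varifold V -> open U ->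
  V (cylinder (thin_set V U (gauge_const / 2) j)) = 0.
Proof.
move=> vV [E [theta [[_ mE] th0 intE repV]]] oU.
set t := (gauge_const / 2)%R; set W := thin_set V U t j.
have t0 : (0 < t)%R by rewrite divr_gt0// gauge_const_gt0.
have mW : measurable (W : set (borel 'rV[R]_n)) by exact: measurable_thin_set.
have Wfin : V (cylinder W) \is a fin_num.
  rewrite ge0_fin_numE ?measure_ge0//.
  apply: le_lt_trans (cylinder_ball_fin vV 0 j%:R).
  by apply: weight_le => //; [exact: measurable_eball|move=> x [[]]].
have HW : hausdorff m (E `&` W) <= V (cylinder W).
  exact: (hausdorff_le_weight n_gt0 vV mE intE repV mW th0).
pose w := fine (V (cylinder W)).
have wE : V (cylinder W) = w%:E by rewrite fineK.
have w0 : (0 <= w)%R by exact: fine_ge0 (measure_ge0 _ _).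
suff we (e : R) : (0 < e)%R -> (w <= e)%R.
  rewrite wE; congr EFin; apply/eqP; rewrite eq_le w0 andbT.
  by apply/ler_addgt0Pr => e e0; rewrite add0r we.
move=> e0.
pose d : R := (j.+1%:R^-1 / 2)%R.
have j0 : (0 < j.+1%:R^-1 :> R)%R by rewrite invr_gt0.
have d0 : (0 < d)%R by rewrite divr_gt0.
have dj : (d < j.+1%:R^-1)%R by rewrite ltr_pdivrMr// ltr_pMr// ltr1n.
have pre : hausdorff_pre m d (E `&` W) < (w + e)%:E.
  apply: le_lt_trans (hausdorff_pre_le _ _ d0) _; apply: le_lt_trans HW _.
  by rewrite wE lte_fin ltrDl.
have [_ [F [WF Fd] <-] Fw] := ereal_inf_lt pre.
have Ffin k : ediam (F k) \is a fin_num.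
  by rewrite ge0_fin_numE ?ediam_ge0// (le_lt_trans (Fd k))// ltry.
pose Q k (Bk : set 'rV[R]_n) := [/\ measurable (Bk : set (borel 'rV[R]_n)),
  F k `&` W `<=` Bk & V (cylinder Bk) <= (2^-1)%:E * hausdorff_gauge m (F k)].
have [B BP] : {B : nat -> set 'rV[R]_n & forall k, Q k (B k)}.
  apply: choice => k; rewrite /Q.
  have [[x [Fx Wx]]|] := pselect (F k `&` W !=set0); last first.
    move=> /set0P/negP; rewrite negbK => /eqP FW0; exists set0; split => //.
      by rewrite FW0.
    rewrite (_ : cylinder set0 = set0)// measure0 mule_ge0 ?lee_fin//.
    exact: hausdorff_gauge_ge0.
  pose r := fine (ediam (F k)).
  have r0 : (0 <= r)%R by exact: fine_ge0 (ediam_ge0 _).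
  have rE : ediam (F k) = r%:E by rewrite fineK.
  have rd : (r <= d)%R by rewrite -lee_fin -rE.
  exists (eball x r); split; first exact: measurable_eball.
    by move=> y [Fy _]; exact: ediam_eball.
  have -> : (2^-1)%:E * hausdorff_gauge m (F k) = (t * r ^+ m)%:E.
    rewrite /hausdorff_gauge; case: ifPn => [/eqP F0|_].
      by move: Fx; rewrite F0.
    rewrite rE -/gauge_const -EFin_expe -!EFinM; congr EFin; rewrite /t; ring.
  case: Wx => _ Wx; move: r0; rewrite le_eqVlt => /orP[/eqP r0|r0]; last first.
    by apply: Wx => //; exact: le_lt_trans dj.
  (* A covering set of diameter 0 gives a ball of radius 0, to which thinness does not apply;
     smaller and smaller positive radii show that its weight is 0, as m > 0. *)
  rewrite -r0 expr0n gtn_eqF// mulr0.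
  apply/lee_addgt0Pr => f f0; rewrite add0e.
  pose s : R := Num.min (Num.min d 1%R) (f / t)%R.
  have s0 : (0 < s)%R by rewrite !lt_min d0 ltr01 divr_gt0.
  have s1 : (s <= 1)%R by rewrite /s !ge_min lexx orbT.
  have sd : (s <= d)%R by rewrite /s !ge_min lexx.
  have sf : (s <= f / t)%R by rewrite /s ge_min lexx orbT.
  apply: (@le_trans _ _ (V (cylinder (eball x s)))).
    apply: weight_le; try exact: measurable_eball.
    by move=> y; rewrite /eball/= => /le_trans; apply; exact: ltW.
  apply: le_trans (Wx _ s0 (le_lt_trans sd dj)) _; rewrite lee_fin.
  rewrite -ler_pdivlMl// mulrC; apply: le_trans sf; rewrite -[leRHS]expr1.
  by apply: ler_wiXn2l => //; exact: ltW.
have mB k : measurable (B k : set (borel 'rV[R]_n)) by have [] := BP k.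
have mG : measurable (\bigcup_k B k : set (borel 'rV[R]_n)) by exact: bigcup_measurable.
have EWG : E `&` W `<=` \bigcup_k B k.
  move=> x EWx; have [k _ Fx] := WF _ EWx; exists k => //.
  by have [_ + _] := BP k; apply; split => //; case: EWx.
have := weight_concentrated n_gt0 vV mE intE repV mW mG EWG.
move=> /le_trans/(_ (weight_bigcup V mB)) h.
have : w%:E <= (2^-1)%:E * (w + e)%:E.
  rewrite -wE; apply: le_trans h _.
  apply: (@le_trans _ _ (\sum_(k <oo) ((2^-1)%:E * hausdorff_gauge m (F k)))).
    apply: lee_nneseries => [k _ _|k _]; first exact: measure_ge0.
    by have [] := BP k.
  rewrite nneseriesZl; last by move=> k _; exact: hausdorff_gauge_ge0.
  by rewrite lee_wpmul2l ?lee_fin// ltW.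
by rewrite -EFinM lee_fin; lra.
Qed.

Lemma exists_dense_point V U : varifold V -> integral_varifold V -> open U ->
  V (cylinder U) != 0 ->
  exists2 y, U y & forall d : R, (0 < d)%R -> exists2 rho, (0 < rho < d)%R &
    (gauge_const / 2 * rho ^+ m)%:E < V (cylinder (eball y rho)).
Proof.
move=> vV iV oU V0; apply: contrapT => h; move/negP: V0; apply.
have t0 : (0 < gauge_const / 2)%R by rewrite divr_gt0// gauge_const_gt0.
have UW : U `<=` \bigcup_j thin_set V U (gauge_const / 2) j.
  move=> y Uy.
  have [d d0 dy] : exists2 d : R, (0 < d)%R & forall rho, (0 < rho < d)%R ->
      V (cylinder (eball y rho)) <= (gauge_const / 2 * rho ^+ m)%:E.
    apply: contrapT => hd; apply: h; exists y => // d d0.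
    apply: contrapT => hr; apply: hd; exists d => // rho rhod.
    by rewrite leNgt; apply/negP => hV; apply: hr; exists rho.
  exists (maxn (Num.bound d^-1) (Num.bound (enorm y))) => //; split.
    split => //; rewrite /eball/= subr0; apply/ltW.
    apply: lt_le_trans (archi_boundP (enorm_ge0 y)) _.
    by rewrite ler_nat leq_maxr.
  move=> rho rho0 rhoj; apply: dy; rewrite rho0/=; apply: lt_trans rhoj _.
  have di : (0 <= d^-1)%R by rewrite invr_ge0 ltW.
  rewrite -[ltRHS]invrK ltf_pV2 ?posrE ?ltr0n ?invr_gt0//.
  by apply: lt_trans (archi_boundP di) _; rewrite ltr_nat ltnS leq_maxl.
rewrite eq_le measure_ge0 andbT.
have mW j := measurable_thin_set V j t0 oU.
apply: le_trans (weight_le _ (open_borel oU) (bigcup_measurable (fun j _ => mW j)) UW) _.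
apply: le_trans (weight_bigcup V mW) _.
by rewrite eseries0// => j _ _; exact: thin_set_null.
Qed.

End DensityLowerBound.

(** * Vitali's covering argument for an abstract relation of meeting *)

Section VitaliSelection.
Context {R : realType} {I : Type}.
Implicit Types (V D : set I) (i j : I).

(** Zorn's lemma is applied to the disjoint subfamilies such that whatever meets them meets a member
    of at least half its radius. If some index met no member of a maximal one, an index of nearly
    maximal radius among those could be added. *)
Lemma vitali_selection (meets : I -> I -> Prop) (rad : I -> R) (M : R) V :
  (forall i, V i -> meets i i) -> (forall i j, meets i j -> meets j i) ->
  (forall i, V i -> 0 < rad i <= M) ->
  exists D, [/\ D `<=` V, forall i j, D i -> D j -> meets i j -> i = j &
    forall i, V i -> exists j, [/\ D j, meets i j & rad i <= 2 * rad j]].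
Proof.
move=> mrefl msym radV.
pose P D := [/\ D `<=` V, forall i j, D i -> D j -> meets i j -> i = j &
    forall i, V i -> (exists2 j, D j & meets i j) ->
      exists j, [/\ D j, meets i j & rad i <= 2 * rad j]].
have [D [[DV Dd Dr] Dmax]] : exists D, P D /\ forall B, D `<` B -> ~ P B.
  apply: Zorn_bigcup => F FP Ftot; split.
  - by move=> i [D FD Di]; have [DV _ _] := FP D FD; exact: DV.
  - move=> i j [D FD Di] [D' FD' D'j] mij.
    have [DD'|D'D] := Ftot D D' FD FD'.
      by have [_ + _] := FP D' FD'; apply => //; exact: DD'.
    by have [_ + _] := FP D FD; apply => //; exact: D'D.
  - move=> i Vi [j [D FD Dj] mij]; have [_ _ h] := FP D FD.
    by have [|k [Dk mik ik]] := h i Vi; [exists j|exists k; split => //; exists D].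
exists D; split => // i Vi; apply: (Dr i Vi); apply: contrapT => nmeet.
pose W := [set k | V k /\ ~ exists2 j, D j & meets k j].
have Wi : W i by [].
have hs : has_sup (rad @` W).
  split; first by exists (rad i); exists i.
  by exists M => _ [k [Vk _] <-]; have /andP[] := radV k Vk.
pose s := sup (rad @` W).
have s0 : 0 < s.
  have /andP[ri _] := radV i Vi; apply: lt_le_trans ri _.
  by apply: sup_upper_bound => //; exists i.
(* The radius of [k] exceeds half the supremum, so every index that meets [k] and no member of [D]
   has at most twice its radius. *)
have [_ [k [Vk Wk] <-] sk] := sup_adherent (divr_gt0 s0 (ltr0n _ 2)) hs.
have sle j : W j -> rad j <= s by move=> Wj; apply: sup_upper_bound => //; exists j.
apply: (Dmax (D `|` [set k])).
  split; first by left.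
  move=> h; apply: Wk; exists k; last exact: mrefl Vk.
  by apply: h; right.
split.
- by move=> j [/DV //|->].
- move=> j l [Dj|->] [Dl|->] mjl //.
  + exact: Dd.
  + by exfalso; apply: Wk; exists j => //; exact: msym.
  + by exfalso; apply: Wk; exists l.
- move=> j Vj [q Dq mjq].
  have [[l Dl mjl]|nj] := pselect (exists2 l, D l & meets j l).
    by have [|p [Dp mjp jp]] := Dr j Vj; [exists l|exists p; split => //; left].
  case: Dq => [Dq|eq]; first by exfalso; apply: nj; exists q.
  exists k; split; [by right|by rewrite -eq|].
  have rj : rad j <= s by apply: sle.
  move: sk; rewrite -/s; lra.
Qed.

End VitaliSelection.

(** * Density of the weight outside a closed set at points of that set *)

Section DensityOfComplement.
Context {R : realType} {m n : nat} {mn : (m <= n)%N} (n_gt0 : (0 < n)%N) (m_gt0 : (0 < m)%N).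
Notation Z := (varifold_space R mn).
Implicit Types (V : {measure set (borel Z) -> \bar R}) (C D : set 'rV[R]_n).

Lemma rational_point (x : 'rV[R]_n) (r : R) : (0 < r)%R ->
  exists q : 'rV[rat]_n, eball x r (map_mx (@ratr R) q).
Proof.
move=> r0; pose e : R := (r / n%:R)%R.
have e0 : (0 < e)%R by rewrite divr_gt0// ltr0n.
have h i : exists q : rat, (x 0 i - e < ratr q < x 0 i + e)%R.
  have [|q] := @rat_in_itvoo R (x 0 i - e) (x 0 i + e); first lra.
  by rewrite in_itv/=; exists q.
have [q hq] := choice h.
exists (\row_i q i); rewrite /eball/=; apply: le_trans (enorm_le_norm _) _.
rewrite mulrC -ler_pdivlMr ?ltr0n// -/e.
rewrite /Num.norm/= mx_normrE; apply/bigmax_leP; split => [|[k i] _ /=]; first exact: ltW.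
rewrite (ord1 k) !mxE ler_norml; have /andP[] := hq i; lra.
Qed.

Local Open Scope ereal_scope.

Definition meets (rad : 'rV[R]_n -> R) (x y : 'rV[R]_n) : Prop :=
  eball x (rad x) `&` eball y (rad y) !=set0.

Lemma disjoint_balls_countable D (rad : 'rV[R]_n -> R) :
  (forall x, D x -> (0 < rad x)%R) ->
  (forall x y, D x -> D y -> meets rad x y -> x = y) -> countable D.
Proof.
move=> rad0 dis.
have h x : exists q : 'rV[rat]_n, D x -> eball x (rad x) (map_mx (@ratr R) q).
  have [Dx|nDx] := pselect (D x); last by exists (0%R : 'rV[rat]_n).
  by have [q hq] := rational_point x (rad0 x Dx); exists q.
have [q hq] := choice h.
apply/countable_injP; exists (choice.pickle \o q) => x y /set_mem Dx /set_mem Dy /=.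
move=> /(pcan_inj choice.pickleK) qxy; apply: dis => //.
exists (map_mx (@ratr R) (q x)); split; first exact: hq.
by rewrite qxy; exact: hq.
Qed.

Lemma ediam_eball_le (x : 'rV[R]_n) (r : R) : (0 <= r)%R -> ediam (eball x r) <= (2 * r)%:E.
Proof.
move=> r0; apply: ge_ereal_sup => v [->|[y [z [+ + ->]]]].
  by rewrite lee_fin mulr_ge0.
rewrite /eball/= => yx zx; rewrite lee_fin.
have := enorm_triangle y x z; rewrite (enormB x z); lra.
Qed.

Lemma expe_le (x y : \bar R) k : 0 <= x -> x <= y -> x ^+ k <= y ^+ k.
Proof.
move=> x0 xy; elim: k => [|k IH]; first by rewrite !expe0.
by rewrite !expeS lee_pmul// expe_ge0.
Qed.

(** The points of [C] in a bounded region at which the weight outside [C] exceeds [e * r ^+ m] for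
    arbitrarily small [r]; vanishing density fails exactly on the union of such sets. *)
Definition dense_points V C (N : nat) (e : R) : set 'rV[R]_n :=
  [set x | [/\ C x, eball 0 N%:R x & forall d : R, (0 < d)%R -> exists2 r, (0 < r < d)%R &
    (e * r ^+ m)%:E < V (cylinder (eball x r `\` C))]].

Lemma measurable_collar V C x (r : R) : closed C ->
  measurable (eball x r `\` C : set (borel 'rV[R]_n)).
Proof.
by move=> cC; apply: measurableD; [exact: measurable_eball|exact: closed_borel].
Qed.

(** Collars of width 1/(j+1) about a bounded part of [C], with [C] removed, decrease to the empty
    set because [C] is closed. They have finite weight, so the weight tends to 0. *)
Lemma small_collar V C (N : nat) (e : R) : varifold V -> closed C -> (0 < e)%R ->
  exists2 d : R, (0 < d)%R & exists G : set 'rV[R]_n,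
    [/\ measurable (G : set (borel 'rV[R]_n)), V (cylinder G) <= e%:E &
      forall x r, C x -> eball 0 N%:R x -> (r <= d)%R -> eball x r `\` C `<=` G].
Proof.
move=> vV cC e0; pose C' := C `&` eball 0 N%:R.
have cC' : closed C' by apply: closedI => //; exact: closed_eball.
have [C'0|/set0P C'n0] := eqVneq C' set0.
  exists 1%R => //; exists set0; split => //.
    by rewrite (_ : cylinder set0 = set0)// measure0 lee_fin ltW.
  by move=> x r Cx Nx; have : C' x by []; rewrite C'0.
pose G j : set 'rV[R]_n := [set x | (setdist C' x <= j.+1%:R^-1)%R] `\` C.
have GC j : closed [set x | (setdist C' x <= j.+1%:R^-1)%R].
  rewrite (_ : [set x | _] = setdist C' @^-1` [set s | (s <= j.+1%:R^-1)%R])//.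
  apply: preimage_closed; last exact: closed_le.
  by move=> x _; exact: setdist_continuous.
have mG j : measurable (G j : set (borel 'rV[R]_n)).
  by apply: measurableD; apply: closed_borel.
have G0 : \bigcap_j G j = set0.
  apply/seteqP; split => // x Gx.
  have [_ nCx] := Gx 0%N Logic.I.
  have [d d0 dC] := open_eballP (closed_openC cC) nCx.
  have dle : (d <= setdist C' x)%R.
    apply: le_setdist => // c [Cc _]; rewrite leNgt; apply/negP => xc.
    by apply: (dC c) => //; rewrite /eball/= enormB ltW.
  have [/= h _] := Gx (Num.bound d^-1) Logic.I.
  move: h; rewrite leNgt => /negP; apply; apply: lt_le_trans dle.
  rewrite -[ltRHS]invrK ltf_pV2 ?posrE ?ltr0n ?invr_gt0//.
  have di : (0 <= d^-1)%R by rewrite invr_ge0 ltW.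
  by apply: lt_trans (archi_boundP di) _; rewrite ltr_nat.
have GN : G 0%N `<=` eball 0 (N%:R + 3).
  move=> x [/= xC _]; rewrite /eball/= subr0.
  rewrite leNgt; apply/negP => Nx.
  have : (2 <= setdist C' x)%R.
    apply: le_setdist => // c [_]; rewrite /eball/= subr0 => cN.
    have := enormD (x - c) c; rewrite subrK; lra.
  move: xC; rewrite invr1; lra.
have Gcvg : V (cylinder (G j)) @[j --> \oo] --> (0 : \bar R).
  have -> : (0 : \bar R) = V (\bigcap_j cylinder (G j)).
    rewrite (_ : \bigcap_j cylinder (G j) = set0) ?measure0//.
    apply/seteqP; split => // z hz; have : (\bigcap_j G j) z.1 by [].
    by rewrite G0.
  apply: (@nonincreasing_cvg_mu _ _ _ V (fun j => cylinder (G j))).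
  - apply: le_lt_trans (cylinder_ball_fin vV 0 (N%:R + 3)).
    by apply: weight_le => //; exact: measurable_eball.
  - by move=> j; exact: measurable_cylinder.
  - by apply: bigcap_measurable => // j _; exact: measurable_cylinder.
  - move=> j k jk; apply/subsetPset => z [/= h1 h2]; split => //.
    by apply: le_trans h1 _; rewrite lef_pV2 ?posrE ?ltr0n// ler_nat.
have [J _ hJ] : \forall j \near \oo, V (cylinder (G j)) < e%:E.
  apply: Gcvg [set v | v < e%:E] _.
  by apply: open_nbhs_nbhs; split; [exact: open_ereal_lt_ereal|rewrite /= lte_fin].
exists (J.+1%:R^-1)%R; first by rewrite invr_gt0.
exists (G J); split => //; first by apply/ltW/hJ => /=.
move=> x r Cx Nx rd y [xy nCy]; split => //=.
by apply: le_trans (setdist_lbound y (_ : C' x)) _ => //; apply: le_trans rd.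
Qed.

(** The Vitali argument: threefold enlargements of disjoint balls cover the dense points, and the
    gauge of each is at most a constant times the weight of its ball outside [C]. By disjointness
    the sum is at most that constant times the weight of a thin collar, which is as small as
    desired. *)
Lemma dense_points_null V C (N : nat) (e : R) : varifold V -> closed C -> (0 < e)%R ->
  hausdorff m (dense_points V C N e) = 0.
Proof.
move=> vV cC e0; apply/eqP; rewrite eq_le outer_measure_ge0 andbT.
apply: ge_ereal_sup => _ [d d0 <-].
apply/lee_addgt0Pr => f f0; rewrite add0e.
(* The threefold ball has diameter at most 6 r, so its gauge is at most [K * (e * r ^+ m)]. *)
pose K := ((@gauge_const R m) * 6 ^+ m / e)%R : R.
have gc0 : (0 < (@gauge_const R m) :> R)%R by exact: gauge_const_gt0.
have K0 : (0 < K)%R by rewrite divr_gt0// mulr_gt0 ?exprn_gt0//.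
have fK : (0 < f / K)%R by rewrite divr_gt0.
have [s s0 [G [mG VG hG]]] := small_collar N vV cC fK.
pose B := dense_points V C N e.
(* The bound [s] keeps the balls in the collar, and [d / 6] keeps the diameters of the threefold
   balls below [d]. *)
pose M := Num.min s (d / 6)%R.
have M0 : (0 < M)%R by rewrite lt_min s0 divr_gt0.
have hr x : exists r : R, B x -> (0 < r < M)%R /\ (e * r ^+ m)%:E < V (cylinder (eball x r `\` C)).
  have [[Cx Nx h]|nB] := pselect (B x); last by exists 0%R.
  by have [r rM hV] := h M M0; exists r.
have [rad radP] := choice hr.
have rad0 x : B x -> (0 < rad x)%R by move=> /radP[/andP[]].
have [D [DB Dd Dc]] : exists D, [/\ D `<=` B, forall x y, D x -> D y -> meets rad x y -> x = y &
    forall x, B x -> exists y, [/\ D y, meets rad x y & (rad x <= 2 * rad y)%R]].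
  apply: (@vitali_selection R _ (meets rad) rad M B).
  - move=> x /radP[/andP[/ltW r0 _] _]; exists x.
    by split; rewrite /eball/= subrr enorm0.
  - by move=> x y [z [xz yz]]; exists z.
  - by move=> x /radP[/andP[-> /ltW ->]].
have /countable_injP[idx idxI] := disjoint_balls_countable (fun x Dx => rad0 x (DB x Dx)) Dd.
have hc k : exists c : option 'rV[R]_n, forall x, c = Some x <-> D x /\ idx x = k.
  have [[x [Dx xk]]|h] := pselect (exists x, D x /\ idx x = k).
    exists (Some x) => y; split => [[<-]//|[Dy yk]]; congr Some.
    by apply: idxI; rewrite ?inE// xk yk.
  by exists None => y; split => // hy; exfalso; apply: h; exists y.
have [c cP] := choice hc.
pose F k := if c k is Some x then eball x (3 * rad x) else set0.
pose U k := if c k is Some x then eball x (rad x) `\` C else set0.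
have mU k : measurable (U k : set (borel 'rV[R]_n)).
  by rewrite /U; case: (c k) => // x; exact: measurable_collar.
have tU : trivIset setT (fun k => cylinder (U k) : set Z).
  apply/trivIsetP => i j _ _ /eqP ij; apply/seteqP; split => // z []; rewrite /cylinder/= /U.
  case ci : (c i) => [x|//]; case cj : (c j) => [y|//] [xz _] [yz _].
  have [Dx xi] := (cP i x).1 ci; have [Dy yj] := (cP j y).1 cj.
  by apply: ij; rewrite -xi -yj (Dd x y)//; exists z.1.
apply: (@le_trans _ _ (\sum_(k <oo) hausdorff_gauge m (F k))).
  apply: ereal_inf_lbound; exists F => //; split.
    move=> x Bx; have [y [Dy [z [xz yz]] rxy]] := Dc x Bx.
    exists (idx y) => //; rewrite /F ((cP (idx y) y).2 _)//.
    rewrite /eball/=; have := enorm_triangle x z y; move: xz yz; rewrite /eball/= (enormB z x); lra.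
  move=> k; rewrite /F; case ck : (c k) => [x|]; last by rewrite ediam_set0 lee_fin ltW.
  have [Dx _] := (cP k x).1 ck; have [/andP[r0 rM] _] := radP x (DB x Dx).
  have rd : (rad x <= d / 6)%R by apply: le_trans (ltW rM) _; rewrite /M ge_min lexx orbT.
  have r30 : (0 <= 3 * rad x)%R by rewrite mulr_ge0// ltW.
  by apply: le_trans (ediam_eball_le x r30) _; rewrite lee_fin; lra.
apply: (@le_trans _ _ (\sum_(k <oo) (K%:E * V (cylinder (U k))))).
  apply: lee_nneseries => [k _ _|k _]; first exact: hausdorff_gauge_ge0.
  rewrite /F /U; case ck : (c k) => [x|]; last first.
    rewrite /hausdorff_gauge eqxx; apply: mule_ge0; last exact: measure_ge0.
    by rewrite lee_fin ltW.
  have [Dx _] := (cP k x).1 ck; have [/andP[r0 rM] Vx] := radP x (DB x Dx).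
  have r30 : (0 <= 3 * rad x)%R by rewrite mulr_ge0// ltW.
  rewrite /hausdorff_gauge; case: ifPn => [_|_].
    by apply: mule_ge0; [rewrite lee_fin ltW|exact: measure_ge0].
  apply: (@le_trans _ _ ((@gauge_const R m)%:E * (6 * rad x)%:E ^+ m)).
    apply: lee_wpmul2l; first by rewrite lee_fin ltW.
    apply: expe_le; [exact: ediam_ge0|].
    by apply: le_trans (ediam_eball_le x r30) _; rewrite lee_fin mulrA -natrM.
  rewrite -EFin_expe -EFinM.
  have -> : ((@gauge_const R m) * (6 * rad x) ^+ m = K * (e * rad x ^+ m))%R.
    by rewrite /K exprMn; field; rewrite gt_eqF.
  by rewrite EFinM; apply: lee_wpmul2l; rewrite ?lee_fin; exact: ltW.
rewrite nneseriesZl; last by move=> k _; exact: measure_ge0.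
have -> : \sum_(k <oo) V (cylinder (U k)) = V (\bigcup_k cylinder (U k)).
  rewrite measure_bigcup//; last by move=> k _; exact: measurable_cylinder.
  by apply: eq_eseriesl => k; rewrite in_setT.
apply: (@le_trans _ _ (K%:E * (f / K)%:E)).
  apply: lee_wpmul2l; first by rewrite lee_fin ltW.
  apply: le_trans VG.
  apply: le_measure; rewrite ?inE.
  - by apply: bigcup_measurable => k _; exact: measurable_cylinder.
  - exact: measurable_cylinder.
  - move=> z [k _]; rewrite /cylinder/= /U; case ck : (c k) => [x|//] zx.
    have [Dx _] := (cP k x).1 ck; have [/andP[r0 rM] _] := radP x (DB x Dx).
    have [Cx Nx _] := DB x Dx; apply: hG zx => //.
    by apply: le_trans (ltW rM) _; rewrite /M ge_min lexx.
by rewrite -EFinM lee_fin mulrCA divff ?mulr1// gt_eqF.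
Qed.

End DensityOfComplement.

(** * Points of small density off the plane *)

Section Support.
Context {R : realType} {m n : nat} {mn : (m <= n)%N} (n_gt0 : (0 < n)%N) (m_gt0 : (0 < m)%N).
Notation Z := (varifold_space R mn).
Context (V : {measure set (borel Z) -> \bar R}) (vV : varifold V).
Implicit Types (A B : set 'rV[R]_n) (x y a : 'rV[R]_n) (r : R).
Local Open Scope ereal_scope.

Lemma weightE A : weight V A = V (cylinder A).
Proof. by rewrite /weight; congr (V _); apply/seteqP; split => z /=; [case|]. Qed.

Lemma weight_support_open a A : weight_support V a -> open A -> A a -> V (cylinder A) != 0.
Proof.
move=> sa oA Aa; apply/eqP => VA0; apply: sa; exists A => //; split => //.
by rewrite weightE.
Qed.

Lemma open_weight_support_compl : open (~` weight_support V).
Proof. by rewrite /weight_support setCK; apply: bigcup_open => U []. Qed.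

(** The union of null open sets is a countable union of null balls with rational centre and radius
    1/(j+1). *)
Lemma weight_support_null : V (cylinder (~` weight_support V)) = 0.
Proof.
have oG := open_weight_support_compl.
pose F k : set 'rV[R]_n :=
  if choice.unpickle k is Some (q, j) then
    let B := eball (map_mx (@ratr R) (q : 'rV[rat]_n)) (j.+1%:R^-1) in
    if V (cylinder B) == 0 then B else set0
  else set0.
have mF k : measurable (F k : set (borel 'rV[R]_n)).
  rewrite /F; case: choice.unpickle => [[q j]|//] /=; case: ifP => // _.
  exact: measurable_eball.
have F0 k : V (cylinder (F k)) = 0.
  have z0 : V (cylinder set0) = 0 by rewrite (_ : cylinder set0 = set0)// measure0.
  by rewrite /F; case: choice.unpickle => [[q j]|//] /=; case: ifP => [/eqP|].
have GF : ~` weight_support V `<=` \bigcup_k F k.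
  rewrite /weight_support setCK => x [U [oU U0] Ux].
  have [r r0 rU] := open_eballP oU Ux.
  pose j := Num.bound (2 / r)%R.
  have r2 : (0 <= 2 / r)%R by rewrite divr_ge0// ltW.
  have jr : (2 * j.+1%:R^-1 < r)%R.
    rewrite ltr_pdivrMr// mulrC -ltr_pdivrMr//.
    by apply: lt_trans (archi_boundP r2) _; rewrite ltr_nat.
  have j0 : (0 < j.+1%:R^-1 :> R)%R by rewrite invr_gt0.
  have [q qx] := rational_point n_gt0 x j0.
  have qU : eball (map_mx (@ratr R) q) (j.+1%:R^-1) `<=` U.
    move=> y; rewrite /eball/= => yq; apply: rU; rewrite /eball/=.
    move: qx; rewrite /eball/= => qx.
    have := enorm_triangle y (map_mx (@ratr R) q) x.
    by move: (j.+1%:R^-1)%R jr yq qx => d; lra.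
  exists (choice.pickle (q, j)) => //; rewrite /F choice.pickleK/= ifT.
    by move: qx; rewrite /eball/= enormB.
  rewrite eq_le measure_ge0 andbT -U0 weightE.
  by apply: weight_le => //; [exact: measurable_eball|exact: open_borel].
apply/eqP; rewrite eq_le measure_ge0 andbT.
apply: le_trans (weight_le V (open_borel oG) (bigcup_measurable (fun j _ => mF j)) GF) _.
by apply: le_trans (weight_bigcup V mF) _; rewrite eseries0.
Qed.

End Support.

(** * Lower bound on weights of balls and decay of the height *)

Section Decay.
Context {R : realType} {m n : nat} {mn : (m <= n)%N} (n_gt0 : (0 < n)%N) (m_gt0 : (0 < m)%N).
Notation Z := (varifold_space R mn).
Context (V : {measure set (borel Z) -> \bar R}) (vV : varifold V) (sV : stationary V)
  (iV : integral_varifold V).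
Implicit Types (A B C : set 'rV[R]_n) (x y a : 'rV[R]_n) (r : R) (S : grass R mn).

Definition mass A : R := fine (V (cylinder A)).

Lemma mass_ge0 A : 0 <= mass A.
Proof. exact: fine_ge0 (measure_ge0 _ _). Qed.

Lemma massE A a r : measurable (A : set (borel 'rV[R]_n)) -> A `<=` eball a r ->
  V (cylinder A) = (mass A)%:E.
Proof.
move=> mA Ar; rewrite fineK// ge0_fin_numE ?measure_ge0//.
apply: le_lt_trans (cylinder_ball_fin vV a r).
by apply: weight_le => //; exact: measurable_eball.
Qed.

Lemma mass_eballE a r : V (cylinder (eball a r)) = (mass (eball a r))%:E.
Proof. by apply: (@massE _ a r); [exact: measurable_eball|]. Qed.

Lemma le_mass A B a r : measurable (A : set (borel 'rV[R]_n)) ->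
  measurable (B : set (borel 'rV[R]_n)) -> A `<=` B -> B `<=` eball a r ->
  mass A <= mass B.
Proof.
move=> mA mB AB Br; rewrite -lee_fin -(massE mB Br) -(massE mA (subset_trans AB Br)).
exact: weight_le.
Qed.

Lemma le_mass_eball x r a t : eball x r `<=` eball a t ->
  mass (eball x r) <= mass (eball a t).
Proof. by move=> h; apply: (@le_mass _ _ a t) => //; exact: measurable_eball. Qed.

Lemma integral_indic_cylinder (k : R) A : measurable (A : set (borel 'rV[R]_n)) ->
  0 <= k -> (\int[V]_z (k * \1_A z.1)%:E = k%:E * V (cylinder A))%E.
Proof.
move=> mA k0; have mc := measurable_cylinder (mn := mn) mA.
have <- : (\int[V]_z (\1_(cylinder A) z)%:E)%E = V (cylinder A).
  by rewrite integral_indic// setIT.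
rewrite -ge0_integralZl_EFin//.
by apply/measurable_EFinP; exact: measurable_indic.
Qed.

Lemma le_integral_support (f g : Z -> R) :
  measurable_fun setT (f : borel Z -> R) -> measurable_fun setT (g : borel Z -> R) ->
  (forall z, 0 <= f z) -> (forall z, 0 <= g z) ->
  (forall z, weight_support V z.1 -> f z <= g z) ->
  (\int[V]_z (f z)%:E <= \int[V]_z (g z)%:E)%E.
Proof.
move=> mf mg f0 g0 fg; apply: ae_ge0_le_integral; [exact: measurableT|..].
- by move=> z _; rewrite lee_fin.
- exact/measurable_EFinP.
- by move=> z _; rewrite lee_fin.
- exact/measurable_EFinP.
exists (cylinder (~` weight_support V)); split.
- by apply: measurable_cylinder; apply: open_borel; exact: open_weight_support_compl.
- exact: weight_support_null.
by move=> z /= h sz; apply: h => _; rewrite lee_fin fg.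
Qed.

(** The density [gauge_const / 2] of a dense point, carried from small radii to r/2 by
    [mass_almost_monotone]; the factor 2^m converts (r/2)^m to r^m. *)
Definition mass_const : R :=
  radial_lower m * (@gauge_const R m / 2) / (radial_upper m * 2 ^+ m).

Lemma mass_const_gt0 : 0 < mass_const.
Proof.
have lo0 : 0 < radial_lower m :> R by exact: radial_lower_gt0.
have up0 : 0 < radial_upper m :> R by exact: radial_upper_gt0.
have g0 : 0 < @gauge_const R m by exact: gauge_const_gt0.
by rewrite /mass_const pmulr_lgt0 ?invr_gt0; apply: mulr_gt0 => //; rewrite ?exprn_gt0// divr_gt0.
Qed.

Lemma mass_almost_monotone a (rho r : R) : 0 < rho -> rho <= r / 2 ->
  radial_lower m / rho ^+ m * mass (eball a rho) <=
  radial_upper m / r ^+ m * mass (eball a r).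
Proof.
move=> rho0 rhor; have r0 : 0 < r by have := lt_le_trans rho0 rhor; rewrite pmulr_lgt0.
have T0 : (0 : 'M[R]_n)^T = 0 by exact: trmx0.
have M0 : (0 : 'M[R]_n) *m (0 : 'M[R]_n) = 0 by rewrite mul0mx.
have := mean_value_inequality m_gt0 vV sV a T0 M0 ler01 rho0 rhor.
have q1 (x : 'rV[R]_n) : qform 1 0 x = 1 by rewrite /qform mulmx0 dotpE mul0mx mxE addr0.
under eq_integral do rewrite q1 mulr1.
under [X in (_ <= X)%E -> _]eq_integral do rewrite q1 mulr1.
have mB := measurable_eball a.
have L0 : 0 <= radial_lower m / rho ^+ m.
  by rewrite divr_ge0 ?exprn_ge0 ?(ltW rho0)//; apply: ltW; exact: radial_lower_gt0.
have U0 : 0 <= radial_upper m / r ^+ m.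
  by rewrite divr_ge0 ?exprn_ge0 ?(ltW r0)//; apply: ltW; exact: radial_upper_gt0.
rewrite (integral_indic_cylinder (mB rho) L0) (integral_indic_cylinder (mB r) U0).
by rewrite !mass_eballE -!EFinM lee_fin.
Qed.

(** The lower density bound holds at points [y] arbitrarily near [a], not necessarily at [a]. Almost
    monotonicity is applied at such a [y], and the ball of radius r/2 about it lies in the ball of
    radius r about [a]. *)
Lemma mass_lower a r : weight_support V a -> 0 < r ->
  mass_const * r ^+ m <= mass (eball a r).
Proof.
move=> sa r0; pose U := [set x | enorm (x - a) < r / 2].
have oU : open U by exact: (@open_eball R n).
have Ua : U a by rewrite /U/= subrr enorm0 divr_gt0.
have [y Uy hy] := exists_dense_point n_gt0 m_gt0 vV iV oU (weight_support_open sa oU Ua).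
have r4 : 0 < r / 4 by rewrite divr_gt0.
have [rho /andP[rho0 rhor]] := hy _ r4.
rewrite mass_eballE lte_fin => hrho.
have rho2 : rho <= r / 2 / 2 by apply: ltW; lra.
have h1 := mass_almost_monotone y rho0 rho2.
have h2 : mass (eball y (r / 2)) <= mass (eball a r).
  apply: le_mass_eball => z; move: Uy; rewrite /eball/U/=.
  have := enorm_triangle z y a; lra.
have lo0 : 0 < radial_lower m :> R by exact: radial_lower_gt0.
have up0 : 0 < radial_upper m :> R by exact: radial_upper_gt0.
have upm0 : 0 < radial_upper m * 2 ^+ m :> R by rewrite pmulr_rgt0// exprn_gt0.
rewrite /mass_const mulrAC ler_pdivrMr//.
apply: (@le_trans _ _ (r ^+ m * (radial_lower m / rho ^+ m * mass (eball y rho)))).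
  rewrite mulrC ler_wpM2l ?exprn_ge0 ?(ltW r0)//.
  by rewrite -[leRHS]mulrA ler_wpM2l ?(ltW lo0)// [leRHS]mulrC ler_pdivlMr ?exprn_gt0// ltW.
apply: (@le_trans _ _ (r ^+ m * (radial_upper m / (r / 2) ^+ m * mass (eball y (r / 2))))).
  by rewrite ler_wpM2l ?exprn_ge0 ?(ltW r0).
rewrite (_ : _ * (_ * _) = mass (eball y (r / 2)) * (radial_upper m * 2 ^+ m)).
  by rewrite ler_wpM2r// ltW.
rewrite expr_div_n; field.
by rewrite !expf_neq0 ?gt_eqF.
Qed.

(** The squared distance from [x] to [S]; hence the doubled exponents where the distance itself must
    be small. *)
Definition height S x : R := dotp (x *m normal_mx S) (x *m normal_mx S).

Lemma height_ge0 S x : 0 <= height S x.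
Proof. exact: dotp_ge0. Qed.

Lemma continuous_height S : continuous (height S).
Proof.
rewrite (_ : height S = (fun x => enorm (x *m normal_mx S) * enorm (x *m normal_mx S))).
  by apply: continuous_mulR; exact: continuous_enorm_mul.
by apply/funext => y; rewrite -expr2 sqr_enorm.
Qed.

Lemma height_le S a x : a \in grass_vspace S -> height S x <= dotp (x - a) (x - a).
Proof.
rewrite -normal_mx_eq0 => /eqP aS.
rewrite (_ : height S x = dotp ((x - a) *m normal_mx S) ((x - a) *m normal_mx S)).
  exact: enorm_proj_le (normal_mx_idem S) (normal_mx_sym S).
by rewrite mulmxBl aS subr0.
Qed.

Lemma height_eq0 S x : (height S x == 0) = (x \in grass_vspace S).
Proof. by rewrite dotp_eq0 normal_mx_eq0. Qed.

Definition plane S : set 'rV[R]_n := [set x | x \in grass_vspace S].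

Lemma closed_plane S : closed (plane S).
Proof.
rewrite (_ : plane S = height S @^-1` [set t | t <= 0]).
  by apply: preimage_closed; [move=> x _; exact: continuous_height|exact: closed_le].
apply/seteqP; split => x; rewrite /plane/= -height_eq0; first by move=> /eqP ->.
by move=> h; rewrite eq_le h height_ge0.
Qed.

Lemma measurable_off_plane S x r :
  measurable (eball x r `\` plane S : set (borel 'rV[R]_n)).
Proof.
apply: measurableD; first exact: measurable_eball.
by apply: closed_borel; exact: closed_plane.
Qed.

Definition height_const : R := radial_upper m / (radial_lower m * mass_const).

Lemma height_const_gt0 : 0 < height_const.
Proof.
have lo0 : 0 < radial_lower m :> R by exact: radial_lower_gt0.
have up0 : 0 < radial_upper m :> R by exact: radial_upper_gt0.
by rewrite /height_const divr_gt0// mulr_gt0// mass_const_gt0.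
Qed.

(** In the sub-mean-value inequality for the height, the right side sees only points off the plane,
    where the height is at most [H]. On the left, for [t] below the height of [x], a ball about [x]
    is taken so small that the height is at least [t] on it; by [mass_lower] the powers of its
    radius cancel. *)
Lemma height_sup_estimate S x r (H : R) : weight_support V x -> 0 < r -> 0 <= H ->
  (forall y, weight_support V y -> eball x r y -> height S y <= H) ->
  height S x <= height_const * H * (mass (eball x r `\` plane S) / r ^+ m).
Proof.
move=> sx r0 H0 hH; set D := mass _.
have lo0 : 0 < radial_lower m :> R by exact: radial_lower_gt0.
have up0 : 0 < radial_upper m :> R by exact: radial_upper_gt0.
have rm0 : 0 < r ^+ m by rewrite exprn_gt0.
suff key (t : R) : 0 <= t -> t < height S x ->
    radial_lower m * mass_const * t <= radial_upper m / r ^+ m * H * D.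
  rewrite leNgt; apply/negP; set B := height_const * H * _ => Bh.
  have B0 : 0 <= B.
    apply: mulr_ge0; last by apply: divr_ge0; [exact: mass_ge0|exact: ltW].
    by apply: mulr_ge0 => //; apply: ltW; exact: height_const_gt0.
  have t0 : 0 <= (B + height S x) / 2 by lra.
  have th : (B + height S x) / 2 < height S x by lra.
  have mc0 := mass_const_gt0.
  have lm0 : 0 < radial_lower m * mass_const by rewrite pmulr_rgt0.
  have := key _ t0 th; rewrite mulrC -ler_pdivlMr//.
  rewrite [leRHS](_ : _ = B); first by lra.
  by rewrite /B /height_const; field; rewrite !gt_eqF.
move=> t0 th.
have [d d0 dh] : exists2 d : R, 0 < d & forall y, eball x d y -> t <= height S y.
  have oT : open [set y | t < height S y].
    rewrite (_ : [set y | _] = height S @^-1` [set s | t < s])//.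
    by apply: open_comp; [move=> y _; exact: continuous_height|exact: open_gt].
  have [d d0 hd] := open_eballP oT th.
  by exists d => // y /hd /ltW.
pose rho := Num.min d (r / 2).
have rho0 : 0 < rho by rewrite lt_min d0 divr_gt0.
have rhod : rho <= d by rewrite /rho ge_min lexx.
have rhor : rho <= r / 2 by rewrite /rho ge_min lexx orbT.
have mv := mean_value_inequality m_gt0 vV sV x (normal_mx_sym S) (normal_mx_idem S) (lexx 0) rho0 rhor.
have qE (y : 'rV[R]_n) : qform 0 (normal_mx S) y = height S y.
  by rewrite /qform add0r /height [RHS]dotp_mulmx normal_mx_sym -mulmxA normal_mx_idem dotpC.
move: mv; under eq_integral do rewrite qE.
under [X in (_ <= X)%E -> _]eq_integral do rewrite qE.
move=> mv.
have mh : measurable_fun setT (fun z : borel Z => height S z.1).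
  by apply: measurable_base; exact: continuous_height.
have mf (k : R) A : measurable (A : set (borel 'rV[R]_n)) ->
    measurable_fun setT (fun z : borel Z => k * \1_A z.1 : R).
  move=> mA; apply: measurable_funM => //; apply: measurable_indic_cylinder.
  exact: measurable_cylinder.
have mg (k : R) A : measurable (A : set (borel 'rV[R]_n)) ->
    measurable_fun setT (fun z : borel Z => k * (\1_A z.1 * height S z.1) : R).
  move=> mA; apply: measurable_funM => //; apply: measurable_funM => //.
  by apply: measurable_indic_cylinder; exact: measurable_cylinder.
have L0 : 0 <= radial_lower m / rho ^+ m by rewrite divr_ge0// ltW ?exprn_gt0.
have U0 : 0 <= radial_upper m / r ^+ m by rewrite divr_ge0// ltW.
have i0 (A : set 'rV[R]_n) y : 0 <= \1_A y :> R by rewrite indicE.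
have mB := measurable_eball x rho.
have mBr := measurable_eball x r.
have mC := measurable_off_plane S x r.
have lower : ((radial_lower m * mass_const * t)%:E <=
    \int[V]_z (radial_lower m / rho ^+ m * (\1_(eball x rho) z.1 * height S z.1))%:E)%E.
  apply: (@le_trans _ _ (\int[V]_z (radial_lower m / rho ^+ m * t * \1_(eball x rho) z.1)%:E)%E).
    rewrite (integral_indic_cylinder mB (mulr_ge0 L0 t0)).
    rewrite mass_eballE -EFinM lee_fin.
    have := ler_wpM2l (mulr_ge0 L0 t0) (mass_lower sx rho0).
    apply: le_trans; rewrite le_eqVlt; apply/orP; left; apply/eqP; field.
    by rewrite expf_neq0// gt_eqF.
  apply: (@le_integral_support
    (fun z => radial_lower m / rho ^+ m * t * \1_(eball x rho) z.1)
    (fun z => radial_lower m / rho ^+ m * (\1_(eball x rho) z.1 * height S z.1)));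
    [exact: mf|exact: mg| | |].
  - by move=> z; exact: mulr_ge0 (mulr_ge0 L0 t0) _.
  - by move=> z; exact: mulr_ge0 L0 (mulr_ge0 _ (height_ge0 _ _)).
  move=> z _; rewrite -mulrA ler_wpM2l// indicE.
  case: (boolP (z.1 \in eball x rho)) => [|_]; last by rewrite mulr0 mul0r.
  rewrite inE mulr1 mul1r => zx; apply: dh.
  by move: zx; rewrite /eball/= => /le_trans; apply.
rewrite -lee_fin; apply: le_trans lower (le_trans mv _).
apply: (@le_trans _ _ (\int[V]_z (radial_upper m / r ^+ m * H * \1_(eball x r `\` plane S) z.1)%:E)%E).
  apply: (@le_integral_support
    (fun z => radial_upper m / r ^+ m * (\1_(eball x r) z.1 * height S z.1))
    (fun z => radial_upper m / r ^+ m * H * \1_(eball x r `\` plane S) z.1));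
    [exact: mg|exact: mf| | |].
  - by move=> z; exact: mulr_ge0 U0 (mulr_ge0 _ (height_ge0 _ _)).
  - by move=> z; exact: mulr_ge0 (mulr_ge0 U0 H0) _.
  move=> z sz; rewrite -[leRHS]mulrA ler_wpM2l// !indicE.
  case: (boolP (z.1 \in eball x r)) => [|_]; last by rewrite mul0r mulr_ge0.
  rewrite inE mul1r => zx.
  have [zS|zS] := pselect (plane S z.1).
    by move: zS; rewrite /plane/= -height_eq0 => /eqP ->; rewrite mulr_ge0.
  by rewrite mem_set// mulr1 hH.
rewrite (integral_indic_cylinder mC (mulr_ge0 U0 H0)) (@massE _ x r)// => y [].
Qed.

Definition sparse_off S a : Prop := forall e : R, 0 < e ->
  exists2 d : R, 0 < d & forall r, 0 < r -> r < d ->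
    mass (eball a r `\` plane S) <= e * r ^+ m.

(** Halving the radius multiplies the supremum of the height by at most [q], where [q] can be
    prescribed because the density of the weight off the plane is 0. *)
Lemma height_decay S a : plane S a -> sparse_off S a -> forall N : nat,
  exists2 d : R, 0 < d & forall r, 0 < r -> r < d ->
    forall y, weight_support V y -> eball a r y -> height S y <= r ^+ N.
Proof.
move=> Sa spa N.
have hc0 := height_const_gt0.
(* One power more than claimed, to absorb the constant produced by the iteration. *)
pose q : R := 2 ^- N.+1.
have q0 : 0 < q by rewrite invr_gt0 exprn_gt0.
(* The factor 2^m accounts for bounding the weight off the plane in a ball of radius r by that in
   the ball of radius 2 r about [a]. *)
pose e := q / (height_const * 2 ^+ m).
have e0 : 0 < e by rewrite divr_gt0// mulr_gt0// exprn_gt0.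
have [d0 d00 hd0] := spa e e0.
have step r (H : R) : 0 < r -> 2 * r < d0 -> 0 <= H ->
    (forall y, weight_support V y -> eball a (2 * r) y -> height S y <= H) ->
    forall y, weight_support V y -> eball a r y -> height S y <= q * H.
  move=> r0 rd H0 hH y sy ay.
  have sub : eball y r `<=` eball a (2 * r).
    by move=> z; move: ay; rewrite /eball/=; have := enorm_triangle z y a; lra.
  have := height_sup_estimate sy r0 H0 (fun x sx yx => hH x sx (sub _ yx)).
  move=> /le_trans; apply.
  have h2 : mass (eball y r `\` plane S) <= e * (2 * r) ^+ m.
    apply: le_trans (hd0 (2 * r) _ rd); last by rewrite mulr_gt0.
    apply: (@le_mass _ _ a (2 * r)).
    - exact: measurable_off_plane.
    - exact: measurable_off_plane.
    - by move=> z [/sub].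
    - by move=> z [].
  rewrite [leRHS]mulrC -mulrA mulrCA ler_wpM2l//.
  rewrite mulrA ler_pdivrMr ?exprn_gt0//.
  apply: (@le_trans _ _ (height_const * (e * (2 * r) ^+ m))).
    by rewrite ler_wpM2l// ltW.
  rewrite le_eqVlt; apply/orP; left; apply/eqP; rewrite /e exprMn; field.
  by rewrite expf_neq0 ?gt_eqF.
pose r0 := Num.min 1 (d0 / 2).
have r00 : 0 < r0 by rewrite lt_min ltr01 divr_gt0.
have r01 : r0 <= 1 by rewrite /r0 ge_min lexx.
have r0d : r0 <= d0 / 2 by rewrite /r0 ge_min lexx orbT.
(* Induction on the number of doublings that lead from [r] up to [r0]; at the top scale the height
   is at most 1 because [r0 <= 1]. *)
have iter (j : nat) : forall r, 0 < r -> r <= r0 -> r0 <= 2 ^+ j * r ->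
    forall y, weight_support V y -> eball a r y -> height S y <= (2 * r / r0) ^+ N.+1.
  have base r : 0 < r -> r <= r0 -> r0 / 2 <= r ->
      forall y, weight_support V y -> eball a r y -> height S y <= (2 * r / r0) ^+ N.+1.
    move=> rp rr0 r0r y sy ay; apply: (@le_trans _ _ 1).
      apply: le_trans (height_le y Sa) _; rewrite -[1](expr1n _ 2) -enorm_le_sqr//.
      by apply: le_trans ay _; apply: le_trans r01.
    by rewrite exprn_ege1// ler_pdivlMr//; lra.
  elim: j => [|j IH] r rp rr0 hr; first by apply: base => //; rewrite expr0 mul1r in hr; lra.
  have [|r2] := leP (r0 / 2) r; first exact: base.
  have rr : 2 * r <= r0 by lra.
  have q2 : q * (2 * (2 * r) / r0) ^+ N.+1 = (2 * r / r0) ^+ N.+1.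
    rewrite /q -exprVn -exprMn; congr (_ ^+ _); field.
    by rewrite gt_eqF.
  rewrite -q2; apply: step => //; first by lra.
    by rewrite exprn_ge0// divr_ge0 ?mulr_ge0 ?ltW.
  apply: IH => //; first by rewrite mulr_gt0.
  by rewrite mulrA -exprSr.
(* The iterated bound is [r ^+ N * (r / s)], hence at most [r ^+ N] for [r <= s]. *)
pose s := (r0 / 2) ^+ N.+1.
have s0 : 0 < s by rewrite exprn_gt0// divr_gt0.
exists (Num.min r0 s); first by rewrite lt_min r00.
move=> r rp; rewrite lt_min => /andP[/ltW rr0 /ltW rs] y sy ay.
have [j hj] : exists j, r0 <= 2 ^+ j * r.
  exists (Num.bound (r0 / r)); rewrite -ler_pdivrMr//.
  have rr : 0 <= r0 / r by rewrite divr_ge0 ?ltW.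
  apply: le_trans (ltW (archi_boundP rr)) _; rewrite -natrX ler_nat ltnW//.
  exact: ltn_expl.
apply: le_trans (iter j r rp rr0 hj y sy ay) _.
rewrite (_ : (2 * r / r0) ^+ N.+1 = r ^+ N * (r / s)).
  by rewrite ler_piMr ?exprn_ge0 ?(ltW rp)// ler_pdivrMr// mul1r.
rewrite /s !expr_div_n exprMn [X in _ = _ * (X / _)](_ : r = r ^+ N.+1 / r ^+ N).
  field; rewrite !expf_neq0 ?gt_eqF//.
by rewrite exprS mulfK// expf_neq0// gt_eqF.
Qed.

End Decay.

(** * Absence of holes in the support along the plane *)

Section NoHoles.
Context {R : realType} {m n : nat} {mn : (m <= n)%N} (n_gt0 : (0 < n)%N) (m_gt0 : (0 < m)%N).
Notation Z := (varifold_space R mn).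
Context (V : {measure set (borel Z) -> \bar R}) (vV : varifold V) (sV : stationary V)
  (iV : integral_varifold V).
Implicit Types (A B C : set 'rV[R]_n) (x y a : 'rV[R]_n) (r : R) (S : grass R mn).

Lemma measurable_indic_tilt S a r :
  measurable_fun setT (fun z : borel Z => \1_(eball a r) z.1 * tilt S z : R).
Proof.
apply: measurable_funM; last exact: measurable_tr.
by apply: measurable_indic_cylinder; exact: measurable_eball_cylinder.
Qed.

Lemma tilt_small S a r (h : R) : 0 < r -> 0 <= h ->
  (forall y, weight_support V y -> eball a (2 * r) y -> enorm (y *m normal_mx S) <= h) ->
  (\int[V]_z (\1_(eball a r) z.1 * tilt S z)%:E <=
   (48 / r * h * mass V (eball a (2 * r)) / psi 0 1)%:E)%E.
Proof.
move=> r0 h0 hh; have p0 : 0 < psi 0 1 :> R by exact: psi_gt0.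
have k0 : 0 <= 48 / r by rewrite divr_ge0 ?(ltW r0).
have i0 (A : set 'rV[R]_n) y : 0 <= \1_A y :> R by rewrite indicE.
have := tilt_estimate a vV sV (normal_mx_sym S) (normal_mx_idem S) r0.
under eq_integral do rewrite EFinM.
rewrite ge0_integralZl_EFin//; first last.
- exact: ltW.
- by apply/measurable_EFinP; exact: measurable_indic_tilt.
- by move=> z _; rewrite lee_fin mulr_ge0// tilt_ge0.
rewrite -lee_pdivlMl// => /le_trans; apply.
rewrite [leRHS]EFinM [leRHS]muleC lee_pmul2l ?lte_fin ?invr_gt0//.
rewrite [leRHS]EFinM -(mass_eballE vV) -(integral_indic_cylinder _ (measurable_eball a (2 * r)) (mulr_ge0 k0 h0)).
apply: (@le_integral_support _ _ _ _ n_gt0 V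
  (fun z => 48 / r * (\1_(eball a (2 * r)) z.1 * enorm (z.1 *m normal_mx S)))
  (fun z => 48 / r * h * \1_(eball a (2 * r)) z.1)).
- apply: measurable_funM => //; apply: measurable_funM.
    by apply: measurable_indic_cylinder; exact: measurable_eball_cylinder.
  apply: (measurable_base (f := fun x => enorm (x *m normal_mx S))).
  exact: continuous_enorm_mul.
- apply: measurable_funM => //.
  by apply: measurable_indic_cylinder; exact: measurable_eball_cylinder.
- by move=> z; exact: mulr_ge0 k0 (mulr_ge0 _ (enorm_ge0 _)).
- by move=> z; exact: mulr_ge0 (mulr_ge0 k0 h0) _.
move=> z sz; rewrite -[leRHS]mulrA ler_wpM2l// !indicE.
case: (boolP (z.1 \in eball a (2 * r))) => [|_]; last by rewrite mul0r mulr0.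
by rewrite inE mul1r mulr1; exact: hh.
Qed.

(** [hole_estimate] at radius 4 r about [s]: the ball of radius 2 r about [s] contains that of
    radius r about [a], whence the left side; the ball of radius 4 r lies in that of radius 5 r
    about [a], where the tilt is controlled by the height on radius 10 r. As h <= 1, also the
    squared height is at most h. *)
Lemma hole_bound S a s r (rho h e : R) : (2 <= m)%N -> weight_support V a ->
  s \in grass_vspace S -> eball a r s -> 0 < r -> 0 <= h -> h <= 1 ->
  0 < e -> e <= rho -> rho <= r -> 10 * r <= 1 ->
  (forall y, weight_support V y -> eball a (10 * r) y -> enorm (y *m normal_mx S) <= h) ->
  V [set z | enorm (z.1 - s) < rho] = 0%E ->
  cutoff_height * @mass_const R m / 4 ^+ m <=
  mass V (eball a 1) * (m%:R * e ^+ 2 / rho ^+ m.+2 +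
    (2 * m%:R + 24) / rho ^+ m.+2 * (h * (1 + 160 / psi 0 1))).
Proof.
move=> m2 sa sS asr r0 h0 h1 e0 erho rhor r1 hh V0.
have p0 : 0 < psi 0 1 :> R by exact: psi_gt0.
have rho0 : 0 < rho by exact: lt_le_trans erho.
have rho4 : rho <= 4 * r by lra.
have := hole_estimate m2 vV sV sS e0 erho rho4 V0.
set K1 := m%:R * e ^+ 2 / _; set K2 := (2 * m%:R + 24) / _ => est.
have rhom0 : 0 <= rho ^+ m.+2 by rewrite exprn_ge0 ?(ltW rho0).
have K10 : 0 <= K1.
  by apply: divr_ge0 => //; apply: mulr_ge0; [exact: ler0n|exact: sqr_ge0].
have K20 : 0 <= K2 by apply: divr_ge0.
have i0 (A : set 'rV[R]_n) y : 0 <= \1_A y :> R by rewrite indicE.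
have ch0 : 0 < cutoff_height :> R by exact: cutoff_height_gt0.
have r40 : 0 < 4 * r by rewrite mulr_gt0.
have mu0 := mass_ge0 V.
have lower : ((cutoff_height * @mass_const R m / 4 ^+ m)%:E <=
    \int[V]_z (cutoff_height / (4 * r) ^+ m * \1_(eball s (4 * r / 2)) z.1)%:E)%E.
  have k0 : 0 <= cutoff_height / (4 * r) ^+ m.
    by rewrite divr_ge0 ?exprn_ge0 ?(ltW ch0) ?(ltW r40).
  rewrite (integral_indic_cylinder _ (measurable_eball s (4 * r / 2)) k0).
  rewrite mass_eballE// -EFinM lee_fin.
  have le1 : @mass_const R m * r ^+ m <= mass V (eball s (4 * r / 2)).
    apply: le_trans (mass_lower n_gt0 m_gt0 vV sV iV sa r0) _.
    apply: le_mass_eball => // z; move: asr; rewrite /eball/=.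
    have := enorm_triangle z a s; rewrite (enormB a s); lra.
  apply: le_trans (ler_wpM2l k0 le1); rewrite le_eqVlt; apply/orP; left; apply/eqP.
  by rewrite exprMn; field; rewrite !expf_neq0// gt_eqF.
have sub5 : eball s (4 * r) `<=` eball a (5 * r).
  move=> z; move: asr; rewrite /eball/=; have := enorm_triangle z s a; lra.
have r50 : 0 < 5 * r by rewrite mulr_gt0.
have ts : (\int[V]_z (\1_(eball a (5 * r)) z.1 * tilt S z)%:E <=
    (48 / (5 * r) * h * mass V (eball a (10 * r)) / psi 0 1)%:E)%E.
  have e10 : 2 * (5 * r) = 10 * r by ring.
  by rewrite -e10; apply: tilt_small => //; rewrite e10.
pose f1 (z : Z) : R := (K1 + K2 * h) * \1_(eball a (5 * r)) z.1.
pose f2 (z : Z) : R := K2 * 16 * r ^+ 2 * (\1_(eball a (5 * r)) z.1 * tilt S z).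
have f10 z : 0 <= f1 z by exact: mulr_ge0 (addr_ge0 K10 (mulr_ge0 K20 h0)) _.
have K30 : 0 <= K2 * 16 * r ^+ 2 by rewrite mulr_ge0 ?exprn_ge0 ?(ltW r0)// mulr_ge0.
have f20 z : 0 <= f2 z by exact: mulr_ge0 K30 (mulr_ge0 _ (tilt_ge0 _ _)).
have mi x t : measurable_fun setT (fun z : borel Z => \1_(eball x t) z.1 : R).
  by apply: measurable_indic_cylinder; exact: measurable_eball_cylinder.
have mf1 : measurable_fun setT (f1 : borel Z -> R) by exact: measurable_funM.
have mf2 : measurable_fun setT (f2 : borel Z -> R).
  by apply: measurable_funM => //; exact: measurable_indic_tilt.
have upper : (\int[V]_z (\1_(eball s (4 * r)) z.1 * (K1 + K2 *
     ((4 * r) ^+ 2 * tilt S z + dotp (z.1 *m normal_mx S) (z.1 *m normal_mx S))))%:E <=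
   \int[V]_z ((f1 z)%:E + (f2 z)%:E))%E.
  under [X in (_ <= X)%E]eq_integral do rewrite -EFinD.
  apply: (@le_integral_support _ _ _ _ n_gt0 V
    (fun z => \1_(eball s (4 * r)) z.1 * (K1 + K2 *
     ((4 * r) ^+ 2 * tilt S z + height S z.1))) (fun z => f1 z + f2 z)).
  - apply: measurable_funM => //; apply: measurable_funD => //.
    apply: measurable_funM => //; apply: measurable_funD.
      by apply: measurable_funM => //; exact: measurable_tr.
    by apply: (measurable_base (f := height S)); exact: continuous_height.
  - exact: measurable_funD.
  - move=> z; apply: mulr_ge0 => //; apply: addr_ge0 => //; apply: mulr_ge0 => //.
    apply: addr_ge0; last exact: height_ge0.
    by apply: mulr_ge0; [rewrite exprn_ge0 ?(ltW r40)|exact: tilt_ge0].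
  - by move=> z; rewrite addr_ge0.
  move=> z sz; rewrite [X in X * _]indicE.
  case: (boolP (z.1 \in eball s (4 * r))) => [|_]; last by rewrite mul0r addr_ge0.
  rewrite inE mul1r => /sub5 z5.
  rewrite /f1 /f2 indicE mem_set// mulr1 mul1r.
  have hz : height S z.1 <= h.
    apply: (@le_trans _ _ (h ^+ 2)).
      rewrite /height -enorm_le_sqr//; apply: hh => //.
      by move: z5; rewrite /eball/=; lra.
    by rewrite expr2 ler_piMl.
  have := ler_wpM2l K20 hz; rewrite exprMn; lra.
have f1I : (\int[V]_z (f1 z)%:E = ((K1 + K2 * h) * mass V (eball a (5 * r)))%:E)%E.
  have k0 := addr_ge0 K10 (mulr_ge0 K20 h0).
  by rewrite /f1 (integral_indic_cylinder _ (measurable_eball a (5 * r)) k0) (mass_eballE vV).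
have f2I : (\int[V]_z (f2 z)%:E <=
    (K2 * 16 * r ^+ 2 * (48 / (5 * r) * h * mass V (eball a (10 * r)) / psi 0 1))%:E)%E.
  rewrite /f2; under eq_integral do rewrite EFinM.
  rewrite ge0_integralZl_EFin//; first last.
  - by apply/measurable_EFinP; exact: measurable_indic_tilt.
  - by move=> z _; rewrite lee_fin mulr_ge0// tilt_ge0.
  by rewrite [leRHS]EFinM lee_wpmul2l// lee_fin.
have le5 : mass V (eball a (5 * r)) <= mass V (eball a 1).
  by apply: le_mass_eball => // z; rewrite /eball/=; lra.
have le10 : mass V (eball a (10 * r)) <= mass V (eball a 1).
  by apply: le_mass_eball => // z; rewrite /eball/=; lra.
have := le_trans lower (le_trans est upper).
rewrite ge0_integralD//; last 4 first.
- by move=> z _; rewrite lee_fin.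
- exact/measurable_EFinP.
- by move=> z _; rewrite lee_fin.
- exact/measurable_EFinP.
rewrite f1I => /le_trans/(_ (leeD2l _ f2I)); rewrite -EFinD lee_fin => /le_trans; apply.
set mu := mass V (eball a 1) in le5 le10 *.
apply: (@le_trans _ _ ((K1 + K2 * h) * mu + K2 * h * (160 / psi 0 1) * mu)); last by lra.
apply: lerD; first exact: ler_wpM2l (addr_ge0 K10 (mulr_ge0 K20 h0)) _ _ le5.
rewrite (_ : _ * _ = (K2 * h * (768 / 5 * r / psi 0 1)) * mass V (eball a (10 * r))); last first.
  by field; rewrite !gt_eqF.
have c1 : 768 / 5 * r / psi 0 1 <= 160 / psi 0 1 by rewrite ler_pM2r ?invr_gt0//; lra.
have c0 : 0 <= 160 / psi 0 1 :> R by rewrite divr_ge0// ltW.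
have Kh0 : 0 <= K2 * h by exact: mulr_ge0.
exact: le_trans (ler_wpM2r (mu0 _) (ler_wpM2l Kh0 c1)) (ler_wpM2l (mulr_ge0 Kh0 c0) le10).
Qed.

(** A hole of radius r^k costs the factor r^-(k (m+2)), but height and tilt decay faster. So a fixed
    positive number would be at most [M * r], which fails for small r. *)
Lemma no_holes S a : (2 <= m)%N -> weight_support V a -> plane S a ->
  sparse_off V S a -> forall k : nat, (0 < k)%N ->
  exists2 d : R, 0 < d & forall r, 0 < r -> r < d ->
    forall s, plane S s -> eball a r s -> exists2 y, weight_support V y & enorm (y - s) <= r ^+ k.
Proof.
move=> m2 sa Sa spa k k0.
(* One more than the exponent lost to the hole, so that a factor r remains. *)
pose N := (k * m.+2).+1.
have [d0 d00 hd0] := height_decay n_gt0 m_gt0 vV sV iV Sa spa (N * 2).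
have p0 : 0 < psi 0 1 :> R by exact: psi_gt0.
have ch0 : 0 < cutoff_height :> R by exact: cutoff_height_gt0.
pose L := (cutoff_height * @mass_const R m / 4 ^+ m) : R.
have L0 : 0 < L by rewrite divr_gt0 ?exprn_gt0// mulr_gt0// mass_const_gt0.
set mu := mass V (eball a 1).
have mu0 : 0 <= mu by exact: mass_ge0.
pose M := mu * ((2 * m%:R + 24) * 10 ^+ N * (1 + 160 / psi 0 1)).
have M0 : 0 <= M.
  have c0 : 0 <= 1 + 160 / psi 0 1 :> R by rewrite addr_ge0// divr_ge0// ltW.
  have c1 : 0 <= 2 * m%:R + 24 :> R by rewrite addr_ge0// mulr_ge0.
  have c2 : 0 <= 10 ^+ N :> R by rewrite exprn_ge0.
  exact: mulr_ge0 mu0 (mulr_ge0 (mulr_ge0 c1 c2) c0).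
have M10 : 0 < M + 1 by rewrite ltr_wpDl.
pose d := Num.min (1 / 10) (Num.min (d0 / 10) (L / (M + 1))).
have d_gt0 : 0 < d by rewrite !lt_min; apply/and3P; split; exact: divr_gt0.
exists d => // r r0; rewrite !lt_min => /andP[r1 /andP[rd rL]] s Ss asr.
apply: contrapT => hole.
have rk0 : 0 < r ^+ k by rewrite exprn_gt0.
have V0 : V [set z | enorm (z.1 - s) < r ^+ k] = 0%E.
  apply/eqP; rewrite eq_le measure_ge0 andbT -[leRHS](weight_support_null n_gt0 V).
  apply: (@weight_le _ _ _ _ V [set x | enorm (x - s) < r ^+ k] (~` weight_support V)).
  - by apply: open_borel; exact: (@open_eball R n).
  - by apply: open_borel; exact: open_weight_support_compl.
  - by move=> x /= xs sx; apply: hole; exists x => //; exact: ltW.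
pose h := (10 * r) ^+ N.
have r100 : 0 <= 10 * r by rewrite mulr_ge0 ?(ltW r0).
have h0 : 0 <= h by rewrite exprn_ge0.
have h1 : h <= 1 by rewrite exprn_ile1//; lra.
have rkr : r ^+ k <= r.
  by rewrite -[leRHS]expr1 ler_wiXn2l//; [exact: ltW|lra].
have hh y : weight_support V y -> eball a (10 * r) y -> enorm (y *m normal_mx S) <= h.
  move=> sy ay; rewrite enorm_le_sqr// /h -exprM.
  by apply: (hd0 (10 * r)) => //; lra.
have key (e : R) : 0 < e -> e <= r ^+ k -> L <= mu * (m%:R * e ^+ 2 / (r ^+ k) ^+ m.+2) + M * r.
  move=> e0 ek.
  have r10 : 10 * r <= 1 by lra.
  have := hole_bound m2 sa Ss asr r0 h0 h1 e0 ek rkr r10 hh V0.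
  rewrite -/mu mulrDr => /le_trans; apply; rewrite lerD2l.
  rewrite le_eqVlt; apply/orP; left; apply/eqP.
  rewrite /M /h /N exprMn [r ^+ _.+1]exprS exprM; field.
  by rewrite gt_eqF//= !expf_neq0// gt_eqF.
have : L <= M * r.
  apply/ler_addgt0Pr => f f0.
  (* The regularisation scale [e] is sent to 0 with the hole fixed, which removes the first term of
     [key]. *)
  pose c := mu * (m%:R / (r ^+ k) ^+ m.+2) + 1.
  have c0 : 0 < c.
    by rewrite ltr_wpDl// mulr_ge0// divr_ge0// !exprn_ge0// ltW.
  pose e := Num.min (r ^+ k) (Num.min 1 (f / c)).
  have e0 : 0 < e by rewrite !lt_min rk0 ltr01 divr_gt0.
  have ek : e <= r ^+ k by rewrite /e ge_min lexx.
  have e1 : e <= 1 by rewrite /e !ge_min lexx orbT.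
  have ef : e <= f / c by rewrite /e !ge_min lexx !orbT.
  apply: le_trans (key e e0 ek) _; rewrite addrC lerD2l.
  apply: (@le_trans _ _ (c * e)); last by rewrite mulrC -ler_pdivlMr.
  rewrite (_ : mu * _ = (mu * (m%:R / (r ^+ k) ^+ m.+2)) * e ^+ 2); last by ring.
  have e2 : e ^+ 2 <= e by rewrite expr2 ler_piMl// ltW.
  apply: (@le_trans _ _ ((mu * (m%:R / (r ^+ k) ^+ m.+2)) * e)).
    by rewrite ler_wpM2l// mulr_ge0// divr_ge0// !exprn_ge0// ltW.
  by rewrite ler_wpM2r ?(ltW e0)// /c lerDl.
move: rL; rewrite ltr_pdivlMr// => rL; lra.
Qed.

End NoHoles.

(** * Differentiability *)

Section Differentiability.
Context {R : realType} {n : nat}.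
Implicit Types (A B : set 'rV[R]_n) (x y a : 'rV[R]_n) (r t : R).
(* The library has another [edist]. *)
Local Notation edist := Defs.edist.

Lemma edist_ge0 x A : (0 <= edist x A)%E.
Proof. by apply: le_ereal_inf_tmp => _ [y _ <-]; rewrite lee_fin enorm_ge0. Qed.

Lemma edist_le x A a : A a -> (edist x A <= (enorm (x - a))%:E)%E.
Proof. by move=> Aa; apply: ereal_inf_lbound; exists a. Qed.

Lemma edist_fin x A a : A a -> edist x A \is a fin_num.
Proof.
move=> Aa; rewrite ge0_fin_numE ?edist_ge0//.
by apply: le_lt_trans (edist_le x Aa) _; rewrite ltry.
Qed.

(** Points of [A] outside the ball of radius [3 * r] are farther from [x] than
    [a] is. *)
Lemma edist_approx A B a x r t : B a -> eball a r x -> 0 <= t ->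
  (forall y, A y -> eball a (3 * r) y -> exists2 z, B z & enorm (y - z) <= t) ->
  (edist x B <= edist x A + t%:E)%E.
Proof.
move=> Ba xr t0 AB; rewrite -leeBlDr//; apply: le_ereal_inf_tmp => _ [y Ay <-].
rewrite leeBlDr// -EFinD.
have [/(AB _ Ay)[z Bz yz]|] := pselect (eball a (3 * r) y).
  apply: le_trans (edist_le x Bz) _; rewrite lee_fin.
  by have := enorm_triangle x y z; lra.
rewrite /eball/= => /negP; rewrite -ltNge => yr.
apply: le_trans (edist_le x Ba) _; rewrite lee_fin.
move: xr; rewrite /eball/=; have := enorm_ge0 (x - a).
by have := enorm_triangle y x a; rewrite (enormB y x); lra.
Qed.

Lemma edist_dist A B a x r t : A a -> B a -> eball a r x -> 0 <= t ->
  (forall y, A y -> eball a (3 * r) y -> exists2 z, B z & enorm (y - z) <= t) ->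
  (forall z, B z -> eball a (3 * r) z -> exists2 y, A y & enorm (z - y) <= t) ->
  (`|edist x A - edist x B| <= t%:E)%E.
Proof.
move=> Aa Ba xr t0 AB BA.
have := edist_approx Ba xr t0 AB; have := edist_approx Aa xr t0 BA.
rewrite -(fineK (edist_fin x Aa)) -(fineK (edist_fin x Ba)) -!EFinD abse_EFin !lee_fin.
by move=> h1 h2; rewrite ler_norml; apply/andP; split; lra.
Qed.

(** The approximating graph is the plane itself, with zero polynomial. The additional power in the
    hypothesis leaves 3^(k+1) r after division by r^k. *)
Lemma strongly_differentiable_plane {m : nat} {mn : (m <= n)%N} (S : grass R mn) A a k :
  (0 < k)%N -> A a -> plane S a ->
  (exists2 d : R, 0 < d & forall r, 0 < r -> r < d -> forall x, eball a r x ->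
    (`|edist x A - edist x (plane S)| <= ((3 * r) ^+ k.+1)%:E)%E) ->
  strongly_pointwise_differentiable k A a.
Proof.
move=> k0 Aa Sa [d d0 hd].
pose P (u : subvs_of S) : subvs_of (orthcomp S) := 0.
have P0 u : vsval (P u) = 0 by exact: raddf0.
exists m, mn, S, P => B; have -> : B = plane S.
  apply/seteqP; split => [_ [x _ <-]|x Sx]; first by rewrite P0 addr0; exact: subvsP.
  by exists (vsproj S x) => //; rewrite P0 addr0 vsprojK.
split => //.
  exists (fun=> 0) => x; rewrite big1// => al _; exact: scaler0.
apply: (@squeeze_cvge _ _ _ _ (fun=> 0%E) _ (fun r => (3 ^+ k.+1 * r)%:E)).
- near=> r; have r0 : 0 < r by near: r; exact: nbhs_right_gt.
  have rd : r < d by near: r; exact: nbhs_right_lt.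
  have rk0 : 0 < r ^+ k by rewrite exprn_gt0.
  have hs : (ereal_sup [set `|edist x A - edist x (plane S)|%E | x in eball a r] <=
      ((3 * r) ^+ k.+1)%:E)%E.
    by apply: ge_ereal_sup => _ [x xr <-]; exact: hd.
  have s0 : (0 <= ereal_sup [set `|edist x A - edist x (plane S)|%E | x in eball a r])%E.
    apply: le_trans (ereal_sup_ubound _); last first.
      by exists a => //; rewrite /eball/= subrr enorm0 ltW.
    exact: abse_ge0.
  apply/andP; split; first by rewrite mule_ge0// lee_fin invr_ge0 ltW.
  apply: le_trans (lee_wpmul2l _ hs) _; first by rewrite lee_fin invr_ge0 ltW.
  rewrite -EFinM lee_fin le_eqVlt; apply/orP; left; apply/eqP.
  by rewrite exprMn [r ^+ _.+1]exprS; field; rewrite gt_eqF.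
- exact: cvg_cst.
- apply: cvg_EFin; first exact: nearW.
  rewrite [X in _ --> X](_ : _ = 3 ^+ k.+1 * 0); last by rewrite mulr0.
  apply: cvgM; first exact: cvg_cst.
  by apply: cvg_at_right_filter; exact: cvg_id.
Unshelve. all: by end_near. Qed.

End Differentiability.

(** * Points where the weight off the plane has density zero *)

Section GoodPoints.
Context {R : realType} {m n : nat} {mn : (m <= n)%N} (n_gt0 : (0 < n)%N) (m_gt0 : (0 < m)%N).
Context (V : {measure set (borel (varifold_space R mn)) -> \bar R}) (vV : varifold V).
Implicit Types (S : grass R mn) (a : 'rV[R]_n).

(** Height decay puts the orthogonal projection of each nearby point of the support within the
    required distance; the absence of holes does the same for points of the plane. *)
Lemma sparse_off_differentiable S a k : (2 <= m)%N -> stationary V -> integral_varifold V ->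
  weight_support V a -> plane S a -> sparse_off V S a -> (0 < k)%N ->
  strongly_pointwise_differentiable k (weight_support V) a.
Proof.
move=> m2 sV iV sa Sa spa k0.
have [d1 d10 h1] := height_decay n_gt0 m_gt0 vV sV iV Sa spa (k.+1 * 2).
have [d2 d20 h2] := no_holes n_gt0 m_gt0 vV sV iV m2 sa Sa spa (ltn0Sn k).
apply: (@strongly_differentiable_plane _ _ _ _ S) => //.
exists (Num.min (d1 / 3) (d2 / 3)); first by rewrite lt_min !divr_gt0.
move=> r r0; rewrite lt_min => /andP[rd1 rd2] x xr.
have r30 : 0 < 3 * r by rewrite mulr_gt0.
have t0 : 0 <= (3 * r) ^+ k.+1 by rewrite exprn_ge0// ltW.
apply: (edist_dist sa Sa xr t0) => [y sy ay|z Sz az].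
  exists (y - y *m normal_mx S).
    rewrite /plane/= -normal_mx_eq0 mulmxBl -mulmxA normal_mx_idem.
    by rewrite subrr.
  rewrite opprB addrC subrK enorm_le_sqr// -exprM.
  by apply: (h1 (3 * r)) => //; lra.
have [||y sy zy] := h2 (3 * r) _ _ z Sz az; [by []|lra|].
by exists y => //; rewrite enormB.
Qed.

Lemma not_sparse_off S a : plane S a -> ~ sparse_off V S a ->
  exists N : nat, dense_points V (plane S) N (N.+1%:R^-1) a.
Proof.
move=> Sa /existsNP[e /not_implyP[e0 he]].
exists (maxn (Num.bound (enorm a)) (Num.bound e^-1)); set N := maxn _ _.
split => //.
  rewrite /eball/= subr0; apply/ltW; apply: lt_le_trans (archi_boundP (enorm_ge0 a)) _.
  by rewrite ler_nat leq_maxl.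
move=> d d0; apply: contrapT => hr; apply: he; exists d => // r r0 rd.
rewrite leNgt; apply/negP => mr; apply: hr; exists r; first by rewrite r0.
rewrite (massE vV (measurable_off_plane S a r) (_ : _ `<=` eball a r)); last by move=> y [].
rewrite lte_fin; apply: le_lt_trans mr; rewrite ler_wpM2r ?exprn_ge0 ?(ltW r0)//.
have ei : 0 <= e^-1 by rewrite invr_ge0 ltW.
rewrite -[leRHS]invrK lef_pV2 ?posrE ?ltr0n ?invr_gt0//.
apply: le_trans (ltW (archi_boundP ei)) _; rewrite ler_nat.
by apply: leq_trans (leqnSn _); rewrite leq_maxr.
Qed.

End GoodPoints.

Theorem theoremC (R : realType) (n m : nat) (n_gt0 : (0 < n)%N)
    (m_ge2 : (2 <= m)%N) (m_le_n : (m <= n)%N) (S : grass R m_le_n)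
    (V : {measure set (borel (varifold_space R m_le_n)) -> \bar R}) :
  varifold V -> stationary V -> integral_varifold V ->
  let A := weight_support V in
  hausdorff m [set a | A a /\ a \in grass_vspace S /\
    ~ (forall k : nat, (0 < k)%N -> strongly_pointwise_differentiable k A a)]
  = 0%E.
Proof.
move=> vV sV iV A; have m_gt0 : (0 < m)%N by exact: leq_trans m_ge2.
set B := [set a | _].
(* Failure of vanishing density is a countable union over [N], where [N] bounds the norm of the
   point and 1/(N+1) the density from below. *)
have BD : B `<=` \bigcup_N dense_points V (plane S) N (N.+1%:R^-1).
  move=> a [sa [Sa nd]].
  have [|N aN] := @not_sparse_off _ _ _ _ V vV S a Sa; last by exists N.
  move=> spa; apply: nd => k k0.
  exact: (@sparse_off_differentiable _ _ _ _ n_gt0 m_gt0 V vV S a k m_ge2 sV iV sa Sa spa k0).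
apply/eqP; rewrite eq_le; apply/andP; split; last exact: outer_measure_ge0.
apply: le_trans (le_outer_measure (@hausdorff_outer R m n) _ _ BD) _.
apply: le_trans (outer_measure_sigma_subadditive (@hausdorff_outer R m n) _) _.
rewrite eseries0// => N _ _; apply: dense_points_null => //.
exact: closed_plane.
Qed.
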